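(* Let $\mathcal{M}=[0,S)\times_h\mathbb{S}^{N-1}$ be a model manifold with pole $O$ (see context), let $R_0,R\in(0,S)$ and let $\Omega\subset\mathcal{M}$ be a bounded $C^1$ domain with $\overline B_{R_0}(O)\subset\Omega\subset B_R(O)$. Let $f\in C^0([R_0,S))$, $\varphi\in C^1((R_0,S))$, $\kappa\in C^0((R_0,S))$, and for $r\in(R_0,S)$, $c\in\mathbb{R}$ define $$w(r,c)=\frac{1}{h(r)^{N-1}\int_{R_0}^r\frac{ds}{h(s)^{N-1}}}\left(c-\int_{R_0}^r\int_s^r\Big(\frac{h(t)}{h(s)}\Big)^{N-1}f(t)\,dt\,ds\right).$$ Assume that the problem $$-\Delta u=f(r)\ \text{in }\Omega\setminus\overline B_{R_0}(O),\quad u=0\ \text{on }\partial B_{R_0}(O),\quad u=\varphi(r)\ \text{on }\partial\Omega,\quad u_\nu=\kappa(r)\ \text{on }\partial\Omega$$ admits a solution $u\in C^2(\Omega\setminus\overline B_{R_0}(O))\cap C^1(\overline\Omega\setminus\overline B_{R_0}(O))\cap C^0(\overline\Omega\setminus B_{R_0}(O))$, and suppose that $\varphi'(r)-w(r,\varphi(r))\ge 0$ for all $r\in(R_0,S)$. Then the function $r\mapsto w(r,\varphi(r))-\kappa(r)$ has a zero in $(R_0,S)$. Furthermore, $u$ is radial if: (1) $w(r,\varphi(r))-\kappa(r)\le 0$ for $r\in(R_0,r_0]$, for every zero $r_0$ of $w(\cdot,\varphi(\cdot))-\kappa(\cdot)$. The same conclusion holds if instead of (1) we assume: (2) $w(r,\varphi(r))-\kappa(r)\ge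 0$ for $r\in[r_0,S)$, for every zero $r_0$ of $w(\cdot,\varphi(\cdot))-\kappa(\cdot)$, and $\Omega$ satisfies the interior sphere condition at each point of $\partial\Omega$. In either case, $\Omega$ must be a geodesic ball if at least one of the following holds: (a) $\varphi'(r)-w(r,\varphi(r))>0$ for all $r\in(R_0,S)$; (b) $w(\cdot,\varphi(\cdot))-\kappa(\cdot)$ is monotone (non-increasing or non-decreasing) on $(R_0,S)$, and $\kappa(r)\ne 0$ for all $r\in(R_0,S)$; (c) $w(\cdot,\varphi(\cdot))-\kappa(\cdot)$ is monotone (non-increasing or non-decreasing) on $(R_0,S)$, and $f$ does not vanish identically on any interval $(a,b)\subset(R_0,S)$.
   Context: Model manifold: fix $N\ge 2$, $S\in(0,+\infty]$ and $h\in C^\infty([0,S))$ with $h(r)>0$ for $r\in(0,S)$, $h'(0)=1$ and $h^{(2k)}(0)=0$ for $k=0,1,2,\dots$. $\mathcal{M}=[0,S)\times_h\mathbb{S}^{N-1}$ is the quotient of $[0,S)\times\mathbb{S}^{N-1}$ in which all points of $\{0\}\times\mathbb{S}^{N-1}$ are identified to one point $O$ (the pole), with metric $g=dr^2+h(r)^2g_{\mathbb{S}^{N-1}}$. $r=r(x)$ is the geodesic distance from $x$ to $O$; $B_\rho(O)=\{r<\rho\}$. $\Delta$ is the Laplace–Beltrami operator of $g$; radial means depending only on $r$. $\nu$ is the outward unit normal to $\partial\Omega$ and $u_\nu=\partial u/\partial\nu$. *)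

(* Defs.v *)
From HB Require Import structures.
From mathcomp Require Import all_boot all_order all_algebra.
From mathcomp Require Import all_classical all_reals all_analysis.
Set Implicit Arguments. Unset Strict Implicit. Unset Printing Implicit Defensive.
Import Order.TTheory GRing.Theory Num.Theory.
Import numFieldNormedType.Exports.
Local Open Scope classical_set_scope.
Local Open Scope ring_scope.

(* The model manifold M = [0,S) x_h S^{N-1} is realised through its global  *)
(* polar chart  (r,theta) |-> r*theta  as the Euclidean ball {|x| < S} of    *)
(* R^N (points are row vectors 'rV[R]_N); the pole O is the origin and      *)
(* r(x) = |x| (Euclidean norm).  The metric g = dr^2 + h(r)^2 g_{S^{N-1}}   *)
(* reads, in this chart, g(x) = P + (h(|x|)/|x|)^2 (I - P) with             *)
(* P = x^T x / |x|^2 (and g(0) = I, its continuous extension since h'(0)=1).*)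
Section ModelManifold.
Variables (R : realType) (N : nat).

Definition enorm (x : 'rV[R]_N) : R := Num.sqrt (\sum_i x 0 i ^+ 2).

Definition Mset (S : \bar R) : set 'rV[R]_N := [set x | ((enorm x)%:E < S)%E].

Definition ballO (rho : R) : set 'rV[R]_N := [set x | enorm x < rho].
Definition cballO (rho : R) : set 'rV[R]_N := [set x | enorm x <= rho].

Definition radproj (x : 'rV[R]_N) : 'M[R]_N := (enorm x ^+ 2)^-1 *: (x^T *m x).
Definition gmat (h : R -> R) (x : 'rV[R]_N) : 'M[R]_N :=
  if x == 0 then 1%:M
  else radproj x + (h (enorm x) / enorm x) ^+ 2 *: (1%:M - radproj x).
Definition ginv (h : R -> R) (x : 'rV[R]_N) : 'M[R]_N := invmx (gmat h x).
Definition sqrtdetg (h : R -> R) (x : 'rV[R]_N) : R := Num.sqrt (\det (gmat h x)).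

Definition partial (i : 'I_N) (u : 'rV[R]_N -> R) (x : 'rV[R]_N) : R :=
  'D_(delta_mx 0 i) u x.
Definition grad (u : 'rV[R]_N -> R) (x : 'rV[R]_N) : 'rV[R]_N :=
  \row_i partial i u x.

Definition C1_on (U : set 'rV[R]_N) (u : 'rV[R]_N -> R) : Prop :=
  (forall x, U x -> differentiable u x) /\
  (forall i, {within U, continuous (partial i u)}).
Definition C2_on (U : set 'rV[R]_N) (u : 'rV[R]_N -> R) : Prop :=
  C1_on U u /\ forall i, C1_on U (partial i u).

Definition LaplaceBeltrami (h : R -> R) (u : 'rV[R]_N -> R) (x : 'rV[R]_N) : R :=
  (sqrtdetg h x)^-1 *
  \sum_i partial i (fun y => sqrtdetg h y * \sum_j ginv h y i j * partial j u y) x.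

Definition bdry (A : set 'rV[R]_N) : set 'rV[R]_N := closure A `\` interior A.

Definition local_defining (A : set 'rV[R]_N) (p : 'rV[R]_N)
    (V : set 'rV[R]_N) (rho : 'rV[R]_N -> R) : Prop :=
  [/\ open V, V p, C1_on V rho, (forall x, V x -> grad rho x != 0) &
      (forall x, V x -> (A x <-> rho x < 0))].

Definition C1_domain (A : set 'rV[R]_N) : Prop :=
  [/\ open A, connected A, exists rho0, A `<=` ballO rho0 &
      forall p, bdry A p -> exists V rho, local_defining A p V rho].

Definition outer_normal (h : R -> R) (A : set 'rV[R]_N) (p nu : 'rV[R]_N) : Prop :=
  exists V rho, local_defining A p V rho /\
    nu = (Num.sqrt ((grad rho p *m ginv h p *m (grad rho p)^T) 0 0))^-1 *:
           (grad rho p *m ginv h p).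

Definition C1_curve (S : \bar R) (gamma : R -> 'rV[R]_N) : Prop :=
  (forall t, derivable gamma t 1) /\ continuous (derive1 gamma) /\
  (forall t, 0 <= t <= 1 -> Mset S (gamma t)).
Definition curve_length (h : R -> R) (gamma : R -> 'rV[R]_N) : \bar R :=
  (\int[@lebesgue_measure R]_(t in `[0%R, 1%R])
     (Num.sqrt ((derive1 gamma t *m gmat h (gamma t) *m (derive1 gamma t)^T) 0 0))%:E)%E.
Definition gdist (S : \bar R) (h : R -> R) (p q : 'rV[R]_N) : \bar R :=
  ereal_inf [set curve_length h gamma | gamma in
               [set gamma | C1_curve S gamma /\ gamma 0 = p /\ gamma 1 = q]].
Definition gball (S : \bar R) (h : R -> R) (q : 'rV[R]_N) (rho : R) : set 'rV[R]_N :=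
  [set x | Mset S x /\ (gdist S h q x < rho%:E)%E].

Definition interior_sphere (S : \bar R) (h : R -> R) (A : set 'rV[R]_N) (p : 'rV[R]_N) : Prop :=
  exists q rho, [/\ Mset S q, 0 < rho, gball S h q rho `<=` A & gdist S h q p = rho%:E].

Definition radial_on (D : set 'rV[R]_N) (u : 'rV[R]_N -> R) : Prop :=
  exists g : R -> R, forall x, D x -> u x = g (enorm x).

End ModelManifold.

Definition model_warping (R : realType) (S : \bar R) (h : R -> R) : Prop :=
  [/\
      exists delta : R, 0 < delta /\
        forall n x, - delta < x -> (x%:E < S)%E -> derivable (derive1n n h) x 1,
      (forall r, 0 < r -> (r%:E < S)%E -> 0 < h r),
      derive1 h 0 = 1 &
      forall k, derive1n k.*2 h 0 = 0].

Definition wfun (R : realType) (N : nat) (h f : R -> R) (R0 r c : R) : R :=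
  (h r ^+ N.-1 * \int[@lebesgue_measure R]_(s in `[R0, r]) (h s ^+ N.-1)^-1)^-1 *
  (c - \int[@lebesgue_measure R]_(s in `[R0, r])
          \int[@lebesgue_measure R]_(t in `[s, r]) ((h t / h s) ^+ N.-1 * f t)).

(* Main.v *)
Require Import Defs.
From HB Require Import structures.
From mathcomp Require Import all_boot all_order all_algebra.
From mathcomp Require Import all_classical all_reals all_analysis.
From mathcomp Require Import ring lra.
Import Order.TTheory GRing.Theory Num.Theory.
Import numFieldNormedType.Exports.
Local Open Scope classical_set_scope.
Local Open Scope ring_scope.

(* Let [F] and [H] be the radial functions vanishing at [R0] with [Laplacian F = f] and
   [H' = h^(1-N)].  The radial solutions vanishing on the inner sphere are [k H - F], and
   [w(r, c)] is the slope at [r] of the one taking the value [c] there.  If [k(r)] is the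
   parameter with [k(r) H(r) - F(r) = phi(r)], the sign condition says that [k] is
   nondecreasing.  Let [r1] and [r2] be the smallest and largest radii on the boundary of
   [Omega].  By comparison, [u] lies between the radial solutions with parameters [k(r1)] and
   [k(r2)], and touches them where these radii are attained; there the normal is radial, so
   the Neumann condition gives [w - kappa >= 0] at [r1] and [<= 0] at [r2], whence a zero.
   Under (1), or (2), one of these inequalities is an equality, and Hopf's lemma with the strong
   maximum principle forces [u] to be that radial solution.  Then [k] is constant on [r1, r2],
   so [r1 = r2] in case (a).  In cases (b) and (c), [w - kappa] vanishes on [r1, r2], so [kappa]
   is the slope of [u]; where it is not zero the normal must be radial, and a domain all of
   whose normals are radial is a ball.  Under (c), a non-radial normal at [p] would make all
   radii near [|p|] occur with non-radial normals, so [u] would have zero slope, and hence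
   [f = 0], on an interval. *)

Set Implicit Arguments. Unset Strict Implicit. Unset Printing Implicit Defensive.

(** * Euclidean norm and directional derivatives *)

(** In the polar chart the Laplacian is the operator [LBform], whose second-order matrix has
    eigenvalue 1 along [x] and [stretch] across it. Its coefficient formulas degenerate only at the
    pole, which [R0 > 0] keeps away. The difference of [u] and a radial solution solves the
    homogeneous equation, so the sign of [f] plays no part in the comparison. Five obstacles shape
    the details. Only [Omega] is given as connected, not the region outside the inner ball, so zeros
    are propagated inside [Omega]. At the boundary [u] is only continuous, with a continuous
    extension of its gradient, so Neumann data and Hopf's lemma meet through one-sided quotients
    along the inward radius. Interior spheres are geodesic, whereas the barrier lives on Euclidean
    balls: a tangent Euclidean ball is found inside the geodesic one. Since [f] is given on
    [[R0, S)], it is continued by a constant to the left, which gives the primitives two-sided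
    derivatives at [R0]. Finally, the boundary is merely of class C^1, so a ball is recognised
    through the first exit times of rays from the pole. *)

Lemma pos_below2 (R : realFieldType) (a b : R) : 0 < a -> 0 < b ->
  exists t, [/\ 0 < t, t < a & t < b].
Proof.
move=> a0 b0; exists (Num.min a b / 2).
have m0 : 0 < Num.min a b by rewrite lt_min a0.
have ma : Num.min a b <= a by rewrite ge_min lexx.
have mb : Num.min a b <= b by rewrite ge_min lexx orbT.
by move: (Num.min a b) m0 ma mb => m m0 ma mb; split; lra.
Qed.

Lemma pos_below3 (R : realFieldType) (a b c : R) : 0 < a -> 0 < b -> 0 < c ->
  exists t, [/\ 0 < t, t < a, t < b & t < c].
Proof.
move=> a0 b0 c0; have [s [s0 sa sb]] := pos_below2 a0 b0.
by have [t [t0 ts tc]] := pos_below2 s0 c0; exists t; split=> //; [exact: lt_trans sa|exact: lt_trans sb].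
Qed.

Section Euclidean.
Variables (R : realType) (N : nat).
Local Notation E := 'rV[R]_N.
Implicit Types (x y z v : E) (a b t : R).

Definition dot x y : R := \sum_i x 0 i * y 0 i.

Lemma dim_gt0 x : x != 0 -> (0 < N)%N.
Proof.
rewrite lt0n => x0; apply: contra_neq x0 => N0; apply/rowP => i.
by have := ltn_ord i; rewrite [X in (_ < X)%N]N0.
Qed.

Lemma dotC x y : dot x y = dot y x.
Proof. by apply: eq_bigr => i _; rewrite mulrC. Qed.

Lemma dotDl x y z : dot (x + y) z = dot x z + dot y z.
Proof. by rewrite -big_split; apply: eq_bigr => i _; rewrite mxE mulrDl. Qed.

Lemma dotDr x y z : dot z (x + y) = dot z x + dot z y.
Proof. by rewrite !(dotC z) dotDl. Qed.

Lemma dotZl a x y : dot (a *: x) y = a * dot x y.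
Proof. by rewrite mulr_sumr; apply: eq_bigr => i _; rewrite mxE mulrA. Qed.

Lemma dotZr a x y : dot x (a *: y) = a * dot x y.
Proof. by rewrite !(dotC x) dotZl. Qed.

Lemma dotNl x y : dot (- x) y = - dot x y.
Proof. by rewrite -scaleN1r dotZl mulN1r. Qed.

Lemma dotNr x y : dot x (- y) = - dot x y.
Proof. by rewrite !(dotC x) dotNl. Qed.

Lemma dotBl x y z : dot (x - y) z = dot x z - dot y z.
Proof. by rewrite dotDl dotNl. Qed.

Lemma dotBr x y z : dot z (x - y) = dot z x - dot z y.
Proof. by rewrite dotDr dotNr. Qed.

Lemma dot0l x : dot 0 x = 0.
Proof. by rewrite -(scale0r 0) dotZl mul0r. Qed.

Lemma dot0r x : dot x 0 = 0.
Proof. by rewrite dotC dot0l. Qed.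

Definition dotE := (dotDl, dotDr, dotNl, dotNr, dotZl, dotZr, dot0l, dot0r).

Lemma dotxx_ge0 x : 0 <= dot x x.
Proof. by apply: sumr_ge0 => i _; rewrite -expr2 sqr_ge0. Qed.

Lemma dotxx_eq0 x : (dot x x == 0) = (x == 0).
Proof.
apply/eqP/eqP => [|->]; last exact: dot0l.
move/eqP; rewrite psumr_eq0; last by move=> i _; rewrite -expr2 sqr_ge0.
move=> /allP xi0; apply/rowP => i; rewrite mxE; apply/eqP.
by have := xi0 i (mem_index_enum i); rewrite /= -expr2 sqrf_eq0.
Qed.

Lemma dotxx_gt0 x : (0 < dot x x) = (x != 0).
Proof. by rewrite lt_neqAle dotxx_ge0 andbT eq_sym dotxx_eq0. Qed.

Lemma enormE x : enorm x = Num.sqrt (dot x x).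
Proof. by rewrite /enorm; congr Num.sqrt; apply: eq_bigr => i _; rewrite expr2. Qed.

Lemma enorm_ge0 x : 0 <= enorm x.
Proof. exact: sqrtr_ge0. Qed.

Lemma enorm_sqr x : enorm x ^+ 2 = dot x x.
Proof. by rewrite enormE sqr_sqrtr// dotxx_ge0. Qed.

Lemma enorm_eq0 x : (enorm x == 0) = (x == 0).
Proof. by rewrite -dotxx_eq0 -enorm_sqr sqrf_eq0. Qed.

Lemma enorm_gt0 x : (0 < enorm x) = (x != 0).
Proof. by rewrite lt_neqAle enorm_ge0 andbT eq_sym enorm_eq0. Qed.

Lemma enorm0 : enorm (0 : E) = 0.
Proof. by apply/eqP; rewrite enorm_eq0. Qed.

Lemma enormZ a x : enorm (a *: x) = `|a| * enorm x.
Proof. by rewrite !enormE !dotE mulrA sqrtrM ?sqrtr_sqr -?expr2 ?sqr_ge0// sqrtr_sqr. Qed.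

Lemma enormN x : enorm (- x) = enorm x.
Proof. by rewrite !enormE !dotE opprK. Qed.

Lemma enormB x y : enorm (x - y) = enorm (y - x).
Proof. by rewrite -enormN opprB. Qed.

Lemma enorm_lt x y : (enorm x < enorm y) = (dot x x < dot y y).
Proof. by rewrite -!enorm_sqr ltr_pXn2r// nnegrE enorm_ge0. Qed.

Lemma dot_sqr_le x y : dot x y ^+ 2 <= dot x x * dot y y.
Proof.
have [->|x0] := eqVneq x 0; first by rewrite !dotE mul0r expr0n.
have xx : 0 < dot x x by rewrite dotxx_gt0.
have := dotxx_ge0 (dot x x *: y - dot x y *: x).
rewrite !dotE (dotC y x) => h.
have : 0 <= dot x x * (dot x x * dot y y - dot x y ^+ 2) by nra.
by rewrite pmulr_rge0// subr_ge0.
Qed.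

Lemma normr_dot_le x y : `|dot x y| <= enorm x * enorm y.
Proof.
rewrite -(ler_pXn2r (_ : (0 < 2)%N)) ?nnegrE ?mulr_ge0 ?enorm_ge0//.
by rewrite real_normK ?num_real// exprMn !enorm_sqr dot_sqr_le.
Qed.

Lemma dot_le x y : dot x y <= enorm x * enorm y.
Proof. exact: le_trans (ler_norm _) (normr_dot_le _ _). Qed.

Lemma enormD x y : enorm (x + y) <= enorm x + enorm y.
Proof.
rewrite -(ler_pXn2r (_ : (0 < 2)%N)) ?nnegrE ?addr_ge0 ?enorm_ge0//.
rewrite sqrrD !enorm_sqr !dotE (dotC y x).
have := dot_le x y; rewrite mulr2n; lra.
Qed.

Lemma enorm_distr x y : `|enorm x - enorm y| <= enorm (x - y).
Proof.
have h1 := enormD (x - y) y; have h2 := enormD (y - x) x.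
move: h1 h2; rewrite !subrK (enormB y) => h1 h2.
by rewrite ler_norml; apply/andP; split; lra.
Qed.

Lemma coord_le_enorm x i : `|x 0 i| <= enorm x.
Proof.
rewrite -(ler_pXn2r (_ : (0 < 2)%N)) ?nnegrE ?enorm_ge0//.
rewrite real_normK ?num_real// enorm_sqr /dot (bigD1 i)//= -expr2 lerDl.
by apply: sumr_ge0 => j _; rewrite -expr2 sqr_ge0.
Qed.

Lemma norm_le_enorm x : `|x| <= enorm x.
Proof.
rewrite /Num.norm /= mx_normrE; apply: bigmax_le; first exact: enorm_ge0.
by move=> [i j] _ /=; rewrite ord1 coord_le_enorm.
Qed.

Lemma coord_le_norm x i : `|x 0 i| <= `|x|.
Proof.
rewrite [leRHS]/Num.norm /= mx_normrE.
exact: (le_bigmax _ (fun ij => `|x ij.1 ij.2|) (0, i)).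
Qed.

(** The constant is not sharp: [N + 1] dominates the optimal square root of [N] and is positive even
    for [N = 0], so it can be divided by. *)
Lemma enorm_le_norm x : enorm x <= (N%:R + 1) * `|x|.
Proof.
rewrite -(ler_pXn2r (_ : (0 < 2)%N)) ?nnegrE ?mulr_ge0 ?addr_ge0 ?ler0n ?enorm_ge0//.
rewrite enorm_sqr exprMn.
apply: (@le_trans _ _ (N%:R * `|x| ^+ 2)).
  rewrite /dot mulr_natl -[X in _ *+ X]card_ord -sumr_const ler_sum// => i _.
  rewrite -expr2 -(real_normK (num_real (x 0 i))) ler_pXn2r ?nnegrE//.
  exact: coord_le_norm.
rewrite ler_wpM2r ?sqr_ge0//; have := ler0n R N; nra.
Qed.

(** The topology on row vectors is that of the sup norm; equivalence of the two norms allows every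
    later estimate to use the Euclidean one. *)
Lemma nbhs_enormP x (P : set E) :
  nbhs x P <-> exists2 e, 0 < e & forall y, enorm (y - x) < e -> P y.
Proof.
split=> [/nbhs_ballP[e /= e0 eP]|[e e0 eP]].
  exists e => // y yx; apply: eP; rewrite -ball_normE /= -normrN opprB.
  exact: le_lt_trans (norm_le_enorm _) yx.
have N1 : 0 < N%:R + 1 :> R by rewrite ltr_wpDl.
apply/nbhs_ballP; exists (e / (N%:R + 1)); first by rewrite /= divr_gt0.
move=> y; rewrite -ball_normE /= => yx; apply: eP.
apply: le_lt_trans (enorm_le_norm _) _.
by rewrite -normrN opprB mulrC -ltr_pdivlMr.
Qed.

Lemma open_enormP (P : set E) : open P <->
  forall x, P x -> exists2 e, 0 < e & forall y, enorm (y - x) < e -> P y.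
Proof.
rewrite openE; split=> [h x /h|h x /h]; first by move/nbhs_enormP.
by move=> h'; apply/nbhs_enormP.
Qed.

Lemma closure_enormP (P : set E) x : closure P x <->
  forall e, 0 < e -> exists2 y, P y & enorm (y - x) < e.
Proof.
split=> [cPx e e0|h B /nbhs_enormP[e e0 eB]]; last first.
  by have [y Py /eB] := h e e0; exists y.
have /cPx[y [Py yx]] : nbhs x [set y | enorm (y - x) < e].
  by apply/nbhs_enormP; exists e.
by exists y.
Qed.

Lemma continuous_enormP (A : set E) (f : E -> R) : {within A, continuous f} <->
  forall x, A x -> forall e, 0 < e -> exists2 d, 0 < d &
    forall y, A y -> enorm (y - x) < d -> `|f y - f x| < e.
Proof.
rewrite subspace_continuousP; split=> h x Ax.
  move=> e e0; have /cvgrPdist_lt /(_ e e0) := h x Ax.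
  rewrite near_withinE => /nbhs_enormP[d d0 dP]; exists d => // y Ay yx.
  by rewrite distrC; exact: dP.
apply/cvgrPdist_lt => e e0; rewrite near_withinE; apply/nbhs_enormP.
by have [d d0 dP] := h x Ax e e0; exists d => // y yx Ay; rewrite distrC; exact: dP.
Qed.

Lemma enorm_continuous (A : set E) : {within A, continuous (@enorm R N)}.
Proof.
apply/continuous_enormP => x _ e e0; exists e => // y _.
exact: le_lt_trans (enorm_distr _ _).
Qed.

Lemma bounded_enorm_closed_compact (A : set E) M :
  (forall x, A x -> enorm x <= M) -> closed A -> compact A.
Proof.
move=> AM; apply: bounded_closed_compact; exists M; split; first exact: num_real.
move=> M' MM' x /AM xM; apply: le_trans (norm_le_enorm _) (le_trans xM (ltW _)).
exact: MM'.
Qed.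

Lemma closed_enormP (P : set E) : closed P <->
  forall x, (forall e, 0 < e -> exists2 y, P y & enorm (y - x) < e) -> P x.
Proof.
by split=> h x; [move=> /closure_enormP/h|move=> /closure_enormP; exact: h].
Qed.

Lemma row_sum_coord v : v = \sum_i v 0 i *: delta_mx 0 i.
Proof. exact: row_sum_delta. Qed.

Lemma dot_delta i x : dot x (delta_mx 0 i) = x 0 i.
Proof.
rewrite /dot (bigD1 i)//= big1 ?addr0 => [|j /negPf ji].
  by rewrite mxE !eqxx mulr1.
by rewrite mxE ji andbF mulr0.
Qed.

Lemma grad_dot (f : E -> R) x v : differentiable f x -> 'D_v f x = dot (grad f x) v.
Proof.
move=> fx; rewrite deriveE// {1}(row_sum_coord v) linear_sum; apply: eq_bigr => i _.
by rewrite linearZ /= mxE /partial deriveE// mulrC.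
Qed.

Lemma differentiable_enormP (f : E -> R) x : differentiable f x ->
  forall e, 0 < e -> exists2 d, 0 < d & forall y, enorm (y - x) < d ->
    `|f y - f x - dot (grad f x) (y - x)| <= e * enorm (y - x).
Proof.
move=> fx e e0.
have /diff_locallyx := fx; set k := 'o _ => fE.
have /(littleoP [littleo of k]) /nbhs_enormP[d d0 dP] : 0 < e by [].
exists d => // y yx.
have := fE (y - x); rewrite subrK => ->.
rewrite -grad_dot// deriveE// [X in `|X|](_ : _ = k (y - x)); last by lra.
apply: le_trans (dP _ _) _; first by rewrite subr0.
by rewrite ler_pM2l// norm_le_enorm.
Qed.

End Euclidean.

(** Serves [near_eq_differentiable]: two functions that agree near [x] differ by a function of this
    kind. The expansion with zero linear part has no remainder near [x]. *)
Lemma near0_differentiable (R : realType) (V W : normedModType R) (f : V -> W) x :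
  (\forall y \near x, f y = 0) -> differentiable f x.
Proof.
move=> f0; have fx0 := nbhs_singleton f0.
have zl : linear (cst 0 : V -> W) by move=> a y v; rewrite /cst scaler0 addr0.
pose Z : {linear V -> W} := HB.pack (cst 0 : V -> W) (GRing.isLinear.Build _ _ _ _ _ zl).
have Zc : continuous Z by apply: cst_continuous.
have fE : f \o shift x = cst (f x) + Z +o_ 0 id.
  apply/eqaddoP => e e0; rewrite /= fx0.
  move: f0; rewrite (near_shift 0) subr0; apply: filterS => y /= fy.
  rewrite (_ : _ y = 0) ?normr0 ?(mulr_ge0 (ltW e0))//.
  by change (f (y + x) - (0 + 0) = 0); rewrite fy addr0 subrr.
have dZ := diff_unique Zc fE.
by apply/diff_locallyP; rewrite dZ.
Qed.

Lemma derivable_derive1 (R : realType) (f : R -> R) r :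
  derivable f r 1 -> is_derive r 1 f (derive1 f r).
Proof. by move=> df; rewrite derive1E; exact: derivableP. Qed.

(** * Derivatives along lines and curves, partial derivatives, radial functions *)

Section Differentiation.
Variables (R : realType) (N : nat).
Local Notation E := 'rV[R]_N.
Implicit Types (x y z v : E) (a b t : R) (u w f : E -> R).

Lemma derive_comp1 (g : R -> R) f x v : differentiable f x ->
  derivable g (f x) 1 ->
  differentiable (g \o f) x /\ 'D_v (g \o f) x = derive1 g (f x) * 'D_v f x.
Proof.
move=> df dg; have dg' : differentiable g (f x) by exact/derivable1_diffP.
have dgf : differentiable (g \o f) x by exact: differentiable_comp.
split=> //; rewrite deriveE// diff_comp//= (deriveE _ df) diff1E//.
by rewrite [LHS]mulrC.
Qed.

Lemma is_derive_curve f (c : R -> E) t c' : differentiable f (c t) ->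
  is_derive t 1 c c' -> is_derive t 1 (f \o c) ('D_c' f (c t)).
Proof.
move=> df [dc <-].
have dc' : differentiable c t by exact/derivable1_diffP.
have dfc : differentiable (f \o c) t by exact: differentiable_comp.
apply: DeriveDef; first exact/derivable1_diffP.
by rewrite deriveE// diff_comp//= -(deriveE _ dc') -deriveE.
Qed.

Lemma is_derive_line x v t : is_derive t 1 (fun s : R => x + s *: v) v.
Proof.
have dl : differentiable (fun s : R => x + s *: v) t.
  by apply: differentiableD => //; exact: differentiableZl.
apply: DeriveDef; first exact/derivable1_diffP.
rewrite deriveD//; last exact/derivable1_diffP/differentiableZl.
rewrite derive_cst add0r deriveE; last exact: differentiableZl.
by rewrite diffZl// diff_val scale1r.
Qed.

Lemma continuous_line x v t : {for t, continuous (fun s : R => x + s *: v)}.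
Proof.
apply/differentiable_continuous/derivable1_diffP.
exact: (@ex_derive _ _ _ _ _ _ _ (is_derive_line x v t)).
Qed.

Lemma cvg_dot (T : topologicalType) (k0 : T) (f g : T -> E) :
  (forall i, (fun k => f k 0 i) @ k0 --> f k0 0 i) ->
  (forall i, (fun k => g k 0 i) @ k0 --> g k0 0 i) ->
  (fun k => dot (f k) (g k)) @ k0 --> dot (f k0) (g k0).
Proof.
move=> cf cg; rewrite /dot; elim: (index_enum _) => [|i l IH].
  by rewrite big_nil; under eq_fun do rewrite big_nil; exact: cvg_cst.
rewrite big_cons; under eq_fun do rewrite big_cons.
by apply: cvgD => //; apply: cvgM; [exact: cf|exact: cg].
Qed.

Lemma is_derive_on_line f x v t : differentiable f (x + t *: v) ->
  is_derive t 1 (fun s => f (x + s *: v)) ('D_v f (x + t *: v)).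
Proof.
by move=> df; apply: (@is_derive_curve f (fun s => x + s *: v)) => //; exact: is_derive_line.
Qed.

Lemma differentiable_coordv i x : differentiable (fun y : E => y 0 i : R) x.
Proof. exact: differentiable_coord. Qed.

Lemma derive_coord i x v : 'D_v (fun y : E => y 0 i : R) x = v 0 i.
Proof.
pose f (y : E) : R := y 0 i.
have fl : linear f by move=> a y z; rewrite /f !mxE.
pose F : {linear E -> R} := HB.pack f (GRing.isLinear.Build _ _ _ _ f fl).
rewrite deriveE; last exact: differentiable_coordv.
by rewrite -[fun y => _]/(F : E -> R) diff_lin//; exact: coord_continuous.
Qed.

Lemma partial_coord i j x : partial i (fun y : E => y 0 j : R) x = (i == j)%:R.
Proof. by rewrite /partial derive_coord mxE eqxx eq_sym. Qed.

Lemma differentiable_mul f g x : differentiable f x -> differentiable g x ->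
  differentiable (fun y => f y * g y) x.
Proof. by move=> df dg; exact: differentiableM. Qed.

Lemma partial_mul i f g x : differentiable f x -> differentiable g x ->
  partial i (fun y => f y * g y) x = f x * partial i g x + partial i f x * g x.
Proof.
move=> df dg; rewrite /partial.
rewrite [LHS]deriveM; [|exact: diff_derivable|exact: diff_derivable].
by rewrite [X in _ + X]mulrC.
Qed.

Lemma partial_add i f g x : differentiable f x -> differentiable g x ->
  partial i (fun y => f y + g y) x = partial i f x + partial i g x.
Proof. by move=> df dg; apply: deriveD; exact: diff_derivable. Qed.

Lemma partial_scale i (k : R) f x : differentiable f x ->
  partial i (fun y => k * f y) x = k * partial i f x.
Proof. by move=> df; apply: deriveZ; exact: diff_derivable. Qed.

Lemma differentiable_sumf (I : finType) (f : I -> E -> R) x :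
  (forall i, differentiable (f i) x) -> differentiable (fun y => \sum_i f i y) x.
Proof.
move=> df; rewrite -[fun y => _]fct_sumE.
by elim/big_rec : _ => [|i h _ dh]; [exact: differentiable_cst|exact: differentiableD].
Qed.

Lemma partial_sum (I : finType) i (f : I -> E -> R) x :
  (forall j, differentiable (f j) x) ->
  partial i (fun y => \sum_j f j y) x = \sum_j partial i (f j) x.
Proof.
move=> df; rewrite /partial -[fun y => _]fct_sumE.
suff: differentiable (\sum_j f j) x /\
    'D_(delta_mx 0 i) (\sum_j f j) x = \sum_j 'D_(delta_mx 0 i) (f j) x by case.
elim/big_ind2 : _ => [|h1 s1 h2 s2 [d1 e1] [d2 e2]|j _]; last by [].
  by split; [exact: differentiable_cst|exact: derive_cst].
split; first exact: differentiableD.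
by rewrite deriveD ?e1 ?e2//; exact: diff_derivable.
Qed.

Lemma near_eq_partial i f g x : (\forall y \near x, f y = g y) ->
  partial i f x = partial i g x.
Proof. exact: near_eq_derive. Qed.

Lemma near_eq_differentiable f g x : (\forall y \near x, f y = g y) ->
  differentiable f x -> differentiable g x.
Proof.
move=> fg df; rewrite (_ : g = f + (fun y => g y - f y)); last first.
  by apply/funext => y; rewrite fctE; ring.
apply: differentiableD => //; apply: near0_differentiable.
by apply: filterS fg => y ->; rewrite subrr.
Qed.

Lemma differentiable_dot c x : differentiable (fun y => dot (y - c) (y - c)) x.
Proof.
rewrite /dot; apply: differentiable_sumf => i.
have h : differentiable (fun y : E => (y - c) 0 i : R) x.
  rewrite (_ : (fun _ => _) = fun y : E => y 0 i + (- c 0 i)); last first.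
    by apply/funext => y; rewrite !mxE.
  by apply: differentiableD => //; exact: differentiable_coordv.
exact: differentiable_mul.
Qed.

Lemma derive_dot c x v : 'D_v (fun y => dot (y - c) (y - c)) x = 2 * dot (x - c) v.
Proof.
rewrite grad_dot; last exact: differentiable_dot.
rewrite /dot mulr_sumr; apply: eq_bigr => i _; rewrite mxE.
have h j : differentiable (fun y : E => (y - c) 0 j : R) x /\
    partial i (fun y : E => (y - c) 0 j : R) x = (i == j)%:R.
  rewrite (_ : (fun _ => _) = fun y : E => y 0 j + (- c 0 j)); last first.
    by apply/funext => y; rewrite !mxE.
  split; first by apply: differentiableD => //; exact: differentiable_coordv.
  rewrite partial_add//; last exact: differentiable_coordv.
  by rewrite partial_coord /partial derive_cst addr0.
rewrite partial_sum => [|j]; last by apply: differentiable_mul; case: (h j).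
rewrite (bigD1 i)//= big1 ?addr0 => [|j /negPf ji].
  by case: (h i) => d e; rewrite partial_mul// e eqxx mulr1n; ring.
by case: (h j) => d e; rewrite partial_mul// e eq_sym ji mulr0n; ring.
Qed.

(** Writing [x - 0] gives the norm the shape of [differentiable_dot] and [derive_dot] with centre
    0. *)
Lemma enorm_dotE x : enorm x = Num.sqrt (dot (x - 0) (x - 0)).
Proof. by rewrite subr0 enormE. Qed.

Lemma differentiable_enorm x : x != 0 -> differentiable (@enorm R N) x.
Proof.
move=> x0; rewrite (_ : @enorm R N = Num.sqrt \o (fun y => dot (y - 0) (y - 0))).
  apply: (derive_comp1 0 _ _).1; first exact: differentiable_dot.
  apply: ex_derive; apply: is_derive1_sqrt.
  by rewrite subr0 dotxx_gt0.
by apply/funext => y; rewrite /= enorm_dotE.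
Qed.

Lemma derive_enorm x v : x != 0 -> 'D_v (@enorm R N) x = dot x v / enorm x.
Proof.
move=> x0; rewrite (_ : @enorm R N = Num.sqrt \o (fun y => dot (y - 0) (y - 0))).
  have xx : 0 < dot (x - 0) (x - 0) by rewrite subr0 dotxx_gt0.
  have [_ ->] := derive_comp1 v (differentiable_dot 0 x) (@ex_derive _ _ _ _ _ _ _ (is_derive1_sqrt xx)).
  rewrite derive_dot derive1E derive_sqrt// subr0 /= subr0 -enormE.
  have := enorm_gt0 x; rewrite x0 => e0.
  by field; rewrite gt_eqF.
by apply/funext => y; rewrite /= enorm_dotE.
Qed.

Lemma differentiable_radial (g : R -> R) x : x != 0 -> derivable g (enorm x) 1 ->
  differentiable (fun y => g (enorm y)) x.
Proof.
by move=> x0 dg; apply: (derive_comp1 0 _ dg).1; exact: differentiable_enorm.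
Qed.

Lemma partial_radial i (g : R -> R) x : x != 0 -> derivable g (enorm x) 1 ->
  partial i (fun y => g (enorm y)) x = derive1 g (enorm x) * (x 0 i / enorm x).
Proof.
move=> x0 dg; rewrite /partial.
have [_ ->] := derive_comp1 (delta_mx 0 i) (differentiable_enorm x0) dg.
by rewrite derive_enorm// dot_delta.
Qed.

End Differentiation.

(** * The Laplace-Beltrami operator in the polar chart *)

Section MatrixDeterminant.
Variables (R : comNzRingType) (n : nat).

(* Both sides are the determinant of [[1, -v], [u, 1]], eliminated in two ways. *)
Lemma det_1_add_rank1 (u : 'cV[R]_n) (v : 'rV[R]_n) :
  \det (1%:M + u *m v) = 1 + (v *m u) 0 0.
Proof.
pose M := block_mx 1%:M (- v) u 1%:M.
have e1 : block_mx 1%:M 0 (- u) 1%:M *m M = block_mx 1%:M (- v) 0 (1%:M + u *m v).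
  by rewrite mulmx_block !mul1mx !mul0mx !addr0 mulmx1 addNr mulNmx mulmxN opprK addrC.
have e2 : block_mx 1%:M v 0 1%:M *m M = block_mx (1%:M + v *m u) 0 u 1%:M.
  by rewrite mulmx_block !mul1mx !mul0mx !add0r mulmx1 addNr.
have := congr1 determinant e1; have := congr1 determinant e2.
rewrite !det_mulmx !det_ublock !det_lblock !det1 !mul1r mulr1 => d2 d1.
by rewrite -d1 d2 det_mx11 !mxE eqxx.
Qed.

End MatrixDeterminant.

Section Metric.
Variables (R : realType) (N : nat) (h : R -> R).
Local Notation E := 'rV[R]_N.
Implicit Types (x y v : E).

Definition stretch (r : R) : R := (r / h r) ^+ 2.

Lemma dot_mulmx x y : dot x y = (x *m y^T) 0 0.
Proof. by rewrite mxE; apply: eq_bigr => i _; rewrite mxE. Qed.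

Lemma mul_outer x y v : v *m (x^T *m y) = dot v x *: y.
Proof. by rewrite mulmxA [v *m _]mx11_scalar mul_scalar_mx dot_mulmx. Qed.

Lemma radproj_outer x : radproj x = (enorm x ^+ 2)^-1 *: (x^T *m x).
Proof. by []. Qed.

Lemma mulmx_radproj x v : v *m radproj x = (dot v x / enorm x ^+ 2) *: x.
Proof. by rewrite /radproj -scalemxAr mul_outer scalerA mulrC. Qed.

Lemma radproj_idem x : x != 0 -> radproj x *m radproj x = radproj x.
Proof.
move=> x0; have := enorm_gt0 x; rewrite x0 => e0.
rewrite {1}/radproj -scalemxAl -mulmxA mulmx_radproj -enorm_sqr divff ?scale1r//.
by rewrite expf_neq0// gt_eqF.
Qed.

(** The metric has eigenvalue 1 on the radial line and [(h r / r)^2] on its orthogonal complement.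
    The inverse is therefore a combination of the identity and the radial projection, which is
    checked by multiplying out with [radproj_idem]. *)
Lemma ginvE x : x != 0 -> h (enorm x) != 0 ->
  ginv h x = (stretch (enorm x))%:M +
    ((1 - stretch (enorm x)) / enorm x ^+ 2) *: (x^T *m x).
Proof.
move=> x0 h0; have := enorm_gt0 x; rewrite x0 => e0.
set A := stretch _; set c2 := (h (enorm x) / enorm x) ^+ 2.
have c2A : c2 * A = 1 by rewrite /c2 /A /stretch; field; rewrite h0 gt_eqF.
rewrite -scalerA -radproj_outer.
rewrite /ginv /gmat (negPf x0) -/c2.
move: (radproj x) (radproj_idem x0) => P PP.
have AB : (P + c2 *: (1%:M - P)) *m (A%:M + (1 - A) *: P) = 1%:M.
  rewrite mulmxDr mul_mx_scalar -scalemxAr mulmxDl PP -scalemxAl mulmxBl PP mul1mx.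
  rewrite subrr scaler0 addr0 scalerDr scalerA (mulrC A) c2A scale1r scalerBl scale1r.
  by rewrite addrC addrA subrK subrKC.
have [uM _] := mulmx1_unit AB.
by rewrite -[RHS](mulKmx uM) AB mulmx1.
Qed.

(** With [c = h r / r], factoring out [c^2] leaves a rank-one perturbation of the identity, of
    determinant [c^-2] by [det_1_add_rank1]; hence the exponent [N - 1]. *)
Lemma sqrtdetgE x : x != 0 -> 0 < h (enorm x) ->
  sqrtdetg h x = (h (enorm x) / enorm x) ^+ N.-1.
Proof.
move=> x0 h0; have := enorm_gt0 x; rewrite x0 => e0.
set c := h (enorm x) / enorm x; have c0 : 0 < c by rewrite divr_gt0.
rewrite /sqrtdetg /gmat (negPf x0) -/c.
have -> : radproj x + c ^+ 2 *: (1%:M - radproj x) =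
    c ^+ 2 *: (1%:M + ((1 - c ^+ 2) / c ^+ 2 / enorm x ^+ 2) *: x^T *m x).
  rewrite -scalemxAl -[_ *: (x^T *m x)]scalerA -/(radproj x) scalerBr scalerDr.
  rewrite addrCA; congr (_ + _).
  rewrite scalerA mulrCA divff ?expf_neq0 ?gt_eqF// mulr1.
  by rewrite scalerBl scale1r.
rewrite detZ det_1_add_rank1 -scalemxAr mxE -dot_mulmx -enorm_sqr.
rewrite divfK ?expf_neq0 ?gt_eqF//.
have N0 := dim_gt0 x0.
have -> : (c ^+ 2) ^+ N * (1 + (1 - c ^+ 2) / c ^+ 2) = (c ^+ N.-1) ^+ 2.
  rewrite -{1}(prednK N0) exprSr -!exprM mulnC.
  by field; rewrite gt_eqF.
by rewrite sqrtr_sqr ger0_norm// exprn_ge0// ltW.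
Qed.

End Metric.

(** * Hessians, the elliptic operator, and the second-order test at a minimum *)

Section SecondOrder.
Variables (R : realType) (N : nat).
Local Notation E := 'rV[R]_N.
Implicit Types (x y z v d : E) (a b t : R) (u w f : E -> R).

(** Pointwise twice differentiability: just enough for [hess] to be meaningful at [x] and
    additive. *)
Definition D2 u x : Prop :=
  (\forall y \near x, differentiable u y) /\ (forall j, differentiable (partial j u) x).

Definition hess u x : 'M[R]_N := \matrix_(i, j) partial i (partial j u) x.

Definition qform (H : 'M[R]_N) v d : R := dot (v *m H) d.

(** The second-order matrix is [A1 I + A2 x^T x], with eigenvalue [A1] across [x] and
    [A1 + A2 |x|^2] along [x]; in all uses the latter equals 1. *)
Definition ellop (A1 A2 B : R) u x : R :=
  A1 * \tr (hess u x) + A2 * qform (hess u x) x x + B * dot x (grad u x).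

Lemma D2_differentiable u x : D2 u x -> differentiable u x.
Proof. by move=> [/nbhs_singleton]. Qed.

Lemma near_partial_lin u w k j x : D2 u x -> D2 w x ->
  \forall y \near x, partial j (fun z => u z + k * w z) y = partial j u y + k * partial j w y.
Proof.
move=> [nu _] [nw _]; near=> y.
have dw : differentiable w y by near: y.
rewrite partial_add//; [|by near: y|exact: differentiableZ].
by rewrite partial_scale.
Unshelve. all: by end_near. Qed.

Lemma D2_lin u w k x : D2 u x -> D2 w x -> D2 (fun z => u z + k * w z) x.
Proof.
move=> ux wx; split => [|j].
  case: ux wx => [nu _] [nw _]; near=> y.
  by apply: differentiableD; [near: y|apply: differentiableZ; near: y].
apply: (@near_eq_differentiable _ _ (fun y => partial j u y + k * partial j w y)).
  by have := near_partial_lin k j ux wx; apply: filterS => y ->.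
case: ux wx => [_ pu] [_ pw].
by apply: differentiableD; [exact: pu|apply: differentiableZ; exact: pw].
Unshelve. all: by end_near. Qed.

Lemma grad_lin u w k x : D2 u x -> D2 w x ->
  grad (fun z => u z + k * w z) x = grad u x + k *: grad w x.
Proof.
move=> ux wx; apply/rowP => j; rewrite !mxE.
exact: (nbhs_singleton (near_partial_lin k j ux wx)).
Qed.

Lemma hess_lin u w k x : D2 u x -> D2 w x ->
  hess (fun z => u z + k * w z) x = hess u x + k *: hess w x.
Proof.
move=> ux wx; apply/matrixP => i j; rewrite !mxE.
rewrite (near_eq_partial _ (near_partial_lin k j ux wx)).
case: ux wx => [_ pu] [_ pw].
rewrite partial_add//; last exact: differentiableZ.
by rewrite partial_scale.
Qed.

Lemma qformDm (H K : 'M[R]_N) v d : qform (H + K) v d = qform H v d + qform K v d.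
Proof. by rewrite /qform mulmxDr dotDl. Qed.

Lemma qformZm a (H : 'M[R]_N) v d : qform (a *: H) v d = a * qform H v d.
Proof. by rewrite /qform -scalemxAr dotZl. Qed.

Lemma qform_outer x v d : qform (x^T *m x) v d = dot v x * dot x d.
Proof. by rewrite /qform mul_outer dotZl. Qed.

Lemma qform_scalar a v d : qform a%:M v d = a * dot v d.
Proof. by rewrite /qform mul_mx_scalar dotZl. Qed.

Lemma tr_outer x : \tr (x^T *m x) = dot x x.
Proof. by rewrite mxtrace_mulC /mxtrace big_ord1 dot_mulmx. Qed.

Lemma ellop_lin A1 A2 B u w k x : D2 u x -> D2 w x ->
  ellop A1 A2 B (fun z => u z + k * w z) x = ellop A1 A2 B u x + k * ellop A1 A2 B w x.
Proof.
move=> ux wx; rewrite /ellop hess_lin// grad_lin// mxtraceD mxtraceZ qformDm qformZm.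
rewrite dotDr dotZr.
move: (hess u x) (hess w x) (grad u x) (grad w x) => H K v d.
move: (\tr H) (\tr K) (qform H x x) (qform K x x) (dot x v) (dot x d) => p1 p2 p3 p4 p5 p6.
ring.
Qed.

Lemma is_derive_partial_line u j x d : differentiable (partial j u) x ->
  is_derive (0 : R) 1 (fun t => partial j u (x + t *: d)) (dot (grad (partial j u) x) d).
Proof.
move=> du; rewrite -(grad_dot d du).
by have := @is_derive_on_line _ _ (partial j u) x d 0; rewrite scale0r addr0 => /(_ du).
Qed.

Lemma qform_hess u x d :
  qform (hess u x) d d = \sum_j d 0 j * dot (grad (partial j u) x) d.
Proof.
rewrite /qform /dot; apply: eq_bigr => j _; rewrite mulrC; congr (_ * _).
by rewrite mxE; apply: eq_bigr => i _; rewrite !mxE mulrC.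
Qed.

(* If [m < 0] then [g' < 0] just to the right of [0], so that [g] drops below [g 0]. *)
Lemma second_derivative_ge0 (g g' : R -> R) (m : R) :
  (\forall t \near 0, is_derive (t : R) 1 g (g' t)) -> is_derive (0 : R) 1 g' m ->
  (\forall t \near 0, g 0 <= g t) -> g' 0 = 0 /\ 0 <= m.
Proof.
move=> ng dg' ming.
have /nbhs_ballP[e /= e0 eP] : \forall t \near 0, is_derive (t : R) 1 g (g' t) /\ g 0 <= g t.
  by apply: filterI.
have eP' t : `|t| < e -> is_derive t 1 g (g' t) /\ g 0 <= g t.
  by move=> te; apply: eP; rewrite -ball_normE /= sub0r normrN.
have g'0 : g' 0 = 0.
  have [//|dg _] := eP' 0; first by rewrite normr0.
  have : is_derive (0 : R) 1 g 0.
    apply: (@derive1_at_min _ g (- e) e).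
    - by lra.
    - move=> t; rewrite in_itv /= => /andP[t1 t2].
      by have [|d _] := eP' t; [rewrite ltr_norml t1 t2|exact: ex_derive].
    - by rewrite in_itv /=; lra.
    - move=> t; rewrite in_itv /= => /andP[t1 t2].
      by have [|_ d] := eP' t; [rewrite ltr_norml t1 t2|].
  by move=> dg0; rewrite -(@derive_val _ _ _ _ _ _ _ dg) derive_val.
split => //; rewrite leNgt; apply/negP => m0.
have [k [kE kc k0]] := (is_derive1_caratheodory _ _ _).1 dg'.
have /cvgrPdist_lt /(_ (- m)) : k t @[t --> 0] --> k 0 by exact: kc.
rewrite oppr_gt0 => /(_ m0)/nbhs_ballP[s /= s0 sP].
pose t := Num.min e s / 2.
have es0 : 0 < Num.min e s by rewrite lt_min e0 s0.
have t0 : 0 < t by rewrite divr_gt0.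
have te : t < e by rewrite (@lt_le_trans _ _ (Num.min e s)) ?ge_min ?lexx// /t; lra.
have ts : t < s by rewrite (@lt_le_trans _ _ (Num.min e s)) ?ge_min ?lexx ?orbT// /t; lra.
have [||c] := @MVT _ g g' 0 t t0.
- move=> c; rewrite in_itv /= => /andP[c0 ct].
  by have [|d _] := eP' c; [rewrite ger0_norm ?ltW//; lra|].
- apply: derivable_within_continuous => c; rewrite in_itv /= => /andP[c0 ct].
  by have [|d _] := eP' c; [rewrite ger0_norm//; lra|exact: ex_derive].
rewrite in_itv /= => /andP[c0 ct] gt.
have [|_ g0t] := eP' t; first by rewrite ger0_norm ?ltW.
have : k c < 0.
  have := sP c; rewrite /ball /= sub0r normrN gtr0_norm// => /(_ (lt_trans ct ts)).
  by rewrite k0 ltr_norml => /andP[]; lra.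
have := kE c; rewrite g'0 !subr0 => g'c kc0.
have : k c * c * t < 0 by rewrite pmulr_llt0// pmulr_llt0.
by move: gt g0t; rewrite g'c subr0; lra.
Qed.

(** One-variable test along every line through [x]; taking the gradient itself as direction shows
    that it vanishes. *)
Lemma D2_local_min w x : D2 w x -> (\forall y \near x, w x <= w y) ->
  grad w x = 0 /\ forall d, 0 <= qform (hess w x) d d.
Proof.
move=> wx minw.
have H d : dot (grad w x) d = 0 /\ 0 <= qform (hess w x) d d.
  pose g' t := \sum_j d 0 j * partial j w (x + t *: d).
  have lc : continuous (fun t : R => x + t *: d).
    by move=> t; exact: continuous_line.
  have lx : (fun t : R => x + t *: d) @ 0 --> x.
    by have := lc 0; rewrite /continuous_at scale0r addr0.
  have [|||] := @second_derivative_ge0 (fun t => w (x + t *: d)) g' (qform (hess w x) d d).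
  - have : \forall t \near (0 : R), differentiable w (x + t *: d) by exact: (lx _ wx.1).
    apply: filterS => t dw; have := is_derive_on_line dw.
    rewrite grad_dot// /g' /dot => dd; apply: is_derive_eq dd _.
    by apply: eq_bigr => j _; rewrite mxE mulrC.
  - rewrite qform_hess /g'.
    rewrite -[fun t => _](fct_sumE _ _ (fun j t => d 0 j * partial j w (x + t *: d))).
    apply: is_derive_sum => j.
    apply: is_deriveZ; apply: is_derive_partial_line; exact: wx.2.
  - by rewrite scale0r addr0; exact: (lx _ minw).
  rewrite /g' scale0r addr0 => g0 m0; split => //.
  by rewrite -g0 /dot; apply: eq_bigr => j _; rewrite mxE mulrC.
split=> [|d]; last by case: (H d).
by apply/eqP; rewrite -dotxx_eq0; case: (H (grad w x)) => ->.
Qed.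

Lemma qform_delta (H : 'M[R]_N) i j : qform H (delta_mx 0 i) (delta_mx 0 j) = H i j.
Proof. by rewrite /qform dot_delta -rowE mxE. Qed.

Lemma dot_suml (I : finType) (F : I -> E) y : dot (\sum_k F k) y = \sum_k dot (F k) y.
Proof. by apply: (big_morph (fun z => dot z y)) => [a b|]; rewrite ?dotDl ?dot0l. Qed.

(* In the orthonormal splitting along [x], with [d_k = e_k - (x_k/|x|^2) x], the trace
   of [H] is [sum_k H(d_k,d_k) + H(x,x)/|x|^2]. *)
Lemma trace_ge (H : 'M[R]_N) x : x != 0 -> (forall d, 0 <= qform H d d) ->
  qform H x x / enorm x ^+ 2 <= \tr H.
Proof.
move=> x0 H0; have := enorm_gt0 x; rewrite x0 => e0.
have r0 : enorm x ^+ 2 != 0 by rewrite expf_neq0// gt_eqF.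
set r := enorm x ^+ 2 in r0 *.
have : 0 <= \sum_k qform H (delta_mx 0 k - (x 0 k / r) *: x) (delta_mx 0 k - (x 0 k / r) *: x).
  by apply: sumr_ge0.
have -> : \sum_k qform H (delta_mx 0 k - (x 0 k / r) *: x) (delta_mx 0 k - (x 0 k / r) *: x) =
    \tr H - qform H x x / r; last by rewrite subr_ge0.
have e1 : \sum_k (x 0 k / r) * qform H (delta_mx 0 k) x = qform H x x / r.
  have -> : qform H x x = dot ((\sum_k x 0 k *: delta_mx 0 k) *m H) x.
    by rewrite -row_sum_coord.
  rewrite mulmx_suml dot_suml mulr_suml.
  by apply: eq_bigr => k _; rewrite /qform -scalemxAl dotZl; ring.
have e2 : \sum_k (x 0 k / r) * qform H x (delta_mx 0 k) = qform H x x / r.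
  rewrite {2}/qform /dot mulr_suml; apply: eq_bigr => k _.
  by rewrite /qform dot_delta; field.
have e3 : \sum_k (x 0 k / r) ^+ 2 = r^-1.
  transitivity (dot x x / r ^+ 2); last by rewrite -enorm_sqr -/r; field.
  by rewrite /dot mulr_suml; apply: eq_bigr => k _; field.
transitivity (\sum_k (H k k - (x 0 k / r) * qform H (delta_mx 0 k) x
   - (x 0 k / r) * qform H x (delta_mx 0 k) + (x 0 k / r) ^+ 2 * qform H x x)).
  apply: eq_bigr => k _; rewrite -(qform_delta H k k) /qform.
  by rewrite mulmxBl -scalemxAl !(dotBl, dotBr, dotZl, dotZr); ring.
by rewrite big_split /= !sumrB e1 e2 -mulr_suml e3 /mxtrace; ring.
Qed.

(** With [q] the Hessian form at [x], the operator is [A1 (tr - q / |x|^2) + q / |x|^2] once the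
    gradient vanishes; the first term is nonnegative by [trace_ge]. *)
Lemma ellop_min_ge0 A1 A2 B w x : x != 0 -> 0 <= A1 -> A1 + A2 * enorm x ^+ 2 = 1 ->
  D2 w x -> (\forall y \near x, w x <= w y) -> 0 <= ellop A1 A2 B w x.
Proof.
move=> x0 A10 AE wx minw; have [g0 H0] := D2_local_min wx minw.
rewrite /ellop g0 dot0r mulr0 addr0.
have := trace_ge x0 H0; have := enorm_gt0 x; rewrite x0 => e0.
have r0 : 0 < enorm x ^+ 2 by rewrite exprn_gt0.
move: (H0 x) => q0 trq.
move: q0 trq; move: (hess w x) => H; move: (qform H x x) (\tr H) => q tr q0 trq.
have qr0 : 0 <= q / enorm x ^+ 2 by rewrite divr_ge0// ltW.
have -> : A2 = (1 - A1) / enorm x ^+ 2 by rewrite -AE; field; rewrite gt_eqF.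
have := ler_wpM2l A10 trq.
have -> : (1 - A1) / enorm x ^+ 2 * q =
  q / enorm x ^+ 2 - A1 * (q / enorm x ^+ 2).
  by ring.
by lra.
Qed.

End SecondOrder.

Lemma lt_ereal_open (R : realType) (S : \bar R) (r : R) : (r%:E < S)%E ->
  exists2 e, 0 < e & forall s, s < r + e -> (s%:E < S)%E.
Proof.
case: S => [s| |]; last by rewrite ltNge leNye.
  rewrite lte_fin => rs; exists (s - r); first by rewrite subr_gt0.
  by move=> t; rewrite lte_fin; lra.
by move=> _; exists 1 => // s _; rewrite ltry.
Qed.

Section PointwiseDerivatives.
Variables (R : realType) (f g : R -> R) (x df dg : R).
Hypotheses (Df : is_derive x 1 f df) (Dg : is_derive x 1 g dg).

(** The rules are put in pointwise form so that the derivative of an explicit formula can be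
    assembled forwards and then read off. *)
Lemma is_derive_mulf : is_derive x 1 (fun y => f y * g y) (df * g x + f x * dg).
Proof.
have := is_deriveM Df Dg.
by rewrite /GRing.scale /= addrC [g x * _]mulrC.
Qed.

Lemma is_derive_addf : is_derive x 1 (fun y => f y + g y) (df + dg).
Proof. exact: is_deriveD Df Dg. Qed.

Lemma is_derive_subf : is_derive x 1 (fun y => f y - g y) (df - dg).
Proof. exact: is_deriveB Df Dg. Qed.

Lemma is_derive_scalef (k : R) : is_derive x 1 (fun y => k * f y) (k * df).
Proof. exact: is_deriveZ Df. Qed.

Lemma is_derive_expf n : is_derive x 1 (fun y => f y ^+ n) (n%:R * f x ^+ n.-1 * df).
Proof.
by have := is_deriveX n Df; rewrite exprfctE.
Qed.

Lemma is_derive_invf : f x != 0 -> is_derive x 1 (fun y => (f y)^-1) (- df / f x ^+ 2).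
Proof.
move=> fx0; have := is_deriveV fx0 Df.
by rewrite /GRing.scale /= mulNr mulrC -mulNr.
Qed.

End PointwiseDerivatives.

(** * The Laplace-Beltrami operator in non-divergence form *)

Section Operator.
Variables (R : realType) (N : nat).
Local Notation E := 'rV[R]_N.
Implicit Types (x y z v d : E) (a b t r : R) (u w f : E -> R).

Lemma near_neq0 x : x != 0 -> \forall y \near x, y != 0.
Proof.
rewrite -enorm_gt0 => x0; apply/nbhs_enormP; exists (enorm x) => // y yx.
by apply: contraTneq yx => ->; rewrite sub0r enormN ltxx.
Qed.

Lemma near_Mset (S : \bar R) x : Mset S x -> \forall y \near x, Mset S y.
Proof.
move=> /lt_ereal_open[e e0 eS]; apply/nbhs_enormP; exists e => // y yx.
by apply: eS; have := enorm_distr y x; rewrite ler_norml => /andP[]; lra.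
Qed.

Lemma differentiable_dot_grad u x : D2 u x -> differentiable (fun y => dot y (grad u y)) x.
Proof.
move=> [_ pu]; apply: differentiable_sumf => j; apply: differentiable_mul.
  exact: differentiable_coordv.
by rewrite (_ : (fun _ => _) = partial j u)//; apply/funext => y; rewrite mxE.
Qed.

Lemma partial_dot_grad i u x : D2 u x ->
  partial i (fun y => dot y (grad u y)) x = grad u x 0 i + (x *m (hess u x)^T) 0 i.
Proof.
move=> [_ pu]; have gE j : (fun y => grad u y 0 j) = partial j u.
  by apply/funext => y; rewrite mxE.
rewrite partial_sum => [|j]; last first.
  by apply: differentiable_mul; [exact: differentiable_coordv|rewrite gE].
transitivity (\sum_j (x 0 j * hess u x i j + (i == j)%:R * grad u x 0 j)).
  apply: eq_bigr => j _; rewrite partial_mul ?gE//; last exact: differentiable_coordv.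
  by rewrite partial_coord [hess u x i j]mxE.
rewrite big_split /= addrC; congr (_ + _); last first.
  by rewrite [RHS]mxE; apply: eq_bigr => j _; congr (_ * _); rewrite [RHS]mxE.
rewrite (bigD1 i)//= big1 ?addr0 ?eqxx ?mul1r// => j /negPf ji.
by rewrite eq_sym ji mul0r.
Qed.

Lemma qform_tr (H : 'M[R]_N) x : qform H^T x x = qform H x x.
Proof.
rewrite /qform !dot_mulmx.
have -> : x *m H^T *m x^T = (x *m H *m x^T)^T by rewrite !trmx_mul trmxK mulmxA.
by rewrite mxE.
Qed.

(** The field [al grad u + be (x . grad u) x] is the shape that [ginvE] gives to the metric gradient
    times the density. In the factor [N + 1], [N] is the divergence of [x] and 1 comes from
    differentiating [x . grad u]. *)
Lemma divergence_radial_form (al be : R -> R) u x : x != 0 ->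
  derivable al (enorm x) 1 -> derivable be (enorm x) 1 -> D2 u x ->
  \sum_i partial i (fun y => al (enorm y) * partial i u y +
     be (enorm y) * (y 0 i * dot y (grad u y))) x =
  al (enorm x) * \tr (hess u x) + be (enorm x) * qform (hess u x) x x +
  (derive1 al (enorm x) / enorm x + derive1 be (enorm x) * enorm x +
   be (enorm x) * (N%:R + 1)) * dot x (grad u x).
Proof.
move=> x0 da db u2; have := enorm_gt0 x; rewrite x0 => r0.
have dg := differentiable_dot_grad u2.
transitivity (\sum_i (al (enorm x) * hess u x i i +
   derive1 al (enorm x) / enorm x * (x 0 i * grad u x 0 i) +
   be (enorm x) * (x 0 i * (grad u x 0 i + (x *m (hess u x)^T) 0 i) + dot x (grad u x)) +
   derive1 be (enorm x) / enorm x * dot x (grad u x) * (x 0 i * x 0 i))).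
  apply: eq_bigr => i _.
  have dyg : differentiable (fun y : E => y 0 i * dot y (grad u y)) x.
    by apply: differentiable_mul => //; exact: differentiable_coordv.
  have dal := differentiable_radial x0 da.
  have dbe := differentiable_radial x0 db.
  have dpu : differentiable (partial i u) x by case: u2.
  rewrite partial_add; [|exact: differentiable_mul|exact: differentiable_mul].
  rewrite !partial_mul//; last exact: differentiable_coordv.
  rewrite (partial_radial i x0 da) (partial_radial i x0 db) partial_dot_grad//.
  rewrite partial_coord eqxx mulr1n.
  rewrite [hess u x i i]mxE [grad u x 0 i]mxE.
  move: (partial i (partial i u) x) (partial i u x) ((x *m (hess u x)^T) 0 i)
    (dot x (grad u x)) (x 0 i) (enorm x) r0 => p1 p2 p3 p4 p5 r r0.
  by field; rewrite gt_eqF.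
rewrite !big_split /= -!mulr_sumr.
have -> : \sum_i (x 0 i * (grad u x 0 i + (x *m (hess u x)^T) 0 i) + dot x (grad u x)) =
  dot x (grad u x) + qform (hess u x) x x + N%:R * dot x (grad u x).
  rewrite big_split /= sumr_const card_ord mulr_natl; congr (_ + _).
  rewrite -(qform_tr (hess u x)) /qform (dotC _ x) -dotDr.
  by apply: eq_bigr => i _; rewrite [in RHS]mxE.
rewrite -/(\tr (hess u x)) -/(dot x (grad u x)) -/(dot x x) -enorm_sqr.
move: (\tr (hess u x)) (qform (hess u x) x x) (dot x (grad u x)) => p1 p2 p3.
move: (enorm x) r0 => r r0.
by field; rewrite gt_eqF.
Qed.

(** Chosen so that a radial [g] is sent to [g'' + (N - 1) (h' / h) g']: the subtracted term cancels
    the [g' / r] contributed by the trace of the Hessian. *)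
Definition drift (h : R -> R) r : R :=
  N.-1%:R * (derive1 h r / h r - stretch h r / r) / r.

Definition LBform (h : R -> R) u x : R :=
  ellop (stretch h (enorm x)) ((1 - stretch h (enorm x)) / enorm x ^+ 2)
    (drift h (enorm x)) u x.

Lemma LaplaceBeltramiE (S : \bar R) (h : R -> R) u x :
  (forall r, 0 < r -> (r%:E < S)%E -> 0 < h r) ->
  (forall r, 0 < r -> (r%:E < S)%E -> derivable h r 1) ->
  x != 0 -> Mset S x -> D2 u x -> LaplaceBeltrami h u x = LBform h u x.
Proof.
move=> hpos dh x0 xS u2; have := enorm_gt0 x; rewrite x0 => r0.
have h0 := hpos _ r0 xS; have dhr := dh _ r0 xS.
have N0 := dim_gt0 x0.
(* [D] is the volume density; [al] and [be] are [D] times the scalar and the rank-one coefficient of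
   [ginvE]. *)
pose D r := (h r / r) ^+ N.-1.
pose al r := D r * stretch h r.
pose be r := (D r - al r) / r ^+ 2.
rewrite /LaplaceBeltrami.
have -> : \sum_i partial i (fun y => sqrtdetg h y * (\sum_j ginv h y i j * partial j u y)) x =
    \sum_i partial i (fun y => al (enorm y) * partial i u y +
     be (enorm y) * (y 0 i * dot y (grad u y))) x.
  apply: eq_bigr => i _; apply: near_eq_partial.
  near=> y.
  have y0 : y != 0 by near: y; exact: near_neq0.
  have yS : Mset S y by near: y; exact: near_Mset.
  have := enorm_gt0 y; rewrite y0 => s0.
  have hy := hpos _ s0 yS.
  rewrite sqrtdetgE// -/(D (enorm y)) ginvE ?gt_eqF//.
  rewrite (eq_bigr (fun j => stretch h (enorm y) * ((i == j)%:R * grad u y 0 j) +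
      (1 - stretch h (enorm y)) / enorm y ^+ 2 * y 0 i * (y 0 j * grad u y 0 j))); last first.
    move=> j _; rewrite !mxE big_ord1 !mxE -[stretch h _ *+ _]mulr_natr.
    by move: (partial j u y) ((i == j)%:R) (stretch _ _) => p q s; ring.
  rewrite big_split /= -!mulr_sumr -/(dot y (grad u y)).
  have -> : \sum_j (i == j)%:R * grad u y 0 j = partial i u y.
    rewrite (bigD1 i)//= big1 ?addr0 ?eqxx ?mul1r ?mxE// => j /negPf ji.
    by rewrite eq_sym ji mul0r.
  rewrite /be /al; move: (dot y _) (partial i u y) (D _) (stretch _ _) => p q s t.
  by ring.
have r1 : enorm x != 0 by rewrite gt_eqF.
have h1 : h (enorm x) != 0 by rewrite gt_eqF.
have dhx : is_derive (enorm x) 1 h (derive1 h (enorm x)).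
  by rewrite derive1E; exact: derivableP.
have did : is_derive (enorm x) 1 id 1 by exact: is_derive_id.
have dc := is_derive_mulf dhx (is_derive_invf did r1).
have dD := is_derive_expf dc N.-1.
have dst := is_derive_expf (is_derive_mulf did (is_derive_invf dhx h1)) 2.
have dal := is_derive_mulf dD dst.
have dr2 := is_derive_invf (is_derive_expf did 2) (expf_neq0 2 r1).
have dbe := is_derive_mulf (is_derive_subf dD dal) dr2.
rewrite (divergence_radial_form x0 (@ex_derive _ _ _ _ _ _ _ dal) (@ex_derive _ _ _ _ _ _ _ dbe) u2).
rewrite !derive1E (@derive_val _ _ _ _ _ _ _ dal) (@derive_val _ _ _ _ _ _ _ dbe).
rewrite /LBform /ellop /drift sqrtdetgE// /be /al /D /stretch.
move: (\tr (hess u x)) (qform (hess u x) x x) (dot x (grad u x)) => p1 p2 p3.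
move: (derive1 h (enorm x)) (h (enorm x)) h0 h1 => h' k k0 k1.
move: (enorm x) r0 r1 => r r0 r1.
(* Differentiating the power [N.-1] produces the truncated exponent [N.-2], so [N = 1] is treated
   apart. *)
case: N N0 => // -[|m] _ /=.
  by rewrite !expr0; field; rewrite ?k1 ?r1.
have D0 : (k / r) ^+ m != 0 by rewrite expf_neq0// mulf_neq0// invr_neq0.
rewrite !exprS; move: ((k / r) ^+ m) D0 => e e0.
by rewrite -!natr1; field; rewrite ?k1 ?r1 ?e0.
Unshelve. all: by end_near. Qed.

End Operator.

(** * The operator on radial functions; functions of the distance to a point *)

Section RadialAndSpherical.
Variables (R : realType) (N : nat).
Local Notation E := 'rV[R]_N.
Implicit Types (x y z v d c : E) (a b t r : R) (u w f : E -> R).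

Lemma near_enorm x (P : R -> Prop) : (\forall r \near enorm x, P r) ->
  \forall y \near x, P (enorm y).
Proof.
move=> /nbhs_ballP[e /= e0 eP]; apply/nbhs_enormP; exists e => // y yx.
by apply: eP; rewrite -ball_normE /= distrC; exact: le_lt_trans (enorm_distr _ _) yx.
Qed.

Lemma partial_scaled_radial i j (G : R -> R) x (dG : R) : x != 0 ->
  is_derive (enorm x) 1 G dG ->
  differentiable (fun y => G (enorm y) * y 0 j) x /\
  partial i (fun y => G (enorm y) * y 0 j) x =
    dG / enorm x * (x 0 i * x 0 j) + G (enorm x) * (i == j)%:R.
Proof.
move=> x0 dGx; have dG' := @ex_derive _ _ _ _ _ _ _ dGx.
have d1 := differentiable_radial x0 dG'.
split; first by apply: differentiable_mul => //; exact: differentiable_coordv.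
rewrite partial_mul//; last exact: differentiable_coordv.
rewrite partial_radial// partial_coord derive1E (@derive_val _ _ _ _ _ _ _ dGx).
by ring.
Qed.

Lemma D2_radial (g dg : R -> R) (ddg : R) x : x != 0 ->
  (\forall r \near enorm x, is_derive (r : R) 1 g (dg r)) ->
  is_derive (enorm x) 1 dg ddg ->
  [/\ D2 (fun y => g (enorm y)) x,
      grad (fun y => g (enorm y)) x = (dg (enorm x) / enorm x) *: x &
      hess (fun y => g (enorm y)) x =
        ((ddg / enorm x - dg (enorm x) / enorm x ^+ 2) / enorm x) *: (x^T *m x) +
        (dg (enorm x) / enorm x)%:M].
Proof.
move=> x0 ng ddgx; have := enorm_gt0 x; rewrite x0 => r0.
have r1 : enorm x != 0 by rewrite gt_eqF.
have near_partial j : \forall y \near x,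
    partial j (fun y => g (enorm y)) y = dg (enorm y) * (enorm y)^-1 * y 0 j.
  near=> y.
  have y0 : y != 0 by near: y; exact: near_neq0.
  have dgy : is_derive (enorm y) 1 g (dg (enorm y)) by near: y; exact: (near_enorm ng).
  rewrite partial_radial//.
  by rewrite derive1E derive_val mulrA mulrAC.
have dG := is_derive_mulf ddgx (is_derive_invf (is_derive_id (enorm x) 1) r1).
have H i j := partial_scaled_radial i j x0 dG.
split.
- split=> [|j].
    near=> y; apply: differentiable_radial; first by near: y; exact: near_neq0.
    have dgy : is_derive (enorm y) 1 g (dg (enorm y)) by near: y; exact: (near_enorm ng).
    exact: ex_derive.
  apply: (near_eq_differentiable _ (H j j).1).
  by have := near_partial j; apply: filterS => y ->.
- apply/rowP => j; rewrite !mxE.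
  exact: (nbhs_singleton (near_partial j)).
apply/matrixP => i j; rewrite [LHS]mxE (near_eq_partial _ (near_partial j)) (H i j).2.
rewrite !mxE big_ord1 !mxE -[(_ / _) *+ _]mulr_natr.
have -> : (ord0 : 'I_1) = 0 by [].
move: ((i == j)%:R) => k; move: (dg _) => p.
by field.
Unshelve. all: by end_near. Qed.

Lemma LBform_radial (h g dg : R -> R) (ddg : R) x : x != 0 -> h (enorm x) != 0 ->
  (\forall r \near enorm x, is_derive (r : R) 1 g (dg r)) ->
  is_derive (enorm x) 1 dg ddg ->
  LBform h (fun y => g (enorm y)) x =
    ddg + N.-1%:R * (derive1 h (enorm x) / h (enorm x)) * dg (enorm x).
Proof.
move=> x0 h0 ng ddgx; have := enorm_gt0 x; rewrite x0 => r0.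
have [_ gE hE] := D2_radial x0 ng ddgx.
rewrite /LBform /ellop gE hE mxtraceD mxtraceZ tr_outer mxtrace_scalar.
rewrite qformDm qformZm qform_outer qform_scalar dotZr -enorm_sqr /drift /stretch.
have N0 := dim_gt0 x0.
have NE : (N%:R : R) = N.-1%:R + 1 by rewrite natr1 prednK.
rewrite -[_ *+ N]mulr_natr NE.
move: (N.-1%:R) (derive1 h _) (dg _) => n h' p; move: (h _) h0 => k k0.
move: (enorm x) r0 => r r0.
by field; rewrite ?k0 (gt_eqF r0).
Qed.

(** The radial operator is [h^(1-N) (h^(N-1) g')']. Stated through the flux [Q = h^(N-1) g'], it
    reads off the source from a first-order system, which is what repeated primitives provide. *)
Lemma LBform_radial_flux (h g Q : R -> R) (s : R) x : (2 <= N)%N -> x != 0 ->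
  (\forall r \near enorm x, h r != 0) -> derivable h (enorm x) 1 ->
  (\forall r \near enorm x, is_derive (r : R) 1 g (Q r / h r ^+ N.-1)) ->
  is_derive (enorm x) 1 Q (h (enorm x) ^+ N.-1 * s) ->
  D2 (fun y => g (enorm y)) x /\ LBform h (fun y => g (enorm y)) x = s.
Proof.
move=> N2 x0 nh dh ng dQ; have h0 := nbhs_singleton nh.
have dhx : is_derive (enorm x) 1 h (derive1 h (enorm x)).
  by rewrite derive1E; exact: derivableP.
have dflux := is_derive_mulf dQ (is_derive_invf (is_derive_expf dhx N.-1) (expf_neq0 _ h0)).
split; first by have [] := D2_radial x0 ng dflux.
rewrite (LBform_radial x0 h0 ng dflux).
move: (Q _) (derive1 h _) => q h'; move: (h _) h0 => k k0.
case: N N2 => // -[//|n] _ /=; rewrite !exprS.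
have e0 : k ^+ n != 0 by rewrite expf_neq0.
by move: (k ^+ n) e0 => e e0; field; rewrite ?k0 ?e0.
Qed.

(** For the barrier of Hopf's lemma, whose centre [c] is in general not the pole. The squared
    distance keeps the function smooth at [c]. *)
Lemma D2_spherical (p dp ddp : R -> R) c x :
  (forall t, is_derive t 1 p (dp t)) -> (forall t, is_derive t 1 dp (ddp t)) ->
  let q y := dot (y - c) (y - c) in
  [/\ D2 (fun y => p (q y)) x,
      grad (fun y => p (q y)) x = (2 * dp (q x)) *: (x - c) &
      hess (fun y => p (q y)) x =
        (4 * ddp (q x)) *: ((x - c)^T *m (x - c)) + (2 * dp (q x))%:M].
Proof.
move=> dpE ddpE q.
have dq y : differentiable q y by exact: differentiable_dot.
have diffp (P dP : R -> R) y : (forall t, is_derive t 1 P (dP t)) ->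
    differentiable (fun y => P (q y)) y /\
    forall i, partial i (fun y => P (q y)) y = 2 * dP (q y) * (y - c) 0 i.
  move=> DP; have [d1 _] := derive_comp1 0 (dq y) (@ex_derive _ _ _ _ _ _ _ (DP (q y))).
  split=> // i; have [_] := derive_comp1 (delta_mx 0 i) (dq y) (@ex_derive _ _ _ _ _ _ _ (DP (q y))).
  rewrite /partial => ->; rewrite derive1E derive_val derive_dot dot_delta.
  by ring.
have partialE j : partial j (fun y => p (q y)) = fun y => 2 * dp (q y) * (y - c) 0 j.
  by apply/funext => y; rewrite (diffp p dp y dpE).2.
have dcoord j y : differentiable (fun y : E => (y - c) 0 j : R) y.
  rewrite (_ : (fun _ => _) = fun y : E => y 0 j + (- c 0 j)); last first.
    by apply/funext => z; rewrite !mxE.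
  by apply: differentiableD => //; exact: differentiable_coordv.
have pcoord i j y : partial i (fun y : E => (y - c) 0 j : R) y = (i == j)%:R.
  rewrite (_ : (fun _ => _) = fun y : E => y 0 j + (- c 0 j)); last first.
    by apply/funext => z; rewrite !mxE.
  rewrite partial_add//; last exact: differentiable_coordv.
  by rewrite partial_coord /partial derive_cst addr0.
have d2 y : differentiable (fun y => 2 * dp (q y)) y.
  by apply: differentiableZ; have [] := diffp dp ddp y ddpE.
split.
- split=> [|j]; first by near=> y; have [] := diffp p dp y dpE.
  by rewrite partialE; exact: differentiable_mul.
- by apply/rowP => j; rewrite mxE partialE [RHS]mxE.
apply/matrixP => i j; rewrite mxE partialE partial_mul// pcoord partial_scale; last first.
  by have [] := diffp dp ddp x ddpE.
rewrite (diffp dp ddp x ddpE).2 !mxE big_ord1 !mxE -[(2 * dp _) *+ _]mulr_natr.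
have -> : (ord0 : 'I_1) = 0 by [].
by move: ((i == j)%:R) (dp _) (ddp _) => k p1 p2; ring.
Unshelve. all: by end_near. Qed.

End RadialAndSpherical.

(** * Maximum principles *)

Section MaximumPrinciples.
Variables (R : realType) (N : nat).
Local Notation E := 'rV[R]_N.
Implicit Types (x y z v d c p : E) (a b t r s : R) (u w : E -> R).

Lemma elliptic_coefs (h : R -> R) x : x != 0 -> 0 <= stretch h (enorm x) /\
  stretch h (enorm x) + (1 - stretch h (enorm x)) / enorm x ^+ 2 * enorm x ^+ 2 = 1.
Proof.
rewrite -enorm_gt0 => x0; split; first exact: sqr_ge0.
by rewrite divfK ?subrKC// expf_neq0// gt_eqF.
Qed.

(** Because the inequality is strict, an interior minimum contradicts [ellop_min_ge0] directly.
    Equations are brought to this case by a perturbation. *)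
Lemma weak_min_principle (h : R -> R) (K D : set E) w (m : R) :
  compact K -> {within K, continuous w} -> open D -> D `<=` K ->
  (forall x, D x -> [/\ x != 0, D2 w x & LBform h w x < 0]) ->
  (forall x, K x -> ~ D x -> m <= w x) -> forall x, K x -> m <= w x.
Proof.
move=> cK cw oD DK LD mK x Kx.
have [|y yK miny] := EVT_min_rV _ cK cw; first by exists x.
apply: le_trans (miny x (mem_set Kx)).
have [Dy|nDy] := pselect (D y); last by apply: mK => //; exact: set_mem.
have [y0 w2 Lw] := LD y Dy; have [A0 AE] := elliptic_coefs h y0.
suff : 0 <= LBform h w y by rewrite leNgt Lw.
apply: ellop_min_ge0 => //.
have : \forall z \near y, D z by exact: open_nbhs_nbhs.
by apply: filterS => z /DK Kz; apply: miny; exact: mem_set.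
Qed.

(** The right-hand form has eigenvalue [A] across [x] and 1 along [x], and the minimum of the two is
    its ellipticity constant. *)
Lemma quadratic_form_ge (A : R) x y : x != 0 -> 0 <= A ->
  Num.min A 1 * dot y y <= A * dot y y + (1 - A) / enorm x ^+ 2 * dot x y ^+ 2.
Proof.
move=> x0 A0; rewrite enorm_sqr; have := dotxx_ge0 y.
have := dot_sqr_le x y; move: (x0); rewrite -dotxx_gt0.
move: (dot x x) (dot y y) (dot x y) => X Y Z X0 ZXY Y0.
have ZX : 0 <= Z ^+ 2 / X <= Y.
  by apply/andP; split; [rewrite divr_ge0 ?sqr_ge0// ltW|rewrite ler_pdivrMr// mulrC].
have -> : (1 - A) / X * Z ^+ 2 = (1 - A) * (Z ^+ 2 / X) by field; rewrite gt_eqF.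
move: (Z ^+ 2 / X) ZX => V /andP[V0 VY].
by case: (leP A 1) => A1; nra.
Qed.

Lemma coef_bounds (S : \bar R) (h : R -> R) a b :
  (forall r, 0 < r -> (r%:E < S)%E -> 0 < h r) ->
  (forall r, 0 < r -> (r%:E < S)%E -> derivable h r 1) ->
  (forall r, 0 < r -> (r%:E < S)%E -> derivable (derive1 h) r 1) ->
  0 < a -> a <= b -> (b%:E < S)%E ->
  exists lam, [/\ 0 < lam, lam <= 1 & forall r, a <= r <= b ->
    [/\ lam <= stretch h r, stretch h r <= lam^-1 & `|drift N h r| <= lam^-1]].
Proof.
move=> hpos dh ddh a0 ab bS.
have inS r : r \in `[a, b] -> 0 < r /\ (r%:E < S)%E.
  rewrite in_itv /= => /andP[ar rb]; split; first exact: lt_le_trans a0 ar.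
  by apply: le_lt_trans bS; rewrite lee_fin.
have cst : {within `[a, b], continuous (stretch h)}.
  apply: derivable_within_continuous => r /inS[r0 rS].
  have h0 : h r != 0 by rewrite gt_eqF// hpos.
  have D1 : is_derive r 1 h (derive1 h r) by exact/derivable_derive1/dh.
  have D4 := is_derive_expf (is_derive_mulf (is_derive_id r 1) (is_derive_invf D1 h0)) 2.
  exact: (@ex_derive _ _ _ _ _ _ _ D4).
have cdr : {within `[a, b], continuous (fun r => `|drift N h r|)}.
  have cdr : {within `[a, b], continuous (drift N h)}.
    apply: derivable_within_continuous => r /inS[r0 rS].
    have h0 : h r != 0 by rewrite gt_eqF// hpos.
    have r1 : r != 0 by rewrite gt_eqF.
    have D1 : is_derive r 1 h (derive1 h r) by exact/derivable_derive1/dh.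
    have D2 : is_derive r 1 (derive1 h) (derive1 (derive1 h) r).
      by rewrite derive1E; apply: derivableP; exact: ddh.
    have D0 := is_derive_invf (is_derive_id r 1) r1.
    have D3 := is_derive_mulf D2 (is_derive_invf D1 h0).
    have D4 := is_derive_expf (is_derive_mulf (is_derive_id r 1) (is_derive_invf D1 h0)) 2.
    have D5 := is_derive_mulf (is_derive_scalef (is_derive_subf D3 (is_derive_mulf D4 D0)) N.-1%:R) D0.
    exact: (@ex_derive _ _ _ _ _ _ _ D5).
  move=> r; apply: continuous_comp; first exact: cdr.
  exact: norm_continuous.
have [m mI mP] := EVT_min ab cst.
have [M MI MP] := EVT_max ab cst.
have [B BI BP] := EVT_max ab cdr.
have m0 : 0 < stretch h m.
  have [m1 mS] := inS _ mI; rewrite /stretch exprn_gt0// divr_gt0//; exact: hpos.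
(* The sum dominates 1, both maxima and the inverse of the minimum, so the single constant
   [lam = 1 / L] serves all the bounds. *)
pose L := 1 + stretch h M + `|drift N h B| + (stretch h m)^-1.
have mV : 0 < (stretch h m)^-1 by rewrite invr_gt0.
have sM : 0 <= stretch h M by exact: sqr_ge0.
have L0 : 1 <= L by rewrite /L; have := normr_ge0 (drift N h B); lra.
exists L^-1; rewrite invr_gt0 invrK; split; first by lra.
  by rewrite invf_le1//; lra.
move=> r rab; have rI : r \in `[a, b] by rewrite in_itv.
split.
- apply: le_trans (mP _ rI); rewrite -[leRHS]invrK lef_pV2 ?posrE//; last by lra.
  by rewrite /L; have := normr_ge0 (drift N h B); lra.
- by apply: le_trans (MP _ rI) _; rewrite /L; have := normr_ge0 (drift N h B); lra.
by apply: le_trans (BP _ rI) _; rewrite /L; lra.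
Qed.

Lemma within_differentiable (A : set E) u : (forall x, A x -> differentiable u x) ->
  {within A, continuous u}.
Proof.
move=> du; apply: continuous_in_subspaceT => x /set_mem Ax.
exact/differentiable_continuous/du.
Qed.

Lemma closed_shell c a b : closed [set x | a <= enorm (x - c) <= b].
Proof.
apply/closed_enormP => x H /=; apply/andP; split; rewrite leNgt; apply/negP => lt.
  have [|y /= /andP[ay _] yx] := H (a - enorm (x - c)); first by lra.
  have := enorm_distr (y - c) (x - c); rewrite opprB addrA subrK ler_norml.
  by move=> /andP[]; lra.
have [|y /= /andP[_ ay] yx] := H (enorm (x - c) - b); first by lra.
have := enorm_distr (y - c) (x - c); rewrite opprB addrA subrK ler_norml.
by move=> /andP[]; lra.
Qed.

Lemma compact_shell c a b : compact [set x | a <= enorm (x - c) <= b].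
Proof.
apply: (@bounded_enorm_closed_compact _ _ _ (b + enorm c)); last exact: closed_shell.
move=> x /= /andP[_ xb]; rewrite -[x in leLHS](subrK c).
by apply: le_trans (enormD _ _) _; rewrite lerD2r.
Qed.

Lemma open_shell c a b : open [set x | a < enorm (x - c) < b].
Proof.
apply/open_enormP => x /= /andP[ax xb].
exists (Num.min (enorm (x - c) - a) (b - enorm (x - c))); first by rewrite lt_min !subr_gt0 ax.
move=> y; rewrite lt_min => /andP[y1 y2].
have := enorm_distr (y - c) (x - c); rewrite opprB addrA subrK ler_norml.
by move=> /andP[z1 z2]; apply/andP; split; lra.
Qed.

End MaximumPrinciples.

(** * Hopf's boundary point lemma *)

Section Hopf.
Variables (R : realType) (N : nat) (S : \bar R) (h : R -> R).
Local Notation E := 'rV[R]_N.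
Implicit Types (x y z v d c p : E) (a b t r s : R) (u w : E -> R).
Hypothesis hpos : forall r, 0 < r -> (r%:E < S)%E -> 0 < h r.
Hypothesis dh : forall r, 0 < r -> (r%:E < S)%E -> derivable h r 1.
Hypothesis ddh : forall r, 0 < r -> (r%:E < S)%E -> derivable (derive1 h) r 1.

(** A polynomial replacement for Hopf's exponential barrier, in terms of the squared distance [q] to
    the centre: it vanishes at [q = s^2], the base stays at least [s^2] inside the ball, and a large
    [n] takes the role of a large exponent. The [+ 2] leaves an honest power [n] in the second
    derivative. *)
Definition barrier s n (q : R) : R := (2 * s ^+ 2 - q) ^+ n.+2 - (s ^+ 2) ^+ n.+2.
Definition dbarrier s n (q : R) : R := - (n.+2%:R * (2 * s ^+ 2 - q) ^+ n.+1).
Definition ddbarrier s n (q : R) : R := n.+2%:R * (n.+1%:R * (2 * s ^+ 2 - q) ^+ n).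

Lemma is_derive_barrier s n (q : R) : is_derive q 1 (barrier s n) (dbarrier s n q).
Proof.
have D1 := is_derive_subf (is_derive_cst (2 * s ^+ 2) q 1) (is_derive_id q 1).
have D2 := is_derive_subf (is_derive_expf D1 n.+2) (is_derive_cst ((s ^+ 2) ^+ n.+2) q 1).
by apply: is_derive_eq D2 _; rewrite /dbarrier /= /cst sub0r subr0 mulrN1.
Qed.

Lemma is_derive_dbarrier s n (q : R) : is_derive q 1 (dbarrier s n) (ddbarrier s n q).
Proof.
have D1 := is_derive_subf (is_derive_cst (2 * s ^+ 2) q 1) (is_derive_id q 1).
have D2 := is_derive_scalef (is_derive_expf D1 n.+1) (- n.+2%:R).
have -> : dbarrier s n = fun q => - n.+2%:R * (2 * s ^+ 2 - q) ^+ n.+1.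
  by apply/funext => z; rewrite /dbarrier mulNr.
by apply: is_derive_eq D2 _; rewrite /ddbarrier /= /cst sub0r mulrN1 mulrN mulNr opprK.
Qed.

Lemma LBform_barrier_gt0 c s a b : 0 < a -> a <= b -> (b%:E < S)%E -> 0 < s ->
  (forall x, enorm (x - c) <= s -> a <= enorm x <= b) ->
  exists n, forall x, s / 2 < enorm (x - c) < s ->
    D2 (fun y => barrier s n (dot (y - c) (y - c))) x /\
    0 < LBform h (fun y => barrier s n (dot (y - c) (y - c))) x.
Proof.
move=> a0 ab bS s0 ball_ab.
have [lam [l0 l1 coefs]] := coef_bounds N hpos dh ddh a0 ab bS.
have lV : 0 < lam^-1 by rewrite invr_gt0.
(* Bounds the terms that multiply the first derivative of the barrier: the scalar part of the trace,
   the rank-one part [1 - A], at most 1, and the drift with [|x| <= b], [|x - c| <= s]. *)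
pose M := N%:R * lam^-1 + 1 + lam^-1 * (b * s).
have b0 : 0 < b by exact: lt_le_trans ab.
have M0 : 0 < M.
  have h1 : 0 <= N%:R * lam^-1 by rewrite mulr_ge0 ?ler0n// ltW.
  have h2 : 0 < lam^-1 * (b * s) by rewrite !mulr_gt0.
  by rewrite /M; lra.
(* After removal of a common factor, the second-derivative term is at least [s^2 (n + 1) lam],
   because [q >= s^2 / 4] in the shell, and the other terms are at most [4 s^2 M]. *)
have [n nM] : exists n, 4 * M / lam < n%:R.
  exists (Num.bound (4 * M / lam)); apply: archi_boundP.
  by rewrite divr_ge0 ?mulr_ge0// ltW.
exists n => x /andP[x1 x2].
have [d2 gE hE] := D2_spherical c x (is_derive_barrier s n) (is_derive_dbarrier s n).
split=> //; rewrite /LBform /ellop gE hE mxtraceD mxtraceZ tr_outer mxtrace_scalar.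
rewrite qformDm qformZm qform_outer qform_scalar dotZr -[_ *+ N]mulr_natl.
have /andP[xa xb] := ball_ab x (ltW x2).
have x0 : x != 0 by rewrite -enorm_gt0; exact: lt_le_trans xa.
have [c1 c2 c3] : [/\ lam <= stretch h (enorm x), stretch h (enorm x) <= lam^-1 &
    `|drift N h (enorm x)| <= lam^-1] by apply: coefs; rewrite xa.
have Q1 : Num.min (stretch h (enorm x)) 1 * dot (x - c) (x - c) <= _ :=
  quadratic_form_ge (x - c) x0 (le_trans (ltW l0) c1).
have [_ AE] := elliptic_coefs h x0.
have Q2 : lam <= Num.min (stretch h (enorm x)) 1 by rewrite le_min c1.
have B1 : drift N h (enorm x) * dot x (x - c) <= lam^-1 * (b * s).
  apply: le_trans (ler_norm _) _; rewrite normrM ler_pM//.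
  apply: le_trans (normr_dot_le _ _) _.
  by rewrite ler_pM ?enorm_ge0// ltW.
rewrite (dotC _ x) -(enorm_sqr x).
have q1 : s ^+ 2 / 4 < dot (x - c) (x - c).
  by rewrite -enorm_sqr; nra.
have q2 : dot (x - c) (x - c) < s ^+ 2.
  by rewrite -enorm_sqr; nra.
rewrite /dbarrier /ddbarrier [_ ^+ n.+1]exprS.
clear - l0 l1 lV M M0 b0 n nM c1 c2 c3 Q1 AE Q2 B1 q1 q2 x0 xa s0.
move: (dot x (x - c)) (dot (x - c) (x - c)) (stretch h (enorm x)) (drift N h (enorm x))
  c1 c2 c3 Q1 AE Q2 B1 q1 q2.
move: (enorm x) => r Y q A B; move: (Num.min _ _) => mu c1 c2 c3 Q1 AE Q2 B1 q1 q2.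
have m0 : 0 < 2 * s ^+ 2 - q by have := sqr_ge0 s; lra.
have m1 : 2 * s ^+ 2 - q <= 2 * s ^+ 2.
  by rewrite lerBlDr lerDl; have := sqr_ge0 s; lra.
have e0 : 0 < (2 * s ^+ 2 - q) ^+ n by rewrite exprn_gt0.
move: ((2 * s ^+ 2 - q) ^+ n) e0 => e e0; move: (2 * s ^+ 2 - q) m0 m1 => m m0 m1.
have k0 : 0 < n.+2%:R :> R by rewrite ltr0n.
move: (n.+2%:R) k0 => k k0.
pose A2 := (1 - A) / r ^+ 2; rewrite -/A2 in Q1 AE *.
rewrite [X in _ < X](_ : _ = k * e * (4 * n.+1%:R * (A * q + A2 * Y ^+ 2) -
  2 * m * (A * N%:R + A2 * r ^+ 2 + B * Y))); last by ring.
apply: mulr_gt0; first exact: mulr_gt0.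
have N0 : 0 <= N%:R :> R by exact: ler0n.
have T1 : A * N%:R + A2 * r ^+ 2 + B * Y <= M.
  have -> : A2 * r ^+ 2 = 1 - A by lra.
  rewrite /M; have := ler_wpM2r N0 c2; lra.
have T2 : 2 * m * (A * N%:R + A2 * r ^+ 2 + B * Y) <= 2 * m * M by rewrite ler_pM2l// mulr_gt0.
have T3 : 2 * m * M <= 4 * s ^+ 2 * M by rewrite ler_pM2r//; lra.
have T4 : 4 * M < n.+1%:R * lam.
  rewrite -ltr_pdivrMr//; apply: lt_trans nM _; rewrite ltr_nat//.
have T5 : lam * (s ^+ 2 / 4) <= A * q + A2 * Y ^+ 2.
  apply: le_trans Q1; apply: ler_pM => //; [exact: ltW|by rewrite divr_ge0// sqr_ge0|exact: ltW].
have n0 : 0 < n.+1%:R :> R by rewrite ltr0n.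
have T6 : 4 * n.+1%:R * (lam * (s ^+ 2 / 4)) <= 4 * n.+1%:R * (A * q + A2 * Y ^+ 2).
  by rewrite ler_pM2l// mulr_gt0.
have s2 : 0 < s ^+ 2 by rewrite exprn_gt0.
have T7 : 4 * s ^+ 2 * M < 4 * n.+1%:R * (lam * (s ^+ 2 / 4)).
  have -> : 4 * s ^+ 2 * M = s ^+ 2 * (4 * M) by ring.
  have -> : 4 * n.+1%:R * (lam * (s ^+ 2 / 4)) = s ^+ 2 * (n.+1%:R * lam) by field.
  by rewrite ltr_pM2l.
lra.
Qed.

(** Provides the positive slope in Hopf's lemma. At relative depth [t] the base is
    [s^2 (1 + 2t - t^2)], at least [s^2 (1 + t)], and a power of a number above 1 is no smaller than
    that number. *)
Lemma barrier_ge s n t : 0 < s -> 0 <= t <= 1 ->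
  (s ^+ 2) ^+ n.+2 * t <= barrier s n (((1 - t) * s) ^+ 2).
Proof.
move=> s0 /andP[t0 t1]; rewrite /barrier.
have -> : 2 * s ^+ 2 - ((1 - t) * s) ^+ 2 = s ^+ 2 * (1 + 2 * t - t ^+ 2) by ring.
have e0 : 0 < (s ^+ 2) ^+ n.+2 by rewrite !exprn_gt0.
rewrite [X in _ <= X - _]exprMn -{3}[(s ^+ 2) ^+ n.+2]mulr1 -mulrBr ler_pM2l//.
have h1 : 1 <= 1 + 2 * t - t ^+ 2 by nra.
have := ler_eXnr (isT : (0 < n.+2)%N) h1; nra.
Qed.

(** A small multiple of the barrier lies below [w] on both spheres bounding the shell, hence in the
    shell by [weak_min_principle]. The conclusion is linear growth along the inward radius instead
    of a derivative, since [w] is only continuous at [p]. *)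
Lemma hopf c s a b w p : 0 < a -> (b%:E < S)%E -> 0 < s -> enorm (p - c) = s ->
  (forall x, enorm (x - c) <= s -> a <= enorm x <= b) ->
  {within [set x | enorm (x - c) <= s], continuous w} ->
  (forall x, enorm (x - c) < s -> [/\ D2 w x, LBform h w x = 0 & 0 < w x]) ->
  (forall x, enorm (x - c) = s -> 0 <= w x) ->
  exists2 eta, 0 < eta & forall t, 0 <= t <= 1/2 -> eta * t <= w (p + t *: (c - p)).
Proof.
move=> a0 bS s0 pc ball_ab cw wB wS.
have ab : a <= b.
  by have /andP[ap pb] : a <= enorm p <= b by [apply: ball_ab; rewrite pc]; exact: le_trans ap pb.
have [n nP] := LBform_barrier_gt0 a0 ab bS s0 ball_ab.
have KB : [set x | s / 2 <= enorm (x - c) <= s] `<=` [set x | enorm (x - c) <= s].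
  by move=> x /= /andP[].
(* The sphere of radius [s / 2], written as a degenerate shell so that [compact_shell] applies. *)
have [|||x0 x0K x0min] := @EVT_min_rV _ _ w [set x | s / 2 <= enorm (x - c) <= s / 2].
- exists (c + 2^-1 *: (p - c)) => /=.
  rewrite addrAC subrr add0r enormZ pc ger0_norm ?invr_ge0// mulrC.
  by rewrite lexx.
- exact: compact_shell.
- apply: continuous_subspaceW cw => x /= /andP[_]; lra.
move: x0K; rewrite inE /= => /andP[x0K x0K'].
have m0 : 0 < w x0 by have [|_ _] := wB x0; first by lra.
pose psi := barrier s n.
have psi0 : 0 < psi (s ^+ 2 / 4).
  have t01 : 0 <= (1 / 2 : R) <= 1 by apply/andP; split; lra.
  have := barrier_ge n s0 t01; have -> : ((1 - 1 / 2) * s) ^+ 2 = s ^+ 2 / 4 by field.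
  apply: lt_le_trans; rewrite mulr_gt0// ?exprn_gt0//; lra.
(* On the inner sphere [eps psi] is exactly the minimum of [w] there; on the outer sphere [psi]
   vanishes. *)
pose eps := w x0 / psi (s ^+ 2 / 4).
have eps0 : 0 < eps by rewrite divr_gt0.
pose q x := dot (x - c) (x - c).
pose v := fun x => w x + (- eps) * psi (q x).
have vK : forall x, s / 2 <= enorm (x - c) <= s -> 0 <= v x.
  apply: (@weak_min_principle _ _ h [set x | s / 2 <= enorm (x - c) <= s]
      [set x | s / 2 < enorm (x - c) < s]).
  - exact: compact_shell.
  - apply: within_continuousD; first exact: (continuous_subspaceW KB cw).
    apply: within_differentiable => y _.
    apply: differentiableZ.
    apply: (derive_comp1 0 (differentiable_dot c y) _).1.
    exact: (@ex_derive _ _ _ _ _ _ _ (is_derive_barrier s n (q y))).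
  - exact: open_shell.
  - by move=> x /= /andP[x1 x2]; rewrite !ltW.
  - move=> x /= /andP[x1 x2]; have [|d2 L0] := nP x; first by rewrite x1.
    have [d2w Lw _] := wB x x2; have /andP[xa _] := ball_ab x (ltW x2).
    split; first by rewrite -enorm_gt0; exact: lt_le_trans xa.
      exact: D2_lin.
    by rewrite /LBform ellop_lin// -/(LBform h w x) Lw add0r mulNr oppr_lt0 mulr_gt0.
  - move=> x /= /andP[x1 x2] nx; rewrite /v /q -enorm_sqr.
    have [xs|xs] := eqVneq (enorm (x - c)) s.
      rewrite xs /psi /barrier; have -> : 2 * s ^+ 2 - s ^+ 2 = s ^+ 2 by ring.
      by rewrite subrr mulr0 addr0; exact: wS.
    have xs2 : enorm (x - c) = s / 2.
      apply/eqP; rewrite eq_le x1 andbT leNgt; apply/negP => x3; apply: nx.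
      by rewrite x3 lt_neqAle xs.
    have -> : enorm (x - c) ^+ 2 = s ^+ 2 / 4 by rewrite xs2; field.
    rewrite /eps mulNr divfK ?gt_eqF// subr_ge0; apply: x0min.
    by rewrite inE /= xs2 lexx.
exists (eps * (s ^+ 2) ^+ n.+2); first by rewrite mulr_gt0// !exprn_gt0.
move=> t /andP[t0 t1]; set x := p + _.
have xc : x - c = (1 - t) *: (p - c).
  by rewrite /x scalerBl scale1r -scalerN opprB addrAC.
have ex : enorm (x - c) = (1 - t) * s by rewrite xc enormZ pc ger0_norm//; lra.
have := vK x; rewrite ex => /(_ _) vx.
have {}vx : 0 <= v x by apply: vx; apply/andP; split; nra.
move: vx; rewrite /v /q -enorm_sqr ex mulNr subr_ge0; apply: le_trans.
rewrite -mulrA ler_pM2l//; apply: barrier_ge => //; apply/andP; split; lra.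
Qed.

End Hopf.

(** * Propagation in connected sets and annuli *)

Lemma connected_locally_constant (T : topologicalType) (A P : set T) : connected A ->
  (forall x, A x -> P x -> \forall y \near x, A y -> P y) ->
  (forall x, A x -> ~ P x -> \forall y \near x, A y -> ~ P y) ->
  forall x y, A x -> A y -> P x -> P y.
Proof.
move=> cA nP nQ x y Ax Ay Px.
suff : A `&` P = A by move=> AP; have [] : (A `&` P) y by rewrite AP.
apply: cA; first by exists x.
  exists (interior [set z | A z -> P z]); first exact: open_interior.
  apply/seteqP; split=> z /=; first by move=> [Az Pz]; split=> //; exact: nP.
  by move=> [Az /interior_subset/=]; split=> //; auto.
exists (~` interior [set z | A z -> ~ P z]); first exact/open_closedC/open_interior.
apply/seteqP; split=> z /=.
  by move=> [Az Pz]; split=> // /interior_subset /= /(_ Az).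
by move=> [Az nz]; split=> //; apply: contrapT => nPz; apply: nz; exact: nQ.
Qed.

Section Connectivity.
Variables (R : realType) (N : nat).
Local Notation E := 'rV[R]_N.
Implicit Types (x y z v d c p : E) (a b t r s : R) (u w : E -> R).

(** Segments that miss the pole can be projected continuously to spheres, which is how they are used
    both in annuli and for directions. *)
Definition avoids0 x y := forall t, 0 <= t <= 1 -> x + t *: (y - x) != 0.

(** The source of connectedness of annuli in dimension at least two. With [x = 0] it simply supplies
    a nonzero vector. *)
Lemma orthogonal_vector x : (2 <= N)%N -> exists2 z, z != 0 & dot x z = 0.
Proof.
case: N x => // -[//|n] x _.
pose i0 : 'I_n.+2 := ord0; pose i1 : 'I_n.+2 := lift ord0 ord0.
have i01 : i0 != i1 by [].
pose z : 'rV[R]_n.+2 := x 0 i1 *: delta_mx 0 i0 - x 0 i0 *: delta_mx 0 i1.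
have z0 : z 0 i0 = x 0 i1 by rewrite !mxE !eqxx (negPf i01) mulr1 mulr0 subr0.
have z1 : z 0 i1 = - x 0 i0.
  by rewrite !mxE !eqxx [i1 == i0]eq_sym (negPf i01) mulr1 mulr0 sub0r.
have xz : dot x z = 0.
  by rewrite dotBr !dotZr !dot_delta mulrC subrr.
have [zz|] := eqVneq z 0; last by exists z.
exists (delta_mx 0 i0); last first.
  by rewrite dot_delta; move: z1; rewrite zz mxE => /eqP; rewrite eq_sym oppr_eq0 => /eqP.
by apply/eqP => /rowP/(_ i0); rewrite !mxE !eqxx => /eqP; rewrite oner_eq0.
Qed.

Lemma avoids0_orthogonal x z : x != 0 -> z != 0 -> dot x z = 0 -> avoids0 x z.
Proof.
rewrite -!dotxx_gt0 => x0 z0 xz t /andP[t0 t1].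
have -> : x + t *: (z - x) = (1 - t) *: x + t *: z.
  by rewrite scalerBr scalerBl scale1r addrA addrAC.
rewrite -dotxx_gt0 !dotE (dotC z x) xz !mulr0 addr0 add0r.
have [->|tn0] := eqVneq t 0; first by rewrite !mul0r subr0 !mul1r addr0.
have tt : 0 < t by rewrite lt_neqAle eq_sym tn0.
by rewrite ltr_wpDl ?mulr_gt0// !mulr_ge0// ?subr_ge0// ltW.
Qed.

(** If the segment meets the pole, [x] and [y] are opposite, and a vector orthogonal to one is
    orthogonal to both, giving a detour. Its norm is that of [x] so that it stays in the annulus. *)
Lemma avoids0_two_steps x y : (2 <= N)%N -> x != 0 -> y != 0 ->
  exists z, [/\ z != 0, enorm z = enorm x, avoids0 x z & avoids0 z y].
Proof.
move=> N2 x0 y0; have [|] := pselect (avoids0 x y).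
  by exists x; split=> // t _; rewrite subrr scaler0 addr0.
move=> /existsNP[t /not_implyP[/andP[t0 t1] /negP]]; rewrite negbK => /eqP xy.
have tn0 : t != 0 by apply: contraNneq x0 => t00; rewrite -xy t00 scale0r addr0.
have yx : t *: y = (t - 1) *: x.
  move/eqP: xy; rewrite scalerBr addrCA -{1}(scale1r x) -scalerBl addr_eq0 => /eqP ->.
  by rewrite -scaleNr opprB.
have [z z0 xz] := orthogonal_vector x N2.
have ez : 0 < enorm z by rewrite enorm_gt0.
have ex : 0 < enorm x by rewrite enorm_gt0.
pose z' := (enorm x / enorm z) *: z.
have k0 : 0 < enorm x / enorm z by rewrite divr_gt0.
have z'0 : z' != 0 by rewrite scaler_eq0 negb_or z0 gt_eqF.
have xz' : dot x z' = 0 by rewrite dotZr xz mulr0.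
exists z'; split=> //.
- by rewrite enormZ gtr0_norm// divfK// gt_eqF.
- exact: avoids0_orthogonal.
apply: avoids0_orthogonal => //; rewrite dotC.
have : t * dot y z' = 0 by rewrite -dotZl yx dotZl xz' mulr0.
by move/eqP; rewrite mulf_eq0 (negPf tn0) => /eqP.
Qed.

Lemma annulus_locally_constant a b (P : set E) : (2 <= N)%N -> 0 <= a ->
  (forall x, a < enorm x < b -> P x -> \forall y \near x, P y) ->
  (forall x, a < enorm x < b -> ~ P x -> \forall y \near x, ~ P y) ->
  forall x y, a < enorm x < b -> a < enorm y < b -> P x -> P y.
Proof.
move=> N2 a0 nP nQ.
suff H x y : avoids0 x y -> a < enorm x < b -> a < enorm y < b -> P x -> P y.
  move=> x y xab yab Px.
  have x0 : x != 0 by rewrite -enorm_gt0; case/andP: xab => /(le_lt_trans a0).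
  have y0 : y != 0 by rewrite -enorm_gt0; case/andP: yab => /(le_lt_trans a0).
  have [z [z0 zx xz zy]] := avoids0_two_steps N2 x0 y0.
  by apply: (H z y) => //; [rewrite zx|apply: (H x z) => //; rewrite zx].
move=> xy xab yab Px.
pose z t := x + t *: (y - x).
(* The segment itself could enter the inner ball; it is rescaled so that the norm interpolates
   linearly between those of the endpoints. *)
pose g t := ((1 - t) * enorm x + t * enorm y) / enorm (z t) *: z t.
have gE t : 0 <= t <= 1 -> enorm (g t) = (1 - t) * enorm x + t * enorm y.
  move=> t01; have z0 := xy t t01; rewrite /g enormZ -/(z t) -enorm_gt0 in z0 *.
  case/andP: (t01) => t0 t1.
  rewrite ger0_norm ?divfK ?gt_eqF// divr_ge0 ?enorm_ge0//.
  by rewrite addr_ge0// mulr_ge0 ?enorm_ge0// subr_ge0.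
have gab t : 0 <= t <= 1 -> a < enorm (g t) < b.
  move=> t01; rewrite gE//; move: t01 xab yab => /andP[t0 t1] /andP[x1 x2] /andP[y1 y2].
  have [->|tn0] := eqVneq t 0; first by rewrite subr0 mul1r mul0r addr0 x1 x2.
  have tt : 0 < t by rewrite lt_neqAle eq_sym tn0.
  have h1 : 0 < t * (enorm y - a) by rewrite mulr_gt0// subr_gt0.
  have h2 : 0 < t * (b - enorm y) by rewrite mulr_gt0// subr_gt0.
  have h3 : 0 <= (1 - t) * (enorm x - a) by rewrite mulr_ge0// subr_ge0// ltW.
  have h4 : 0 <= (1 - t) * (b - enorm x) by rewrite mulr_ge0// subr_ge0// ltW.
  by apply/andP; split; lra.
have x0 : x != 0 by rewrite -enorm_gt0; case/andP: xab => /(le_lt_trans a0).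
have y0 : y != 0 by rewrite -enorm_gt0; case/andP: yab => /(le_lt_trans a0).
have g0 : g 0 = x.
  by rewrite /g /z scale0r addr0 subr0 mul1r mul0r addr0 divff ?scale1r// enorm_eq0.
have g1 : g 1 = y.
  by rewrite /g /z scale1r subrr mul0r add0r mul1r subrKC divff ?scale1r// enorm_eq0.
have cz t : z @ t --> z t by exact: continuous_line.
have cg t : 0 <= t <= 1 -> g @ t --> g t.
  move=> t01; apply: cvgZ; last exact: cz.
  apply: cvgM.
    apply: cvgD; (apply: cvgM; last exact: cvg_cst); last exact: cvg_id.
    by apply: cvgB; [exact: cvg_cst|exact: cvg_id].
  apply: cvgV; first by rewrite enorm_eq0; exact: xy.
  have ce : {for z t, continuous (@enorm R N)}.
    by apply/differentiable_continuous/differentiable_enorm; exact: xy.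
  exact: (continuous_cvg _ ce (cz t)).
have cI : connected `[(0 : R), 1]%classic.
  by apply/connected_intervalP; exact: interval_is_interval.
have := @connected_locally_constant _ _ (fun t => P (g t)) cI _ _ 0 1.
rewrite g0 g1; apply => //=; rewrite ?in_itv /= ?lexx ?ler01//.
- move=> t; rewrite /= in_itv /= => t01 Pg.
  have : \forall s \near t, P (g s) by exact: (cg t t01 _ (nP _ (gab t t01) Pg)).
  by apply: filterS => s.
- move=> t; rewrite /= in_itv /= => t01 Pg.
  have : \forall s \near t, ~ P (g s) by exact: (cg t t01 _ (nQ _ (gab t t01) Pg)).
  by apply: filterS => s.
Qed.

End Connectivity.

(** * The strong minimum principle *)

Section StrongMinimumPrinciple.
Variables (R : realType) (N : nat) (S : \bar R) (h : R -> R).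
Local Notation E := 'rV[R]_N.
Implicit Types (x y z v d c p : E) (a b t r s : R) (u w : E -> R).
Hypothesis hpos : forall r, 0 < r -> (r%:E < S)%E -> 0 < h r.
Hypothesis dh : forall r, 0 < r -> (r%:E < S)%E -> derivable h r 1.
Hypothesis ddh : forall r, 0 < r -> (r%:E < S)%E -> derivable (derive1 h) r 1.

(* Otherwise Hopf's lemma applies to the largest ball around a nearby point in which [w] is
   positive; it touches the zero set at an interior minimum, where the gradient vanishes. *)
Lemma zero_set_open (D : set E) w x0 : open D ->
  (forall x, D x -> [/\ x != 0, Mset S x, D2 w x, LBform h w x = 0 & 0 <= w x]) ->
  D x0 -> w x0 = 0 -> \forall y \near x0, w y = 0.
Proof.
move=> oD wD Dx0 wx0.
have [x00 x0S _ _ _] := wD _ Dx0.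
have [e1 e10 e1D] := (open_enormP D).1 oD _ Dx0.
have [e2 e20 e2S] := lt_ereal_open x0S.
have ex0 : 0 < enorm x0 by rewrite enorm_gt0.
have four a : 0 < a -> 0 < a / 4 by move=> a0; rewrite divr_gt0.
(* The touching ball about [y] has radius below [e], as [x0] is itself a zero within [e] of [y].
   Everything thus happens within [2 e] of [x0], and this ball must lie in [D], in the manifold and
   away from the pole. *)
have [e [e0]] := pos_below3 (four _ e10) (four _ e20) (four _ ex0).
rewrite !ltr_pdivlMr// => ee1 ee2 ee3.
apply/nbhs_enormP; exists e => // y yx0.
have ballD x : enorm (x - x0) <= 2 * e -> D x.
  by move=> xx0; apply: e1D; apply: le_lt_trans xx0 _; lra.
apply/eqP/negPn/negP => wy0.
pose K := [set x | 0 <= enorm (x - x0) <= 2 * e].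
have cw : {within K, continuous w}.
  apply: within_differentiable => x /= /andP[_ /ballD/wD[_ _ d2 _ _]].
  exact: D2_differentiable.
pose Z := K `&` [set x | w x = 0].
have cZ : compact Z.
  apply: (@bounded_enorm_closed_compact _ _ _ (2 * e + enorm x0)).
    move=> x [/= /andP[_ xb] _]; rewrite -[x in leLHS](subrK x0).
    by apply: le_trans (enormD _ _) _; rewrite lerD2r.
  apply/closed_enormP => x H.
  have Kx : K x.
    apply: ((closed_enormP K).1 (@closed_shell _ _ x0 0 (2 * e))) => d d0.
    by have [z [Kz _] zx] := H d d0; exists z.
  split=> //=; apply/eqP/negPn/negP => wx.
  have wxp : 0 < `|w x| by rewrite normr_gt0.
  have [d d0 dP] := (continuous_enormP _ _).1 cw x Kx `|w x| wxp.
  have [z [Kz /= wz] zx] := H d d0.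
  by have := dP z Kz zx; rewrite wz sub0r normrN ltxx.
have ZX : Z x0 by split=> //; rewrite /K /= subrr enorm0 lexx /=; lra.
have [||z0 /set_mem[/= Kz0 wz0] z0min] := @EVT_min_rV _ _ (fun z => enorm (z - y)) Z _ cZ.
- by exists x0.
- apply/continuous_enormP => x _ d d0; exists d => // z _ zx.
  by have := enorm_distr (z - y) (x - y); rewrite opprB addrA subrK => /le_lt_trans; apply.
pose s := enorm (z0 - y).
have se : s < e by apply: le_lt_trans (z0min x0 (mem_set ZX)) _; rewrite enormB.
have s0 : 0 < s.
  by rewrite enorm_gt0 subr_eq0; apply: contra_neq wy0 => <-.
have near_x0 x : enorm (x - y) <= s -> enorm (x - x0) < 2 * e.
  move=> xy; have := enormD (x - y) (y - x0); rewrite addrA subrK; lra.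
have xD x : enorm (x - y) <= s -> D x by move=> /near_x0/ltW/ballD.
have x_ab x : enorm (x - y) <= s -> enorm x0 / 2 <= enorm x <= enorm x0 + 2 * e.
  move=> /near_x0 xx0; have := enorm_distr x x0; rewrite ler_norml => /andP[h1 h2].
  by apply/andP; split; lra.
have [|||||eta eta0 etaP] := hopf hpos dh ddh (_ : 0 < enorm x0 / 2) (_ : ((enorm x0 + 2 * e)%:E < S)%E)
  s0 (erefl s) x_ab (w := w).
- by rewrite divr_gt0.
- by apply: e2S; lra.
- apply: within_differentiable => x /= /xD/wD[_ _ d2 _ _]; exact: D2_differentiable.
- move=> x xs; have Dx := xD _ (ltW xs); have [_ _ d2 Lw w0] := wD _ Dx.
  split=> //; rewrite lt_neqAle w0 andbT eq_sym; apply/eqP => wx.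
  have Zx : Z x by split=> //; rewrite /K /= enorm_ge0 ltW// near_x0// ltW.
  by have := z0min x (mem_set Zx); rewrite leNgt -/s xs.
- by move=> x xs; have [_ _ _ _] := wD _ (xD x (eq_ind_r (fun r => is_true (r <= s)) (lexx s) xs)).
have Dz0 : D z0 by apply: xD; rewrite lexx.
have [_ _ d2 _ _] := wD _ Dz0.
have [|g0 _] := D2_local_min d2.
  have : \forall z \near z0, D z by exact: open_nbhs_nbhs.
  by apply: filterS => z Dz; rewrite wz0; have [] := wD z Dz.
(* Half of Hopf's slope: with zero gradient, [w] is at most [eta t / 2] at distance [t s] from [z0],
   against the lower bound [eta t]. *)
have k0 : 0 < eta / (2 * s) by rewrite divr_gt0// mulr_gt0.
have [d d0 dP] := differentiable_enormP (D2_differentiable d2) k0.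
have h12 : 0 < 1 / 2 :> R by rewrite divr_gt0.
have [t [t0 t1]] := pos_below2 h12 (divr_gt0 d0 s0); rewrite ltr_pdivlMr// => ts.
have et : enorm (t *: (y - z0)) = t * s by rewrite enormZ gtr0_norm// enormB.
have := dP (z0 + t *: (y - z0)); rewrite addrAC subrr add0r et => /(_ ts).
rewrite wz0 g0 dot0l !subr0 => /(le_trans (ler_norm _)).
have := etaP t; rewrite (ltW t0) (ltW t1) => /(_ isT) h1 h2.
have h3 : eta / (2 * s) * (t * s) = eta * t / 2 by field; rewrite gt_eqF.
have h4 : 0 < eta * t by rewrite mulr_gt0.
by move: h1 h2; rewrite h3; lra.
Qed.

(** Connectedness is known for [Om] only, so the ball of radius [r1] has to be crossed. If [w] has a
    zero in the annulus between [R0] and [r1], it vanishes on that annulus, and the property of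
    lying in the ball or in the zero set propagates through [Om]. Otherwise the zero set alone is
    clopen in [Om]. *)
Lemma strong_min_principle (Om : set E) (R0 r1 : R) w : (2 <= N)%N ->
  open Om -> connected Om -> 0 < R0 -> R0 < r1 -> ballO r1 `<=` Om ->
  (forall x, Om x -> R0 < enorm x ->
     [/\ Mset S x, D2 w x, LBform h w x = 0 & 0 <= w x]) ->
  forall z, Om z -> R0 < enorm z -> w z = 0 ->
  forall x, Om x -> R0 < enorm x -> w x = 0.
Proof.
move=> N2 oOm cOm R00 R0r1 bOm wD z Omz R0z wz.
pose D := Om `&` [set x | R0 < enorm x].
have oE : open [set x : E | R0 < enorm x].
  apply/open_enormP => x /= xR; exists (enorm x - R0); first by rewrite subr_gt0.
  by move=> y yx; have := enorm_distr y x; rewrite ler_norml => /andP[]; lra.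
have oB : open (@ballO R N r1).
  apply/open_enormP => x /= xR; exists (r1 - enorm x); first by rewrite subr_gt0.
  by move=> y yx; have := enorm_distr y x; rewrite ler_norml /ballO /= => /andP[]; lra.
have oD : open D by exact: openI.
have wD' x : D x -> [/\ x != 0, Mset S x, D2 w x, LBform h w x = 0 & 0 <= w x].
  move=> [Omx Rx]; have [] := wD _ Omx Rx; split=> //.
  by rewrite -enorm_gt0; exact: lt_trans Rx.
have nearD x : D x -> \forall y \near x, D y by move=> Dx; exact: open_nbhs_nbhs.
have near0 x : D x -> w x = 0 -> \forall y \near x, w y = 0.
  exact: (zero_set_open oD wD').
have nearn0 x : D x -> w x <> 0 -> \forall y \near x, w y <> 0.
  move=> Dx wx; have [_ _ d2 _ _] := wD' _ Dx.
  have : w @ x --> w x by exact/differentiable_continuous/D2_differentiable.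
  move=> /(_ [set t | t <> 0]); apply.
  have : nbhs (w x) [set t | t != 0] by apply: open_nbhs_nbhs; split; [exact: open_neq|exact/eqP].
  by apply: filterS => t /= /eqP.
have AD x : R0 < enorm x < r1 -> D x by move=> /andP[xR xr]; split=> //; exact: bOm.
have [[a /andP[aA wa]]|nA] := pselect (exists a : E, (R0 < enorm a < r1) && (w a == 0)).
  have wA x : R0 < enorm x < r1 -> w x = 0.
    move=> xA; apply: (@annulus_locally_constant _ _ R0 r1 (fun x => w x = 0) N2 (ltW R00) _ _ a) => //.
    - by move=> y yA; apply: near0; exact: AD.
    - by move=> y yA; apply: nearn0; exact: AD.
    - exact/eqP.
  pose Q x := ballO r1 x \/ w x = 0.
  have H x : Om x -> Q x.
    move=> Omx; apply: (@connected_locally_constant _ _ Q cOm _ _ z) => //; last by right.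
    - move=> y Omy [By|wy].
        have : \forall y' \near y, ballO r1 y' by exact: open_nbhs_nbhs.
        by apply: filterS => y' By' _; left.
      have [yR|yR] := ltP (enorm y) r1.
        have : \forall y' \near y, ballO r1 y' by exact: open_nbhs_nbhs.
        by apply: filterS => y' By' _; left.
      have Dy : D y by split=> //; exact: lt_le_trans yR.
      by apply: filterS (near0 _ Dy wy) => y' wy' _; right.
    - move=> y Omy nQ.
      have yR : r1 <= enorm y by rewrite leNgt; apply/negP => yr; apply: nQ; left.
      have Dy : D y by split=> //; exact: lt_le_trans yR.
      have wy : w y <> 0 by move=> wy; apply: nQ; right.
      have : \forall y' \near y, w y' <> 0 /\ D y'.
        by apply: filterI; [exact: nearn0|exact: nearD].
      apply: filterS => y' [wy' [_ Ry']] _ [By'|//].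
      by apply: wy'; apply: wA; rewrite Ry'.
  move=> x Omx xR; have [Bx|//] := H x Omx.
  by apply: wA; rewrite xR.
pose Q x := R0 < enorm x /\ w x = 0.
have nQA x : ballO r1 x -> ~ Q x.
  by move=> xr [xR wx]; apply: nA; exists x; rewrite xR xr wx eqxx.
have Om0 : Om 0 by apply: bOm; rewrite /ballO /= enorm0; exact: lt_trans R0r1.
(* The zero set keeps away from the annulus, so it is open and closed in [Om]; by connectedness it
   would contain the pole, where [Q] fails. *)
have : Q 0.
  apply: (@connected_locally_constant _ _ Q cOm _ _ z) => //.
  - move=> y Omy [yR wy]; have Dy : D y by split.
    have : \forall y' \near y, w y' = 0 /\ D y'.
      by apply: filterI; [exact: near0|exact: nearD].
    by apply: filterS => y' [wy' [_ Ry']] _; split.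
  - move=> y Omy nQ.
    have [yR|yR] := ltP (enorm y) r1.
      have : \forall y' \near y, ballO r1 y' by exact: open_nbhs_nbhs.
      by apply: filterS => y' By' _; exact: nQA.
    have Dy : D y by split=> //; exact: lt_le_trans yR.
    have wy : w y <> 0 by move=> wy; apply: nQ; split=> //; exact: lt_le_trans yR.
    by apply: filterS (nearn0 _ Dy wy) => y' wy' _ [_].
by case; rewrite enorm0 ltNge ltW.
Qed.

End StrongMinimumPrinciple.

(** * Radial solutions and the function w *)

Section RadialCalculus.
Variable R : realType.
Implicit Types (S : \bar R) (f g G h : R -> R) (a b r s t c : R).
Local Notation mu := (@lebesgue_measure R).

Lemma is_derive_continuous g (dg r : R) : is_derive r 1 g dg -> {for r, continuous g}.
Proof.
move=> Dg; apply: differentiable_continuous; apply/derivable1_diffP.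
exact: (@ex_derive _ _ _ _ _ _ _ Dg).
Qed.

Lemma continuous_within_segment g a b : (forall r, a <= r <= b -> {for r, continuous g}) ->
  {within `[a, b], continuous g}.
Proof.
move=> cg; apply: continuous_in_subspaceT => r /set_mem; rewrite /= in_itv /=.
exact: cg.
Qed.

Lemma integral_FTC2 g G a b : a < b ->
  (forall r, a <= r <= b -> is_derive r 1 G (g r)) ->
  (forall r, a <= r <= b -> {for r, continuous g}) ->
  (\int[mu]_(t in `[a, b]) (g t)%:E = (G b - G a)%:E)%E.
Proof.
move=> ab DG cg.
have cG r : a <= r <= b -> {for r, continuous G} by move=> /DG/is_derive_continuous.
rewrite (@continuous_FTC2 _ g G)//.
- exact: continuous_within_segment.
- split.
  + move=> r; rewrite in_itv /= => /andP[ar rb].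
    have [|Dr _] := DG r; first by rewrite !ltW.
    exact: Dr.
  + by apply: cvg_at_right_filter; apply: cG; rewrite lexx ltW.
  + by apply: cvg_at_left_filter; apply: cG; rewrite lexx ltW.
- move=> r; rewrite in_itv /= => /andP[ar rb].
  have Dr : is_derive r 1 G (g r) by apply: DG; rewrite !ltW.
  by rewrite derive1E (@derive_val _ _ _ _ _ _ _ Dr).
Qed.

Lemma Rintegral_FTC2 g G a b : a <= b ->
  (forall r, a <= r <= b -> is_derive r 1 G (g r)) ->
  (forall r, a <= r <= b -> {for r, continuous g}) ->
  \int[mu]_(t in `[a, b]) g t = G b - G a.
Proof.
rewrite le_eqVlt => /predU1P[-> _ _|ab DG cg].
  by rewrite set_itv1 Rintegral_set1 subrr.
by rewrite /Rintegral (integral_FTC2 ab DG cg).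
Qed.

(** Integration starts at a point [b] strictly between [a] and [R0], so that the primitive has a
    two-sided derivative at [R0] too; a constant then makes it vanish there. *)
Lemma primitive_exists S a R0 g : a < R0 -> (R0%:E < S)%E ->
  (forall r, a < r -> (r%:E < S)%E -> {for r, continuous g}) ->
  exists G b, [/\ a < b, b < R0, G R0 = 0 &
    forall r, b < r -> (r%:E < S)%E -> is_derive r 1 G (g r)].
Proof.
move=> aR0 R0S cg; pose b := (a + R0) / 2.
have ab : a < b by rewrite /b; lra.
have bR0 : b < R0 by rewrite /b; lra.
pose G0 r := \int[mu]_(t in `[b, r]) g t.
exists (fun r => G0 r - G0 R0), b; split=> //; first by rewrite subrr.
move=> r br rS; have [e e0 eS] := lt_ereal_open rS.
have ru : r < r + e / 2 by rewrite ltrDl divr_gt0.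
have ig : mu.-integrable `[b, (r + e / 2)] (EFin \o g).
  apply: continuous_compact_integrable; first exact: segment_compact.
  apply: continuous_within_segment => t /andP[bt tr]; apply: cg; first exact: lt_le_trans bt.
  by apply: eS; lra.
have [dG0 G0E] := continuous_FTC1_closed ru ig br (cg r (lt_trans ab br) rS).
have DG0 : is_derive r 1 G0 (g r) by apply: DeriveDef; [exact: dG0|rewrite -derive1E; exact: G0E].
have := is_derive_subf DG0 (is_derive_cst (G0 R0) r 1).
by rewrite subr0.
Qed.

(** Freezing [f] at its value at [R0] turns one-sided continuity at [R0] into ordinary
    continuity. *)
Lemma continuous_max_extension S R0 f : (R0%:E < S)%E ->
  {within [set r | R0 <= r /\ (r%:E < S)%E], continuous f} ->
  forall r, (r%:E < S)%E -> {for r, continuous (fun t => f (Num.max R0 t))}.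
Proof.
move=> R0S cf r rS.
have mS : [set r | R0 <= r /\ (r%:E < S)%E] (Num.max R0 r).
  by split=> /=; [rewrite le_max lexx|case: (leP R0 r)].
have /cvgrPdist_lt H := (subspace_continuousP _ _).1 cf _ mS.
have [e1 e10 e1S] := lt_ereal_open rS.
suff : (fun t => f (Num.max R0 t)) @ r --> f (Num.max R0 r) by [].
apply/cvgrPdist_lt => e e0.
have := H e e0; rewrite near_withinE => /nbhs_ballP[d /= d0 dP].
apply/nbhs_ballP; exists (Num.min d e1); first by rewrite /= lt_min d0.
move=> t; rewrite /ball /= lt_min => /andP[td te].
have mE : `|Num.max R0 r - Num.max R0 t| <= `|r - t|.
  by rewrite !maxEle; case: (leP R0 r); case: (leP R0 t) => h1 h2;
    rewrite ler_norml; apply/andP; split; have := ler_norm (r - t);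
    have := ler_norm (t - r); rewrite (distrC t r); lra.
apply: dP; first by rewrite /ball /=; exact: le_lt_trans td.
split; first by rewrite le_max lexx.
have tS : (t%:E < S)%E by apply: e1S; move: te; rewrite ltr_norml => /andP[]; lra.
by case: (leP R0 t).
Qed.

(** Solves [h^(1-N) (h^(N-1) F')' = f] by two successive primitives, [Phi] being the flux. The
    second starts later than the first because its integrand is controlled only where [Phi] is
    differentiable. *)
Lemma radial_system (N : nat) S h f R0 : 0 < R0 -> (R0%:E < S)%E ->
  (forall r, 0 < r -> (r%:E < S)%E -> 0 < h r) ->
  (forall r, 0 < r -> (r%:E < S)%E -> derivable h r 1) ->
  (forall r, 0 < r -> (r%:E < S)%E -> {for r, continuous f}) ->
  exists F Phi b, [/\ 0 < b, b < R0, F R0 = 0, Phi R0 = 0 &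
    forall r, b < r -> (r%:E < S)%E -> is_derive r 1 F (Phi r / h r ^+ N.-1) /\
      is_derive r 1 Phi (h r ^+ N.-1 * f r)].
Proof.
move=> R00 R0S hpos dh cf.
have dhn r : 0 < r -> (r%:E < S)%E ->
    is_derive r 1 (fun t => h t ^+ N.-1) (N.-1%:R * h r ^+ N.-2 * derive1 h r).
  move=> r0 rS; exact/is_derive_expf/derivable_derive1/dh.
have [Phi [b1 [b10 b1R Phi0 DPhi]]] : exists Phi b, [/\ 0 < b, b < R0, Phi R0 = 0 &
    forall r, b < r -> (r%:E < S)%E -> is_derive r 1 Phi (h r ^+ N.-1 * f r)].
  apply: primitive_exists => // r r0 rS; apply: continuousM; last exact: cf.
  exact: is_derive_continuous (dhn _ r0 rS).
have [F [b2 [b2b1 b2R F0 DF]]] : exists F b, [/\ b1 < b, b < R0, F R0 = 0 &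
    forall r, b < r -> (r%:E < S)%E -> is_derive r 1 F (Phi r / h r ^+ N.-1)].
  apply: primitive_exists => // r r1 rS.
  have r0 : 0 < r by exact: lt_trans r1.
  have hn0 : h r ^+ N.-1 != 0 by rewrite expf_neq0// gt_eqF// hpos.
  apply: is_derive_continuous; apply: is_derive_mulf (DPhi r r1 rS) _.
  exact: is_derive_invf (dhn r r0 rS) hn0.
exists F, Phi, b2; split=> //; first exact: lt_trans b2b1.
by move=> r br rS; split; [exact: DF|apply: DPhi => //; exact: lt_trans br].
Qed.

(** Both integrals are explicit: the inner one is [h(s)^(1-N) (Phi r - Phi s)], and this has the
    primitive [Phi r * H s - F s] in [s]. *)
Lemma wfun_eq (N : nat) S h f R0 b H F Phi : 0 < b -> b < R0 ->
  (forall r, 0 < r -> (r%:E < S)%E -> 0 < h r) ->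
  (forall r, 0 < r -> (r%:E < S)%E -> derivable h r 1) ->
  (forall r, R0 <= r -> (r%:E < S)%E -> {for r, continuous f}) ->
  H R0 = 0 -> F R0 = 0 -> Phi R0 = 0 ->
  (forall r, b < r -> (r%:E < S)%E -> is_derive r 1 H (h r ^+ N.-1)^-1) ->
  (forall r, b < r -> (r%:E < S)%E -> is_derive r 1 F (Phi r / h r ^+ N.-1) /\
      is_derive r 1 Phi (h r ^+ N.-1 * f r)) ->
  forall r c, R0 <= r -> (r%:E < S)%E ->
    wfun N h f R0 r c = (h r ^+ N.-1 * H r)^-1 * (c + F r - Phi r * H r).
Proof.
move=> b0 bR0 hpos dh cf H0 F0 Phi0 DH DF r c R0r rS.
have inS t : R0 <= t <= r -> [/\ 0 < t, b < t & (t%:E < S)%E].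
  move=> /andP[R0t tr]; have bt : b < t by exact: lt_le_trans R0t.
  by split=> //; [exact: lt_trans bt|apply: le_lt_trans rS; rewrite lee_fin].
have dhn t : R0 <= t <= r -> is_derive t 1 (fun t => h t ^+ N.-1) (N.-1%:R * h t ^+ N.-2 * derive1 h t).
  by move=> /inS[t0 _ tS]; exact/is_derive_expf/derivable_derive1/dh.
have hn0 t : R0 <= t <= r -> h t ^+ N.-1 != 0.
  by move=> /inS[t0 _ tS]; rewrite expf_neq0// gt_eqF// hpos.
have dinv t (tI : R0 <= t <= r) := is_derive_invf (dhn t tI) (hn0 t tI).
have DPhi t (tI : R0 <= t <= r) : is_derive t 1 Phi (h t ^+ N.-1 * f t).
  by have [_ bt tS] := inS _ tI; have [] := DF _ bt tS.
rewrite /wfun; congr ((_ * _)^-1 * _).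
  transitivity (H r - H R0); last by rewrite H0 subr0.
  apply: Rintegral_FTC2 => // t tI.
    by have [_ bt tS] := inS _ tI; exact: DH.
  exact: is_derive_continuous (dinv t tI).
have inner s : R0 <= s <= r ->
    \int[mu]_(t in `[s, r]) ((h t / h s) ^+ N.-1 * f t) = (h s ^+ N.-1)^-1 * (Phi r - Phi s).
  move=> /andP[R0s sr].
  have tI t : s <= t <= r -> R0 <= t <= r.
    by move=> /andP[st ->]; rewrite (le_trans R0s st).
  rewrite mulrBr; apply: (@Rintegral_FTC2 _ (fun t => (h s ^+ N.-1)^-1 * Phi t)) => //.
  - move=> t /tI tI'; apply: is_derive_eq (is_derive_scalef (DPhi t tI') _) _.
    by rewrite expr_div_n mulrA [_ / _]mulrC.
  - move=> t /tI tI'; apply: continuousM; last first.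
      by apply: cf; [case/andP: tI'|have [] := inS _ tI'].
    have := is_derive_scalef (dhn t tI') (h s ^+ N.-1)^-1.
    move=> /is_derive_continuous; rewrite (_ : (fun y => _) = fun t => (h t / h s) ^+ N.-1)//.
    by apply/funext => y; rewrite expr_div_n mulrC.
rewrite -addrA; congr (_ + _).
transitivity (- \int[mu]_(s in `[R0, r]) ((h s ^+ N.-1)^-1 * (Phi r - Phi s))).
  congr (- _); apply: eq_Rintegral => s; rewrite inE /= in_itv /=; exact: inner.
transitivity (- ((Phi r * H r - F r) - (Phi r * H R0 - F R0))); last by rewrite H0 F0; ring.
congr (- _); apply: (@Rintegral_FTC2 _ (fun s => Phi r * H s - F s)) => //.
- move=> t tI; have [_ bt tS] := inS _ tI; have [D1 _] := DF _ bt tS.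
  apply: is_derive_eq (is_derive_subf (is_derive_scalef (DH _ bt tS) (Phi r)) D1) _.
  by ring.
- move=> t tI; apply: continuousM; first exact: is_derive_continuous (dinv t tI).
  exact: is_derive_continuous (is_derive_subf (is_derive_cst (Phi r) t 1) (DPhi t tI)).
Qed.

End RadialCalculus.

(** * Geodesic distance *)

(* The integral of a nonnegative function is a supremum over the simple functions below it,
   hence monotone without any measurability assumption. *)
Lemma le_integral_nomeas d (T : measurableType d) (R : realType)
    (mu : {measure set T -> \bar R}) (D : set T) (f g : T -> \bar R) :
  (forall x, D x -> (0 <= f x)%E) -> (forall x, D x -> (f x <= g x)%E) ->
  (\int[mu]_(x in D) f x <= \int[mu]_(x in D) g x)%E.
Proof.
move=> f0 fg; rewrite integral_mkcond [leRHS]integral_mkcond.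
have f0' x : (0 <= (f \_ D) x)%E by exact: erestrict_ge0.
have fg' x : ((f \_ D) x <= (g \_ D) x)%E by exact: lee_restrict.
have g0' x : (0 <= (g \_ D) x)%E by exact: le_trans (fg' x).
rewrite !ge0_integralTE//; apply: ereal_sup_le => _ [k kf <-]; exists k => // x.
exact: le_trans (kf x) (fg' x).
Qed.

Section Distance.
Variables (R : realType) (N : nat) (S : \bar R) (h : R -> R).
Local Notation E := 'rV[R]_N.
Local Notation mu := (@lebesgue_measure R).
Implicit Types (x y z v d c p q : E) (a b t r s : R).

Definition speed x v : R := Num.sqrt ((v *m gmat h x *m v^T) 0 0).

Lemma speed0 v : speed 0 v = enorm v.
Proof. by rewrite /speed /gmat eqxx mulmx1 -dot_mulmx -enormE. Qed.

Lemma speedE x v : x != 0 -> speed x v =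
  Num.sqrt ((dot x v / enorm x) ^+ 2 +
    (h (enorm x) / enorm x) ^+ 2 * (dot v v - (dot x v / enorm x) ^+ 2)).
Proof.
move=> x0; rewrite /speed /gmat (negPf x0) -dot_mulmx; congr Num.sqrt.
have := enorm_gt0 x; rewrite x0 => r0.
have e1 : dot (v *m radproj x) v = (dot x v / enorm x) ^+ 2.
  by rewrite mulmx_radproj dotZl (dotC v x) expr_div_n mulrAC.
by rewrite mulmxDr -[v *m (_ ^+ 2 *: _)]scalemxAr mulmxBr mulmx1 !dotE e1.
Qed.

Lemma radial_speed_le x v : x != 0 -> (dot x v / enorm x) ^+ 2 <= dot v v.
Proof.
move=> x0; have := enorm_gt0 x; rewrite x0 => r0.
rewrite expr_div_n ler_pdivrMr ?exprn_gt0// enorm_sqr mulrC; exact: dot_sqr_le.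
Qed.

(** The left side is the rate of change of the regularised radius, the square root of [|x|^2 + e],
    which stays differentiable when a curve runs through the pole. *)
Lemma speed_ge x v e : 0 < e -> `|dot x v / Num.sqrt (dot x x + e)| <= speed x v.
Proof.
move=> e0; have [->|x0] := eqVneq x 0.
  by rewrite !dot0l mul0r normr0 speed0 enorm_ge0.
rewrite speedE// -sqrtr_sqr ler_sqrt; last first.
  by rewrite addr_ge0 ?sqr_ge0// mulr_ge0 ?sqr_ge0// subr_ge0 radial_speed_le.
apply: (@le_trans _ _ ((dot x v / enorm x) ^+ 2)); last first.
  by rewrite lerDl mulr_ge0 ?sqr_ge0// subr_ge0 radial_speed_le.
have xx : 0 < dot x x by rewrite dotxx_gt0.
rewrite !expr_div_n enorm_sqr sqr_sqrtr; last by rewrite addr_ge0// ltW.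
by rewrite ler_wpM2l ?sqr_ge0// lef_pV2 ?posrE ?addr_gt0// lerDl ltW.
Qed.

Lemma continuous_dot (f g : R -> E) t : {for t, continuous f} -> {for t, continuous g} ->
  {for t, continuous (fun s => dot (f s) (g s))}.
Proof.
move=> cf cg; apply: cvg_dot => i.
  exact: (continuous_cvg _ (@coord_continuous R 1 N 0 i (f t)) cf).
exact: (continuous_cvg _ (@coord_continuous R 1 N 0 i (g t)) cg).
Qed.

Lemma curve_length_ge (g : R -> E) : C1_curve S g ->
  ((enorm (g 1) - enorm (g 0))%:E <= curve_length h g)%E.
Proof.
move=> [dg [cg gS]]; apply/lee_addgt0Pr => e e0.
(* Regularising with [e^2] changes the radius by at most [e], which is the slack granted by
   [lee_addgt0Pr]. *)
pose G t := Num.sqrt (dot (g t - 0) (g t - 0) + e ^+ 2).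
have e2 : 0 < e ^+ 2 by rewrite exprn_gt0.
have gg t : 0 < dot (g t) (g t) + e ^+ 2 by rewrite ltr_wpDl// dotxx_ge0.
pose dG t := dot (g t) (derive1 g t) / Num.sqrt (dot (g t) (g t) + e ^+ 2).
have Dg t : is_derive t 1 g (derive1 g t) by rewrite derive1E; exact: derivableP.
have cgt t : {for t, continuous g}.
  by apply: differentiable_continuous; apply/derivable1_diffP.
have DG t : is_derive t 1 G (dG t).
  have D1 := is_derive_curve (differentiable_dot 0 (g t)) (Dg t).
  have D2 := is_derive_addf D1 (is_derive_cst (e ^+ 2) t 1).
  have gg' : 0 < dot (g t - 0) (g t - 0) + e ^+ 2 by rewrite subr0.
  have D3 : is_derive t 1 G _ := @is_derive1_comp R Num.sqrt
    (fun s => dot (g s - 0) (g s - 0) + e ^+ 2) t _ _ (is_derive1_sqrt gg') D2.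
  apply: is_derive_eq D3 _; rewrite addr0 derive_dot !subr0 /dG.
  have s0 : Num.sqrt (dot (g t) (g t) + e ^+ 2) != 0 by rewrite gt_eqF// sqrtr_gt0.
  by field.
have cdG t : {for t, continuous dG}.
  have cn : {for t, continuous (fun t => dot (g t) (derive1 g t))}.
    by apply: continuous_dot; [exact: cgt|exact: cg].
  apply: continuousM => //; apply: continuousV.
    by rewrite gt_eqF// sqrtr_gt0.
  have cd : {for t, continuous (fun t => dot (g t) (g t) + e ^+ 2)}.
    apply: continuousD; last exact: cst_continuous.
    by apply: continuous_dot; exact: cgt.
  exact: (continuous_comp cd (@sqrt_continuous R _)).
have H1 : (\int[mu]_(t in `[0%R, 1%R]) (dG t)%:E = (G 1 - G 0)%:E)%E by apply: integral_FTC2.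
have H2 : (\int[mu]_(t in `[0%R, 1%R]) (dG t)%:E <= \int[mu]_(t in `[0%R, 1%R]) `|dG t|%:E)%E.
  apply: le_integral => //.
  - apply: continuous_compact_integrable; first exact: segment_compact.
    by apply: continuous_within_segment => t _.
  - apply: (@continuous_compact_integrable _ (fun t => `|dG t|)); first exact: segment_compact.
    apply: continuous_within_segment => t _.
    exact: (continuous_comp (cdG t) (@norm_continuous _ _ _)).
  - by move=> t _; rewrite lee_fin ler_norm.
have H3 : (\int[mu]_(t in `[0%R, 1%R]) `|dG t|%:E <= curve_length h g)%E.
  apply: le_integral_nomeas => t _; rewrite lee_fin ?normr_ge0//.
  exact: speed_ge.
have H4 : ((G 1 - G 0)%:E <= curve_length h g)%E by rewrite -H1; exact: le_trans H2 H3.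
have : ((enorm (g 1) - enorm (g 0))%:E <= (G 1 - G 0)%:E + e%:E)%E.
  rewrite -EFinD lee_fin.
  have h1 : enorm (g 1) <= G 1.
    by rewrite enormE /G subr0 ler_sqrt; [rewrite lerDl ltW|exact: ltW].
  have h0 : G 0 <= enorm (g 0) + e.
    have ge0 : 0 <= enorm (g 0) + e by rewrite addr_ge0 ?enorm_ge0// ltW.
    rewrite /G subr0 -[leRHS](ger0_norm ge0) -sqrtr_sqr ler_sqrt ?sqr_ge0// sqrrD enorm_sqr -addrA lerD2l lerDr.
    by rewrite mulrn_wge0// mulr_ge0 ?enorm_ge0// ltW.
  lra.
by move=> /le_trans; apply; exact: leeD2r.
Qed.

Lemma gdist_ge p q : ((enorm q - enorm p)%:E <= gdist S h p q)%E.
Proof.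
apply: le_ereal_inf_tmp => _ [g [Cg [<- <-]] <-]; exact: curve_length_ge.
Qed.

(** What is integrated is a continuous majorant [b] of the speed with a known primitive; the length
    follows by monotonicity of the integral. *)
Lemma gdist_segment_le q v (G b : R -> R) :
  (forall t, 0 <= t <= 1 -> Mset S (q + t *: v)) ->
  (forall t, 0 <= t <= 1 -> speed (q + t *: v) v <= b t) ->
  (forall t, 0 <= t <= 1 -> is_derive t 1 G (b t)) ->
  (forall t, 0 <= t <= 1 -> {for t, continuous b}) ->
  (gdist S h q (q + v) <= (G 1 - G 0)%:E)%E.
Proof.
move=> segS sb DG cb; pose g t := q + t *: v.
have Dg t : is_derive t 1 g v by exact: is_derive_line.
have d1 t : derive1 g t = v by rewrite derive1E (@derive_val _ _ _ _ _ _ _ (Dg t)).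
apply: (@le_trans _ _ (curve_length h g)).
  apply: ereal_inf_lbound; exists g => //; split; last first.
    by rewrite /g scale0r addr0 scale1r.
  split; first by move=> t; exact: (@ex_derive _ _ _ _ _ _ _ (Dg t)).
  split=> //; rewrite (_ : derive1 g = cst v); first exact: cst_continuous.
  by apply/funext => t; rewrite d1.
rewrite -(integral_FTC2 ltr01 DG cb); apply: le_integral_nomeas => t.
  by rewrite lee_fin sqrtr_ge0.
by rewrite /= in_itv /= lee_fin => t01; rewrite d1; exact: sb.
Qed.

Lemma gdist_pole x : Mset S x -> gdist S h 0 x = (enorm x)%:E.
Proof.
move=> xS; apply/eqP; rewrite eq_le; apply/andP; split; last first.
  by have := gdist_ge 0 x; rewrite enorm0 subr0.
have -> : x = 0 + x by rewrite add0r.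
have := @gdist_segment_le 0 x (fun t => enorm x * t) (fun=> enorm x).
rewrite mulr1 mulr0 subr0 add0r; apply.
- move=> t /andP[t0 t1]; apply: le_lt_trans xS.
  by rewrite add0r enormZ lee_fin ger0_norm// -[leRHS]mul1r ler_wpM2r// enorm_ge0.
- move=> t /andP[t0 t1]; rewrite add0r.
  have [->|x0] := eqVneq x 0; first by rewrite scaler0 speed0.
  have [->|tn0] := eqVneq t 0; first by rewrite scale0r speed0.
  have tt : 0 < t by rewrite lt_neqAle eq_sym tn0.
  have := enorm_gt0 x; rewrite x0 => r0.
  rewrite speedE ?scaler_eq0 ?negb_or ?tn0// enormZ (gtr0_norm tt) dotZl -enorm_sqr.
  rewrite (_ : t * enorm x ^+ 2 / (t * enorm x) = enorm x).
    by rewrite subrr mulr0 addr0 sqrtr_sqr ger0_norm// enorm_ge0.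
  by field; rewrite tn0 gt_eqF.
- move=> t _; have := is_derive_scalef (is_derive_id t 1) (enorm x).
  by rewrite mulr1.
- by move=> t _; exact: cst_continuous.
Qed.

Lemma gball_pole rho : (forall x, enorm x < rho -> Mset S x) ->
  gball S h 0 rho = @ballO R N rho.
Proof.
move=> rS; apply/seteqP; split=> x; rewrite /gball /ballO /=.
  by move=> [xS]; rewrite gdist_pole// lte_fin.
by move=> xr; have xS := rS x xr; split=> //; rewrite gdist_pole// lte_fin.
Qed.

Lemma sqrt_add_le a b : 0 < a -> 0 <= b -> Num.sqrt (a ^+ 2 + b) <= a + b / (2 * a).
Proof.
move=> a0 b0; have c0 : 0 <= a + b / (2 * a) by rewrite addr_ge0 ?divr_ge0 ?mulr_ge0// ltW.
rewrite -[leRHS]ger0_norm// -sqrtr_sqr ler_sqrt ?sqr_ge0//.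
have -> : (a + b / (2 * a)) ^+ 2 = a ^+ 2 + b + (b / (2 * a)) ^+ 2 by field; rewrite gt_eqF.
by rewrite lerDl sqr_ge0.
Qed.

(* Along the straight segment [q + t v] the radial part of the speed is the derivative of the
   radius, and the angular part only contributes to second order. *)
Lemma gdist_segment_second_order q x (M : R) : q != 0 -> Mset S x ->
  0 < dot (x - q) q ->
  (forall r, enorm q <= r <= enorm x -> `|h r / r| <= M) ->
  (gdist S h q x <= (enorm x - enorm q +
    M ^+ 2 * (dot x x - (dot x q / enorm q) ^+ 2) * enorm x / (2 * dot (x - q) q))%:E)%E.
Proof.
move=> q0 xS + hM; have [v vE] : exists v, v = x - q by exists (x - q).
rewrite -vE => vq; have qvx : q + v = x by rewrite vE subrKC.
have a0 : 0 < enorm q by rewrite enorm_gt0.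
have qq : 0 < dot q q by rewrite dotxx_gt0.
have vv := dotxx_ge0 v.
have zz t : dot (q + t *: v) (q + t *: v) = dot q q + 2 * t * dot v q + t ^+ 2 * dot v v.
  by rewrite !dotE (dotC q v); ring.
have xE : x = q + 1 *: v by rewrite scale1r.
have zge t : 0 <= t <= 1 -> enorm q <= enorm (q + t *: v) <= enorm x.
  move=> /andP[t0 t1].
  have h1 : 0 <= t * dot v q by rewrite mulr_ge0// ltW.
  have h2 : 0 <= t ^+ 2 * dot v v by rewrite mulr_ge0// sqr_ge0.
  have h3 : t * dot v q <= dot v q by rewrite ler_piMl// ltW.
  have h4 : t ^+ 2 * dot v v <= dot v v by rewrite ler_piMl// expr_le1.
  apply/andP; split; rewrite !enormE ler_sqrt ?dotxx_ge0// ?xE !zz; lra.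
have z0 t : 0 <= t <= 1 -> 0 < enorm (q + t *: v).
  by move=> /zge/andP[h1 _]; exact: lt_le_trans h1.
(* [Y] is the squared Euclidean distance of [x] from the line through [q]. The next identity is the
   constancy of the Gram determinant of [q + t v] and [v] along the segment. *)
set Y := dot x x - (dot x q / enorm q) ^+ 2.
have YE t : dot v v * dot (q + t *: v) (q + t *: v) - dot (q + t *: v) v ^+ 2 =
    Y * dot q q.
  rewrite zz !dotE (dotC q v) /Y [in dot x x]xE [in dot x q]xE zz !dotE expr_div_n enorm_sqr.
  by field; rewrite gt_eqF.
have Y0 : 0 <= Y by rewrite subr_ge0; have := @radial_speed_le q x q0; rewrite dotC.
have ex : 0 < enorm x by rewrite xE; apply: z0; rewrite lexx ler01.
pose C := M ^+ 2 * Y * enorm x / (2 * dot v q).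
have := @gdist_segment_le q v (fun t => enorm (q + t *: v) + C * t)
  (fun t => dot (q + t *: v) v / enorm (q + t *: v) + C).
rewrite scale1r scale0r addr0 mulr0 addr0 mulr1 !qvx.
rewrite (_ : enorm x + C - enorm q = enorm x - enorm q + C); last by ring.
apply.
- move=> t /zge/andP[_ zx]; apply: le_lt_trans xS; rewrite lee_fin//.
- move=> t t01; have zt := z0 t t01; have /andP[z1 z2] := zge t t01.
  have zn0 : q + t *: v != 0 by rewrite -enorm_gt0.
  set z := q + t *: v in zt z1 z2 zn0 *.
  have zv : dot v q <= dot z v.
    rewrite /z !dotE (dotC q v) lerDl mulr_ge0//; by case/andP: t01.
  have zv0 : 0 < dot z v by exact: lt_le_trans zv.
  have A0 : 0 < dot z v / enorm z by rewrite divr_gt0.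
  rewrite speedE//.
  have W : dot v v - (dot z v / enorm z) ^+ 2 <= Y.
    have -> : dot v v - (dot z v / enorm z) ^+ 2 = Y * (dot q q / dot z z).
      rewrite mulrA -(YE t) -/z expr_div_n enorm_sqr; field.
      by rewrite -enorm_sqr expf_neq0// gt_eqF.
    rewrite ler_piMr// ler_pdivrMr ?mul1r -?enorm_sqr ?exprn_gt0//.
    by rewrite ler_pXn2r// nnegrE enorm_ge0.
  have W0 : 0 <= dot v v - (dot z v / enorm z) ^+ 2 by rewrite subr_ge0 radial_speed_le.
  have hM2 : (h (enorm z) / enorm z) ^+ 2 <= M ^+ 2.
    have hz := hM _ (zge t t01); rewrite -/z in hz.
    rewrite -[leLHS]real_normK ?num_real// ler_pXn2r// nnegrE//.
    exact: le_trans hz.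
  set b := (_ ^+ 2 * (dot v v - _)).
  have b0 : 0 <= b by rewrite mulr_ge0// sqr_ge0.
  have bY : b <= M ^+ 2 * Y by apply: ler_pM => //; exact: sqr_ge0.
  apply: le_trans (sqrt_add_le A0 b0) _; rewrite lerD2l.
  apply: (@le_trans _ _ (M ^+ 2 * Y / (2 * (dot z v / enorm z)))).
    by rewrite ler_wpM2r// invr_ge0 mulr_ge0// ltW.
  have MY : 0 <= M ^+ 2 * Y by rewrite mulr_ge0// sqr_ge0.
  have -> : M ^+ 2 * Y / (2 * (dot z v / enorm z)) = M ^+ 2 * Y * (enorm z / (2 * dot z v)).
    by field; rewrite !gt_eqF.
  have -> : C = M ^+ 2 * Y * (enorm x / (2 * dot v q)) by rewrite mulrA.
  rewrite ler_wpM2l//; apply: ler_pM => //; first exact: enorm_ge0.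
    by rewrite invr_ge0 mulr_ge0// ltW.
  by rewrite lef_pV2 ?posrE ?mulr_gt0// ler_pM2l.
- move=> t t01; have zt := z0 t t01.
  have zn0 : q + t *: v != 0 by rewrite -enorm_gt0.
  have D1 := is_derive_on_line (differentiable_enorm zn0); rewrite derive_enorm// in D1.
  have := is_derive_addf D1 (is_derive_scalef (is_derive_id t 1) C).
  by rewrite mulr1.
- move=> t t01; have zt := z0 t t01.
  have zn0 : q + t *: v != 0 by rewrite -enorm_gt0.
  have D1 := is_derive_on_line (differentiable_enorm zn0).
  apply: continuousD; last exact: cst_continuous.
  apply: continuousM.
    by apply: continuous_dot; [exact: continuous_line|exact: cst_continuous].
  apply: continuousV; first by rewrite gt_eqF.
  exact: is_derive_continuous D1.
Qed.

End Distance.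

(** * Euclidean balls inside geodesic balls *)

Section InteriorSphere.
Variables (R : realType) (N : nat) (S : \bar R) (h : R -> R).
Local Notation E := 'rV[R]_N.
Implicit Types (x y z v d c p q : E) (a b t r s : R).
Hypothesis dh : forall r, 0 < r -> (r%:E < S)%E -> derivable h r 1.

(* With [e = r2 - z], the Euclidean ball gives [Y < 2 s e], while [|x| <= z + Y / (2 z)]. *)
Lemma touching_ball_bound c q x (K r2 s : R) : 0 < enorm q -> 0 <= K -> 0 < s ->
  2 * s * (K + r2^-1) <= 1 -> 4 * s <= r2 ->
  c = ((r2 - s) / enorm q) *: q -> enorm (x - c) < s ->
  let z := dot x q / enorm q in
  r2 - 2 * s <= z /\ enorm x + K * (dot x x - z ^+ 2) < r2.
Proof.
move=> a0 K0 s0 sK sr cE xc z.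
have qq : dot q q = enorm q ^+ 2 by rewrite enorm_sqr.
have xq : dot x q = z * enorm q by rewrite /z divfK// gt_eqF.
have : enorm (x - c) ^+ 2 < s ^+ 2 by rewrite ltr_pXn2r// nnegrE ?enorm_ge0// ltW.
rewrite enorm_sqr cE !dotE (dotC q x) xq qq.
have -> : dot x x + - ((r2 - s) / enorm q * (z * enorm q)) +
  (- ((r2 - s) / enorm q * (z * enorm q)) + - (- ((r2 - s) / enorm q * ((r2 - s) / enorm q * enorm q ^+ 2)))) =
  dot x x - z ^+ 2 + (z - (r2 - s)) ^+ 2.
  by field; rewrite gt_eqF.
have Y0 : 0 <= dot x x - z ^+ 2.
  rewrite subr_ge0 /z expr_div_n ler_pdivrMr ?exprn_gt0// enorm_sqr.
  exact: dot_sqr_le.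
have [Y YE] : exists Y, Y = dot x x - z ^+ 2 by exists (dot x x - z ^+ 2).
rewrite -YE in Y0 * => Yz.
have zs2 : (z - (r2 - s)) ^+ 2 < s ^+ 2 by lra.
have /andP[z1 z2] : - s < z - (r2 - s) < s.
  have s0' := ltW s0.
  by rewrite -ltr_norml -ltr_sqr ?nnegrE// real_normK ?num_real.
have zr : r2 - 2 * s <= z by lra.
split=> //.
have r0 : 0 < r2 by lra.
have z0 : r2 / 2 <= z by lra.
have zp : 0 < z by lra.
have Y2 : Y < 2 * s * (r2 - z).
  have : (2 * s - (r2 - z)) * (r2 - z) = s ^+ 2 - (z - (r2 - s)) ^+ 2 by ring.
  nra.
have ex : enorm x <= z + Y / (2 * z).
  rewrite enormE (_ : dot x x = z ^+ 2 + Y); last by rewrite YE; ring.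
  exact: sqrt_add_le.
have zz : 0 < 2 * z by lra.
have zV : (2 * z)^-1 <= r2^-1 by rewrite lef_pV2 ?posrE//; lra.
have h1 : Y / (2 * z) <= Y * r2^-1 by rewrite ler_wpM2l.
have rV : 0 < r2^-1 by rewrite invr_gt0.
have K1 : 0 < K + r2^-1 by lra.
have h2 : Y * (K + r2^-1) < 2 * s * (r2 - z) * (K + r2^-1) by rewrite ltr_pM2r.
have h3 : 2 * s * (K + r2^-1) * (r2 - z) <= 1 * (r2 - z) by rewrite ler_wpM2r//; lra.
have h4 : 2 * s * (r2 - z) * (K + r2^-1) = 2 * s * (K + r2^-1) * (r2 - z) by ring.
move: h2 h3 ex h1; rewrite h4 mulrDr (mulrC K); lra.
Qed.

(** Since distances dominate differences of radii, the geodesic ball has radius at least [r2 - |q|],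
    so it comes up to the outer sphere on the ray of [q]. There a small tangent Euclidean ball fits
    inside, by the second-order bound on distances. The point [p'] is on that ray and may differ
    from [p]; for [q] at the pole [p] itself will do. *)
Lemma interior_sphere_touch (A : set E) p (R0 r2 : R) : 0 < R0 -> R0 < r2 ->
  (r2%:E < S)%E -> A `<=` ballO r2 -> enorm p = r2 -> interior_sphere S h A p ->
  exists p' s, [/\ enorm p' = r2, 0 < s, 4 * s <= r2 - R0 &
    forall x, enorm (x - (1 - s / r2) *: p') < s -> A x].
Proof.
move=> R00 R0r r2S AB pr [q [rho [qS rho0 qA qp]]].
have r0 : 0 < r2 by exact: lt_trans R0r.
have AS x : enorm x < r2 -> Mset S x.
  by move=> xr; apply: lt_trans r2S; rewrite lte_fin.
have rho_ge : r2 - enorm q <= rho.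
  by have := gdist_ge S h q p; rewrite qp pr lee_fin.
pose s0 := (r2 - R0) / 4.
have s00 : 0 < s0 by rewrite divr_gt0// subr_gt0.
have [q0|q0] := eqVneq q 0.
  exists p, s0; split=> //; first by rewrite /s0; lra.
  move=> x xs; apply: qA; have xr : enorm x < r2.
    have := enormD (x - (1 - s0 / r2) *: p) ((1 - s0 / r2) *: p).
    rewrite subrK enormZ pr ger0_norm; last by rewrite subr_ge0 ler_pdivrMr// /s0; lra.
    rewrite mulrBl mul1r divfK ?gt_eqF//; lra.
  split; first exact: AS.
  rewrite q0 gdist_pole; last exact: AS.
  by rewrite lte_fin; apply: lt_le_trans xr _; rewrite q0 enorm0 subr0 in rho_ge.
have a0 : 0 < enorm q by rewrite enorm_gt0.
have ar : enorm q < r2.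
  apply: AB; apply: qA; split=> //.
  (* The constant curve shows that [q] belongs to its own geodesic ball, hence to [A]. *)
  have := @gdist_segment_le _ _ S h q 0 (cst 0) (cst 0).
  rewrite addr0 subrr => /(_ _ _ _ _)/le_lt_trans; apply; last by rewrite lte_fin.
  - by move=> t _; rewrite scaler0 addr0.
  - by move=> t _; rewrite scaler0 addr0 speedE// !dot0r mul0r expr0n subrr mulr0 addr0 sqrtr0.
  - by move=> t _; exact: (@cst_continuous R R 0).
have [M [M0 hM]] : exists M, 0 <= M /\ forall r, enorm q <= r <= r2 -> `|h r / r| <= M.
  have ch : {within `[enorm q, r2], continuous (fun r => `|h r / r|)}.
    apply: continuous_within_segment => r /andP[qr rr].
    have rp : 0 < r by exact: lt_le_trans qr.
    have rS : (r%:E < S)%E by apply: le_lt_trans r2S; rewrite lee_fin.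
    have D1 : is_derive r 1 h (derive1 h r) by exact/derivable_derive1/dh.
    have rn0 : r != 0 by rewrite gt_eqF.
    have D2 := is_derive_mulf D1 (is_derive_invf (is_derive_id r 1) rn0).
    exact: (continuous_comp (is_derive_continuous D2) (@norm_continuous _ _ _)).
  have [m mI mP] := EVT_max (ltW ar) ch.
  by exists `|h m / m|; split=> // r rI; apply: mP; rewrite in_itv.
(* The coefficient of [Y] in [gdist_segment_second_order] once [|x| <= r2] and [dot (x - q) q] is at
   least half of [|q| (r2 - |q|)]. *)
pose K := M ^+ 2 * r2 / (enorm q * (r2 - enorm q)).
have K0 : 0 <= K by rewrite divr_ge0 ?mulr_ge0 ?sqr_ge0 ?subr_ge0// ltW.
have rV : 0 < r2^-1 by rewrite invr_gt0.
(* The three bounds give, in turn, distance from the inner ball, the lower bound on [dot (x - q) q]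
   used for [K], and the smallness required by [touching_ball_bound]. *)
pose s := Num.min s0 (Num.min ((r2 - enorm q) / 4) (2 * (K + r2^-1))^-1).
have sp : 0 < s.
  rewrite !lt_min s00 divr_gt0 ?subr_gt0//= invr_gt0 mulr_gt0//; lra.
have ss0 : s <= s0 by rewrite ge_min lexx.
have s1 : s <= (r2 - enorm q) / 4 by rewrite !ge_min lexx orbT.
have s2 : s <= (2 * (K + r2^-1))^-1 by rewrite !ge_min lexx !orbT.
have sK : 2 * s * (K + r2^-1) <= 1.
  have k0 : 0 < 2 * (K + r2^-1) by rewrite mulr_gt0//; lra.
  have := ler_wpM2r (ltW k0) s2; rewrite [X in _ <= X]mulVf ?gt_eqF//; lra.
have s4 : 4 * s <= r2 - R0 by move: ss0; rewrite /s0; lra.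
exists ((r2 / enorm q) *: q), s; split=> //.
  by rewrite enormZ gtr0_norm ?divr_gt0// divfK// gt_eqF.
move=> x; rewrite scalerA => xc.
have cE : ((1 - s / r2) * (r2 / enorm q)) *: q = ((r2 - s) / enorm q) *: q.
  by congr (_ *: _); field; rewrite !gt_eqF.
have s4' : 4 * s <= r2 by lra.
have [zr] := touching_ball_bound a0 K0 sp sK s4' cE xc.
set z := dot x q / enorm q in zr *; set Y := dot x x - z ^+ 2 => xY.
have Y0 : 0 <= Y.
  rewrite subr_ge0 /z expr_div_n ler_pdivrMr ?exprn_gt0// enorm_sqr.
  exact: dot_sqr_le.
have xr : enorm x < r2 by have := mulr_ge0 K0 Y0; lra.
have xS := AS x xr.
apply: qA; split=> //.
have xq : dot x q = z * enorm q by rewrite /z divfK// gt_eqF.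
have vq : dot (x - q) q = enorm q * (z - enorm q).
  by rewrite !dotE xq -enorm_sqr; ring.
have vq0 : enorm q * ((r2 - enorm q) / 2) <= dot (x - q) q.
  by rewrite vq ler_pM2l//; lra.
have vqp : 0 < dot (x - q) q.
  by apply: lt_le_trans vq0; rewrite mulr_gt0// divr_gt0// subr_gt0.
have hMx r : enorm q <= r <= enorm x -> `|h r / r| <= M.
  by move=> /andP[h1 h2]; apply: hM; rewrite h1 (le_trans h2)// ltW.
apply: le_lt_trans (gdist_segment_second_order q0 xS vqp hMx) _.
rewrite lte_fin -/z -/Y; apply: lt_le_trans rho_ge.
suff : M ^+ 2 * Y * enorm x / (2 * dot (x - q) q) <= K * Y by lra.
have -> : K * Y = M ^+ 2 * Y * (r2 / (2 * (enorm q * ((r2 - enorm q) / 2)))).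
  by rewrite /K; field; rewrite !gt_eqF// subr_gt0.
rewrite -[leLHS]mulrA; apply: ler_wpM2l; first by rewrite mulr_ge0// sqr_ge0.
have d0 : 0 < enorm q * ((r2 - enorm q) / 2) by rewrite !mulr_gt0// subr_gt0.
apply: ler_pM; [exact: enorm_ge0|by rewrite invr_ge0 mulr_ge0// ltW|exact: ltW|].
by rewrite lef_pV2 ?posrE ?(mulr_gt0 (ltr0Sn _ 1))// ler_pM2l.
Qed.

End InteriorSphere.

(** * Boundary normals *)

Section Normals.
Variables (R : realType) (N : nat).
Local Notation E := 'rV[R]_N.
Implicit Types (x y z v d c p q g : E) (a b t r s : R) (A V : set E) (rho : E -> R).

Lemma bdry_open A p : open A -> bdry A p -> closure A p /\ ~ A p.
Proof. by move=> /interior_id AE [cp]; rewrite AE. Qed.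

Lemma open_bdry A p : open A -> closure A p -> ~ A p -> bdry A p.
Proof. by move=> /interior_id AE cp nAp; split=> //; rewrite AE. Qed.

Lemma directional_sign rho p d : differentiable rho p -> 0 < dot (grad rho p) d ->
  exists2 e, 0 < e & forall t, 0 < t < e -> rho (p - t *: d) < rho p < rho (p + t *: d).
Proof.
move=> dr gd; have d0 : 0 < enorm d.
  by rewrite enorm_gt0; apply: contraTneq gd => ->; rewrite dot0r ltxx.
have e0 : 0 < dot (grad rho p) d / (2 * enorm d) by rewrite divr_gt0// mulr_gt0.
have [k k0 kP] := differentiable_enormP dr e0.
exists (k / enorm d); first by rewrite divr_gt0.
move=> t /andP[t0]; rewrite ltr_pdivlMr// => tk.
have gt : 0 < t * dot (grad rho p) d by rewrite mulr_gt0.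
have eE : dot (grad rho p) d / (2 * enorm d) * (t * enorm d) = t * dot (grad rho p) d / 2.
  by field; rewrite gt_eqF.
have := kP (p + t *: d); have := kP (p - t *: d).
rewrite ![p + _ - p]addrAC subrr !add0r enormN enormZ (gtr0_norm t0) => /(_ tk) h1 /(_ tk).
move: h1; rewrite eE dotNr dotZr !ler_norml => /andP[h1 h2] /andP[h3 h4].
by apply/andP; split; lra.
Qed.

Lemma local_defining_bdry0 A p V rho : open A -> local_defining A p V rho -> bdry A p ->
  rho p = 0.
Proof.
move=> oA [oV Vp [dr _] _ Ar] /(bdry_open oA)[cp nAp].
have r0 : 0 <= rho p by rewrite leNgt; apply/negP => /(Ar p Vp).2.
apply/eqP; rewrite eq_le r0 andbT leNgt; apply/negP => rp.
have crp : rho @ p --> rho p by exact/differentiable_continuous/dr.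
have : \forall x \near p, V x /\ 0 < rho x.
  apply: filterI; first exact: open_nbhs_nbhs.
  by move: crp => /cvgr_gt; apply.
move=> /nbhs_enormP[e e0 eP].
have [y Ay yp] := (closure_enormP A p).1 cp e e0.
have [Vy ry] := eP y yp.
by have := (Ar y Vy).1 Ay; rewrite ltNge (ltW ry).
Qed.

Lemma defining_crossing A p V rho x d : local_defining A p V rho -> V x -> rho x = 0 ->
  0 < dot (grad rho x) d ->
  exists2 e, 0 < e & forall t, 0 < t < e -> A (x - t *: d) /\ ~ A (x + t *: d).
Proof.
move=> [oV Vp [dr _] _ Ar] Vx rx gd; have [m m0 mP] := directional_sign (dr x Vx) gd.
have [k k0 kV] := (open_enormP V).1 oV x Vx.
have d0 : 0 < enorm d by rewrite enorm_gt0; apply: contraTneq gd => ->; rewrite dot0r ltxx.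
have [e [e0 em ek]] := pos_below2 m0 (divr_gt0 k0 d0); exists e => // t /andP[t0 te].
have tI : 0 < t < m by rewrite t0 (lt_trans te).
have /andP[r1 r2] := mP t tI; rewrite rx in r1 r2.
have tk : enorm (t *: d) < k by rewrite enormZ gtr0_norm// -ltr_pdivlMr// (lt_trans te).
have V1 : V (x - t *: d) by apply: kV; rewrite addrAC subrr add0r enormN.
have V2 : V (x + t *: d) by apply: kV; rewrite addrAC subrr add0r.
by split; [exact/(Ar _ V1)|move=> /(Ar _ V2); rewrite ltNge ltW].
Qed.

Lemma local_defining_zero_bdry A p V rho x : open A -> local_defining A p V rho ->
  V x -> rho x = 0 -> bdry A x.
Proof.
move=> oA LD Vx rx; have [_ _ _ g0 Ar] := LD; apply: open_bdry => //; last first.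
  by move=> /(Ar x Vx).1; rewrite rx ltxx.
apply/closure_enormP => e e0; have gn : 0 < enorm (grad rho x) by rewrite enorm_gt0 g0.
have gg : 0 < dot (grad rho x) (grad rho x) by rewrite dotxx_gt0 g0.
have [m m0 mP] := defining_crossing LD Vx rx gg.
have [t [t0 tm te]] := pos_below2 m0 (divr_gt0 e0 gn).
exists (x - t *: grad rho x); first by have [|] := mP t; rewrite ?t0.
by rewrite addrAC subrr add0r enormN enormZ gtr0_norm// -ltr_pdivlMr.
Qed.

(** A Farkas lemma for one inequality. If [g] had a component [u] orthogonal to [p], the direction
    [u - e p] with small [e] would point into the half-space and still satisfy [g . d > 0]. *)
Lemma parallel_of_halfspace g p : p != 0 -> g != 0 ->
  (forall d, dot d p < 0 -> dot g d <= 0) -> exists2 l, 0 < l & g = l *: p.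
Proof.
move=> p0 g0 H; have pp : 0 < dot p p by rewrite dotxx_gt0.
have gp : 0 <= dot g p.
  by have := H (- p); rewrite dotNl dotNr !oppr_lt0 oppr_le0; apply.
pose l := dot g p / dot p p.
have [u uE] : exists u, u = g - l *: p by eexists.
have gE : g = u + l *: p by rewrite uE subrK.
have up : dot u p = 0 by rewrite uE dotBl dotZl /l divfK ?subrr// gt_eqF.
have gu : dot g u = dot u u by rewrite {1}gE dotDl dotZl (dotC p) up mulr0 addr0.
have uu : dot u u = 0.
  apply/eqP; rewrite eq_le dotxx_ge0 andbT leNgt; apply/negP => u0.
  pose e := dot u u / (dot g p + 1) / 2.
  have e0 : 0 < e by rewrite !divr_gt0//; lra.
  have := H (u - e *: p); rewrite !dotE up add0r oppr_lt0 mulr_gt0// gu => /(_ isT).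
  have eE : 2 * e * (dot g p + 1) = dot u u by rewrite /e; field; lra.
  nra.
have u0 : u = 0 by apply/eqP; rewrite -dotxx_eq0 uu.
exists l; last by rewrite {1}gE u0 add0r.
rewrite lt_neqAle /l divr_ge0 ?(ltW pp)// andbT eq_sym.
by apply: contra_neq g0 => l0; rewrite gE u0 add0r /l l0 scale0r.
Qed.

Lemma normal_of_inner_ball A p V rho : open A -> local_defining A p V rho -> bdry A p ->
  p != 0 -> ballO (enorm p) `<=` A -> exists2 l, 0 < l & grad rho p = l *: p.
Proof.
move=> oA LD bp p0 BA; have r0 := local_defining_bdry0 oA LD bp; have [_ Vp _ g0 _] := LD.
apply: parallel_of_halfspace => //; first exact: g0.
move=> d dp; rewrite leNgt; apply/negP => gd.
have [m m0 mP] := defining_crossing LD Vp r0 gd.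
have dd : 0 < dot d d.
  by rewrite dotxx_gt0; apply: contraTneq dp => ->; rewrite dot0l ltxx.
have dp' : 0 < - dot d p / dot d d by rewrite divr_gt0// oppr_gt0.
have [t [t0 tm]] := pos_below2 m0 dp'; rewrite ltr_pdivlMr// => td.
have [|_ nA] := mP t; first by rewrite t0.
apply: nA; apply: BA; rewrite /ballO /= enorm_lt !dotE (dotC p d).
have : t * (t * dot d d + 2 * dot d p) < 0 by rewrite pmulr_rlt0//; lra.
lra.
Qed.

(** If [rho] increased along some [d] with [d . p < 0], a step along [- d] would enter [A] while
    increasing the norm. *)
Lemma normal_of_outer_ball A p V rho : open A -> local_defining A p V rho -> bdry A p ->
  p != 0 -> A `<=` ballO (enorm p) -> exists2 l, 0 < l & grad rho p = l *: p.
Proof.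
move=> oA LD bp p0 AB; have r0 := local_defining_bdry0 oA LD bp; have [_ Vp _ g0 _] := LD.
apply: parallel_of_halfspace => //; first exact: g0.
move=> d dp; rewrite leNgt; apply/negP => gd.
have [m m0 mP] := defining_crossing LD Vp r0 gd.
have t0 : 0 < m / 2 by rewrite divr_gt0.
have [|/AB + _] := mP (m / 2); first by rewrite t0 ltr_pdivrMr//; lra.
move: (m / 2) t0 => t t0; rewrite /ballO /= enorm_lt !dotE (dotC p d).
have := dotxx_ge0 d; have : 0 < t * (t * dot d d - 2 * dot d p).
  by have := dotxx_ge0 d => dd; rewrite mulr_gt0//; nra.
lra.
Qed.

Section Metric.
Variable h : R -> R.

Lemma mul_ginv g p : p != 0 -> h (enorm p) != 0 ->
  g *m ginv h p = stretch h (enorm p) *: g +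
    ((1 - stretch h (enorm p)) / enorm p ^+ 2 * dot g p) *: p.
Proof.
move=> p0 h0; rewrite ginvE// mulmxDr mul_mx_scalar -[g *m (_ *: _)]scalemxAr.
by rewrite mul_outer scalerA.
Qed.

Lemma outer_normal_radial A p V rho l : p != 0 -> 0 < h (enorm p) ->
  local_defining A p V rho -> 0 < l -> grad rho p = l *: p ->
  outer_normal h A p ((enorm p)^-1 *: p).
Proof.
move=> p0 h0 LD l0 gE; exists V, rho; split=> //.
have := enorm_gt0 p; rewrite p0 => r0.
rewrite mul_ginv ?gt_eqF// gE.
have -> : stretch h (enorm p) *: (l *: p) +
   ((1 - stretch h (enorm p)) / enorm p ^+ 2 * dot (l *: p) p) *: p = l *: p.
  rewrite scalerA -scalerDl dotZl -enorm_sqr; congr (_ *: _); field.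
  by rewrite gt_eqF.
rewrite -dot_mulmx dotZl dotZr -enorm_sqr scalerA; congr (_ *: _).
have -> : l * (l * enorm p ^+ 2) = (l * enorm p) ^+ 2 by ring.
rewrite sqrtr_sqr gtr0_norm ?mulr_gt0//; field.
by rewrite !gt_eqF.
Qed.

(* The hypothesis [dot nu p = |p|] says that the angle between [nu] and the radial direction
   vanishes; by equality in Cauchy-Schwarz the normal is then radial. *)
Lemma outer_normal_aligned A p V rho : p != 0 -> 0 < h (enorm p) ->
  local_defining A p V rho ->
  exists2 nu, outer_normal h A p nu &
    dot p nu = enorm p -> exists l, grad rho p = l *: p.
Proof.
move=> p0 h0 LD; have := enorm_gt0 p; rewrite p0 => r0.
have [_ Vp _ /(_ p Vp) gn0 _] := LD.
have gin : grad rho p *m ginv h p = _ := mul_ginv (grad rho p) p0 (lt0r_neq0 h0).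
eexists; first by exists V, rho; split; [exact: LD|reflexivity].
rewrite -dot_mulmx gin dotZr !dotE.
have gg : 0 < dot (grad rho p) (grad rho p) by rewrite dotxx_gt0.
have CS := dot_sqr_le (grad rho p) p.
have pp : dot p p = enorm p ^+ 2 by rewrite enorm_sqr.
rewrite (dotC p (grad rho p)) pp.
have A0 : 0 < stretch h (enorm p) by rewrite /stretch exprn_gt0// divr_gt0.
rewrite pp in CS.
set G := dot (grad rho p) (grad rho p) in gg CS *.
set P := dot (grad rho p) p in CS *.
have [PE _|nPE] := eqVneq (P ^+ 2) (G * enorm p ^+ 2).
  exists (P / enorm p ^+ 2); apply/eqP; rewrite -subr_eq0 -dotxx_eq0 !dotE.
  rewrite (dotC p (grad rho p)) -/G -/P pp; apply/eqP.
  rewrite [LHS](_ : _ = G - P ^+ 2 / enorm p ^+ 2); last by field; rewrite gt_eqF.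
  by rewrite PE mulfK ?subrr// expf_neq0// gt_eqF.
have CSlt : P ^+ 2 < G * enorm p ^+ 2 by rewrite lt_neqAle nPE.
have -> : stretch h (enorm p) * P + (1 - stretch h (enorm p)) / enorm p ^+ 2 * P * enorm p ^+ 2 = P.
  by field; rewrite gt_eqF.
(* [W] is the squared metric length of the gradient; [W |p|^2] exceeds [P^2] by [stretch] times the
   Gram determinant of the gradient and [p], positive in this case. *)
set W := stretch h (enorm p) * G + _.
have WE : W * enorm p ^+ 2 = P ^+ 2 + stretch h (enorm p) * (G * enorm p ^+ 2 - P ^+ 2).
  by rewrite /W; field; rewrite gt_eqF.
have r2 : 0 < enorm p ^+ 2 by rewrite exprn_gt0.
have Wgt : P ^+ 2 < W * enorm p ^+ 2 by rewrite WE ltrDl mulr_gt0// subr_gt0.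
have W0 : 0 < W by rewrite -(pmulr_lgt0 _ r2); apply: le_lt_trans Wgt; exact: sqr_ge0.
have sW : 0 < Num.sqrt W by rewrite sqrtr_gt0.
move=> /(congr1 (fun k : R => (k * Num.sqrt W) ^+ 2)).
rewrite mulrAC mulVf ?gt_eqF// mul1r exprMn (sqr_sqrtr (ltW W0)) => PW.
by move: Wgt; rewrite PW mulrC ltxx.
Qed.

End Metric.

(* The curves [s |-> r (p + s tau) / |p + s tau|] on spheres of radius [r] cross the boundary
   transversally when [tau], the tangential part of the normal at [p], does not vanish. *)
Lemma nonradial_normal_radii A p V rho e : open A -> local_defining A p V rho -> bdry A p ->
  p != 0 -> (forall l, grad rho p <> l *: p) -> 0 < e ->
  exists m e1, [/\ 0 < e1, enorm p <= m & forall r, `|r - m| < e1 ->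
    exists x, [/\ bdry A x, enorm x = r, V x & enorm (x - p) < e]].
Proof.
move=> oA LD bp p0 npar e0; have rp0 := local_defining_bdry0 oA LD bp.
have [oV Vp [dr _] g0 Ar] := LD.
have pp : 0 < dot p p by rewrite dotxx_gt0.
have ep : 0 < enorm p by rewrite enorm_gt0.
set g := grad rho p in npar *.
have [u uE] : exists u, u = g - (dot g p / dot p p) *: p by eexists.
have gE : g = u + (dot g p / dot p p) *: p by rewrite uE subrK.
have up : dot u p = 0 by rewrite uE dotBl dotZl divfK ?subrr// gt_eqF.
have u0 : u != 0.
  by apply/eqP => u0; apply: (npar (dot g p / dot p p)); rewrite {1}gE u0 add0r.
have uu : 0 < dot u u by rewrite dotxx_gt0.
have eu : 0 < enorm u by rewrite enorm_gt0.
have gu : 0 < dot g u by rewrite gE dotDl dotZl (dotC p) up mulr0 addr0.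
have [k k0 kV] := (open_enormP V).1 oV p Vp.
have [m1 m10 m1P] := directional_sign (dr p Vp) gu.
pose e' := Num.min e k.
have e'0 : 0 < e' by rewrite lt_min e0.
pose s0 := Num.min (m1 / 2) (e' / (4 * enorm u)).
have s00 : 0 < s0 by rewrite lt_min !divr_gt0// mulr_gt0.
have s0m : 0 < s0 < m1.
  rewrite s00; apply: (@le_lt_trans _ _ (m1 / 2)); [by rewrite ge_min lexx|lra].
have s0e : s0 * enorm u <= e' / 4.
  rewrite -ler_pdivlMr//; have : s0 <= e' / (4 * enorm u) by rewrite ge_min lexx orbT.
  by rewrite invfM mulrA.
have /andP[rneg rpos] := m1P s0 s0m; rewrite rp0 in rneg rpos.
have zz s : dot (p + s *: u) (p + s *: u) = dot p p + s ^+ 2 * dot u u.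
  by rewrite !dotE (dotC p u) up; ring.
have zgt s : 0 < dot (p + s *: u) (p + s *: u) by rewrite zz ltr_wpDr// mulr_ge0 ?sqr_ge0// ltW.
have zn s : 0 < enorm (p + s *: u) by rewrite enorm_gt0 -dotxx_gt0.
(* The endpoints [p + s0 u] and [p - s0 u] have this same norm, and [rho] has opposite signs there.
   The signs persist on spheres of radius close to [m], so the intermediate value theorem gives a
   boundary point on each. *)
pose m := enorm (p + s0 *: u).
have mN : enorm (p - s0 *: u) = m.
  by rewrite /m !enormE -[- (s0 *: u)]scaleNr !zz sqrrN.
have mle s : - s0 <= s <= s0 -> enorm p <= enorm (p + s *: u) <= m.
  move=> /andP[s1 s2]; have ss : s ^+ 2 <= s0 ^+ 2 by nra.
  apply/andP; split; rewrite /m !enormE ler_sqrt ?zz ?lerDl ?lerD2l.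
  - by rewrite mulr_ge0 ?sqr_ge0// ltW.
  - by rewrite -zz ltW.
  - by rewrite ler_pM2r.
  - by rewrite -zz ltW.
have mp : m <= enorm p + e' / 4.
  by apply: le_trans (enormD _ _) _; rewrite enormZ (gtr0_norm s00) lerD2l.
have m0 : 0 < m by exact: zn.
pose c r s := (r / enorm (p + s *: u)) *: (p + s *: u).
have cm1 : c m s0 = p + s0 *: u by rewrite /c divff ?scale1r// gt_eqF.
have cm2 : c m (- s0) = p - s0 *: u by rewrite /c scaleNr mN divff ?scale1r// gt_eqF.
have sI : - s0 <= s0 by lra.
have cclose r s : 0 <= r -> `|r - m| < e' / 4 -> - s0 <= s <= s0 -> enorm (c r s - p) < e'.
  move=> r0 rm sI'; have /andP[h1 h2] := mle s sI'.
  have : enorm (c r s - (p + s *: u)) = `|r - enorm (p + s *: u)|.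
    rewrite (_ : c r s - _ = (r / enorm (p + s *: u) - 1) *: (p + s *: u)); last first.
      by rewrite scalerBl scale1r.
    rewrite enormZ -[X in _ * X](gtr0_norm (zn s)) -normrM mulrBl mul1r divfK//.
    by rewrite gt_eqF.
  move=> c1; have c2 : enorm (s *: u) <= e' / 4.
    rewrite enormZ; apply: le_trans s0e; rewrite ler_pM2r// ler_norml//.
  have -> : c r s - p = (c r s - (p + s *: u)) + s *: u.
    by rewrite opprD addrA subrK.
  apply: le_lt_trans (enormD _ _) _; rewrite c1.
  have c4 : `|r - enorm (p + s *: u)| < e' / 2.
    by move: rm; rewrite !ltr_norml => /andP[a1 a2]; apply/andP; split; lra.
  move: c2 c4; move: `|_| (enorm (s *: u)) => w1 w2; lra.
have ee : e' <= e by rewrite ge_min lexx.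
have ek : e' <= k by rewrite ge_min lexx orbT.
have cV r s : 0 <= r -> `|r - m| < e' / 4 -> - s0 <= s <= s0 -> V (c r s).
  by move=> h1 h2 h3; apply: kV; apply: lt_le_trans (cclose r s h1 h2 h3) ek.
have ccr s : (fun r => c r s) @ m --> c m s.
  apply: cvgZ; last exact: cvg_cst.
  by apply: cvgM; [exact: cvg_id|exact: cvg_cst].
have nearsign s : - s0 <= s <= s0 -> (fun r => rho (c r s)) @ m --> rho (c m s).
  move=> sI'; have Vc : V (c m s) by apply: cV => //; [exact: ltW|rewrite subrr normr0 divr_gt0].
  have crho : {for c m s, continuous rho} by exact/differentiable_continuous/dr.
  exact: (continuous_cvg _ crho (ccr s)).
have n1 : \forall r \near m, 0 < rho (c r s0).
  have := nearsign s0; rewrite sI lexx => /(_ isT) /cvgr_gt; apply.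
  by rewrite cm1.
have n2 : \forall r \near m, rho (c r (- s0)) < 0.
  have := nearsign (- s0); rewrite sI lexx => /(_ isT) /cvgr_lt; apply.
  by rewrite cm2.
have /nbhs_ballP[d1 /= d10 d1P] : \forall r \near m, 0 < rho (c r s0) /\ rho (c r (- s0)) < 0.
  exact: filterI.
pose dd := Num.min d1 (Num.min (e' / 4) m).
exists m, dd; split.
- by rewrite !lt_min d10 m0 divr_gt0.
- have s0I : - s0 <= s0 <= s0 by rewrite sI lexx.
  by have /andP[] := mle s0 s0I.
move=> r; rewrite !lt_min => /andP[rd1 /andP[re rm]].
have r0 : 0 < r by move: rm; rewrite ltr_norml => /andP[]; lra.
have [rr1 rr2] : 0 < rho (c r s0) /\ rho (c r (- s0)) < 0.
  by apply: d1P; rewrite /ball /= distrC.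
have ck : {within `[- s0, s0], continuous (fun s => rho (c r s))}.
  apply: continuous_in_subspaceT => s /set_mem; rewrite /= in_itv /= => sI'.
  have Vc : V (c r s) by apply: cV => //; exact: ltW.
  have cz := @continuous_line _ _ p u s.
  have cc : (fun s => c r s) @ s --> c r s.
    apply: cvgZ; last exact: cz.
    apply: cvgM; first exact: cvg_cst.
    apply: cvgV; first by rewrite gt_eqF.
    have ce : {for p + s *: u, continuous (@enorm R N)}.
      by apply/differentiable_continuous/differentiable_enorm; rewrite -enorm_gt0.
    exact: (continuous_cvg _ ce cz).
  have crho : {for c r s, continuous rho} by exact/differentiable_continuous/dr.
  exact: (continuous_cvg _ crho cc).
have [|s sI' rs] := IVT sI ck (v := 0).
  by rewrite ge_min le_max (ltW rr1) (ltW rr2) orbT.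
rewrite in_itv /= in sI'.
exists (c r s); split.
- by apply: (local_defining_zero_bdry oA LD) => //; apply: cV => //; exact: ltW.
- by rewrite /c enormZ ger0_norm ?divfK ?gt_eqF// divr_ge0// ltW.
- by apply: cV => //; exact: ltW.
- by apply: lt_le_trans (cclose r s (ltW r0) re sI') ee.
Qed.

End Normals.

(** * Domains all of whose normals are radial *)

Section RadialNormals.
Variables (R : realType) (N : nat).
Local Notation E := 'rV[R]_N.
Implicit Types (x y z v d p q g : E) (a b t r s : R) (A V : set E) (rho : E -> R).

Lemma flat_constant (k : R -> R) :
  (forall t, 0 <= t <= 1 -> forall e, 0 < e -> exists2 c, 0 < c &
     forall s, `|s - t| < c -> `|k s - k t| <= e * `|s - t|) -> k 0 = k 1.
Proof.
move=> H.
have Dk t : 0 <= t <= 1 -> is_derive t 1 k 0.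
  move=> t01; have cv : (fun s => s^-1 *: (k (s *: 1 + t) - k t)) @ 0^' --> (0 : R).
    apply/cvgrPdist_le => e e0; have [c c0 cP] := H t t01 e e0.
    rewrite near_withinE; apply/nbhs_ballP; exists c => // s.
    rewrite /ball /= sub0r normrN => sc s0; rewrite sub0r normrN normrM normfV.
    rewrite mulrC ler_pdivrMr ?normr_gt0//.
    by have := cP (s *: 1 + t); rewrite addrK /GRing.scale /= mulr1; apply.
  by apply: DeriveDef; [apply/cvg_ex; exists 0|apply/cvg_lim].
have [||c _] := @MVT_segment _ k (cst 0) 0 1 ler01.
- by move=> t; rewrite in_itv /= => /andP[t0 t1]; apply: Dk; rewrite !ltW.
- apply: continuous_within_segment => t /Dk; exact: is_derive_continuous.
by rewrite /cst mul0r => /eqP; rewrite subr_eq0 => /eqP.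
Qed.

Definition direction x : E := (enorm x)^-1 *: x.

Lemma enorm_direction x : x != 0 -> enorm (direction x) = 1.
Proof.
rewrite -enorm_gt0 => x0; rewrite enormZ gtr0_norm ?invr_gt0// mulVf//.
by rewrite gt_eqF.
Qed.

Lemma scale_direction x : x != 0 -> enorm x *: direction x = x.
Proof.
by rewrite -enorm_gt0 => x0; rewrite scalerA divff ?scale1r// gt_eqF.
Qed.

Lemma direction_lipschitz x y : x != 0 -> y != 0 ->
  enorm (direction y - direction x) <= 2 / enorm x * enorm (y - x).
Proof.
move=> x0 y0; have := enorm_gt0 x; have := enorm_gt0 y; rewrite x0 y0 => ey ex.
have -> : direction y - direction x =
    (enorm x)^-1 *: (y - x) + ((enorm x - enorm y) / enorm x) *: direction y.
  rewrite /direction scalerBr scalerA addrAC; congr (_ - _).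
  rewrite -scalerDl; congr (_ *: _); field.
  by rewrite !gt_eqF.
apply: le_trans (enormD _ _) _.
rewrite [enorm (_ *: (y - x))]enormZ [enorm (_ *: direction y)]enormZ enorm_direction// mulr1.
rewrite normrM !normfV !(gtr0_norm ex) [_^-1 * _]mulrC -mulrDl.
rewrite mulrAC ler_pM2r ?invr_gt0//.
by have := enorm_distr x y; rewrite enormB; lra.
Qed.

Variables (A : set E) (R0 r2 : R).
Hypotheses (R00 : 0 < R0) (oA : open A) (inA : ballO R0 `<=` A) (outA : A `<=` ballO r2).

(** [A] is not known to be star-shaped and the ray may return to it, so the first exit is an infimum
    over all times spent outside. *)
Definition exits x : set R := [set s | 0 <= s /\ ~ A (s *: direction x)].
Definition first_exit x : R := inf (exits x).

Lemma first_exitP x : x != 0 -> [/\ R0 <= first_exit x,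
  ~ A (first_exit x *: direction x) & forall s, 0 <= s < first_exit x -> A (s *: direction x)].
Proof.
move=> x0; have dx := enorm_direction x0.
have r0 : 0 < r2.
  have /outA : A 0 by apply: inA; rewrite /ballO /= enorm0.
  by rewrite /ballO /= enorm0.
have ne : exits x !=set0.
  exists r2; split; first exact: ltW.
  by move=> /outA; rewrite /ballO /= enormZ dx mulr1 gtr0_norm// ltxx.
have lb : lbound (exits x) R0.
  move=> s [s0 ns]; rewrite leNgt; apply/negP => sR; apply: ns; apply: inA.
  by rewrite /ballO /= enormZ dx mulr1 ger0_norm.
have hi : has_inf (exits x) by split=> //; exists R0.
have T0 : R0 <= first_exit x by exact: lb_le_inf.
have below s : 0 <= s < first_exit x -> A (s *: direction x).
  move=> /andP[s0 sT]; apply: contrapT => ns.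
  have : first_exit x <= s by apply: ge_inf; [exists R0|split].
  by rewrite leNgt sT.
split=> // AT; have [e e0 eP] := (open_enormP A).1 oA _ AT.
have [s [s0 ns] sT] := inf_adherent e0 hi.
apply: ns; have [sl|sl] := ltP s (first_exit x); first by apply: below; rewrite s0.
apply: eP; rewrite -scalerBl enormZ dx mulr1 ger0_norm ?subr_ge0//.
by rewrite ltrBlDl.
Qed.

Lemma first_exit_le x s : 0 <= s -> ~ A (s *: direction x) -> first_exit x <= s.
Proof.
move=> s0 ns; apply: ge_inf; last by split.
by exists 0 => t [].
Qed.

Hypothesis normals : forall p, bdry A p ->
  exists V rho, local_defining A p V rho /\ exists l, grad rho p = l *: p.

(* At an exit point the boundary is perpendicular to the ray, so moving the ray by [w]
   changes the exit time by [o(w)]. *)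
Lemma first_exit_flat x e : x != 0 -> 0 < e -> exists2 c, 0 < c &
  forall y, y != 0 -> enorm (direction y - direction x) < c ->
    `|first_exit y - first_exit x| <= e * enorm (direction y - direction x).
Proof.
move=> x0 e0; have [TR nAT below] := first_exitP x0.
set T := first_exit x in TR nAT below *; set n := direction x in nAT below *.
have T0 : 0 < T by exact: lt_le_trans TR.
have en : enorm n = 1 by exact: enorm_direction.
have nn : dot n n = 1 by rewrite -enorm_sqr en expr1n.
set p := T *: n in nAT *.
have ep : enorm p = T by rewrite enormZ en mulr1 gtr0_norm.
have p0 : p != 0 by rewrite -enorm_gt0 ep.
have bp : bdry A p.
  apply: open_bdry => //; apply/closure_enormP => k k0.
  have [t [t0 tk tT]] := pos_below2 k0 T0.
  exists ((T - t) *: n); first by apply: below; apply/andP; split; lra.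
  by rewrite -scalerBl enormZ en mulr1 addrAC subrr add0r normrN gtr0_norm.
have [V [rho [LD [l gE]]]] := normals bp.
have rp0 := local_defining_bdry0 oA LD bp.
have [oV Vp [dr _] gn0 Ar] := LD.
(* The ray reaches [p] from inside [A]; with [l < 0] the points just before [p] would lie
   outside. *)
have l0 : 0 < l.
  rewrite ltNge; apply/negP => l0.
  have ln0 : l != 0.
    by apply: contraNneq (gn0 p Vp) => l00; rewrite gE l00 scale0r.
  have gd : 0 < dot (grad rho p) (- p).
    rewrite gE dotZl dotNr -enorm_sqr ep; have : l < 0 by rewrite lt_neqAle ln0.
    have := exprn_gt0 2 T0; nra.
  have [m m0 mP] := defining_crossing LD Vp rp0 gd.
  have [t [t0 tm t1]] := pos_below2 m0 ltr01.
  have [|_] := mP t; first by rewrite t0.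
  apply; have -> : p + t *: - p = ((1 - t) * T) *: n.
    by rewrite scalerN -scalerA scalerBl scale1r.
  by apply: below; apply/andP; split; nra.
(* The linearisation tolerance, chosen with [4 ee (e + T) = l T e]: at distance [(e + T) w] from [p]
   the error is a quarter of the first-order gain [l T e w]. *)
pose ee := l * T * e / (4 * (e + T)).
have eT : 0 < e + T by rewrite addr_gt0.
have ee0 : 0 < ee by rewrite divr_gt0 ?mulr_gt0.
have eeE : 4 * (ee * (e + T)) = l * T * e by rewrite /ee; field; rewrite gt_eqF.
have [k k0 kP] := differentiable_enormP (dr p Vp) ee0.
have [k2 k20 kV] := (open_enormP V).1 oV p Vp.
pose k' := Num.min k k2.
have k'0 : 0 < k' by rewrite lt_min k0.
pose d0 := Num.min (k' / 4) (T / 2).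
have d00 : 0 < d0 by rewrite lt_min !divr_gt0.
have d0k : d0 <= k' / 4 by rewrite ge_min lexx.
have d0T : d0 <= T / 2 by rewrite ge_min lexx orbT.
have k'k : k' <= k by rewrite ge_min lexx.
have k'k2 : k' <= k2 by rewrite ge_min lexx orbT.
(* By compactness of the initial piece of the ray, neighbouring rays stay in [A] up to time
   [T - d0]; an early exit can only occur near [p]. *)
have tube : \forall m \near n, `[0, T - d0]%classic `<=` (fun s => A (s *: m)).
  have /compact_near_coveringP := @segment_compact R 0 (T - d0).
  move=> /(_ _ (nbhs n) (fun m s => A (s *: m))); apply.
  move=> s; rewrite /= in_itv /= => /andP[s0 sT].
  have As : A (s *: n) by apply: below; rewrite s0 /=; lra.
  have : (fun z : R * E => z.1 *: z.2) @ (s, n) --> s *: n.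
    by apply: cvgZ; [exact: cvg_fst|exact: cvg_snd].
  by apply; exact: open_nbhs_nbhs.
have /nbhs_enormP[c1 c10 c1P] := tube.
pose c := Num.min c1 (Num.min (e / (2 * (T + e))) (Num.min 1 (Num.min (k' / (2 * T)) (k' / (4 * (e + T)))))).
exists c.
  by rewrite !lt_min c10 ltr01 !divr_gt0// mulr_gt0// addrC.
move=> y y0; set m := direction y; set w := enorm (m - n).
rewrite /c !lt_min => /andP[wc1 /andP[we /andP[w1 /andP[wk wk']]]].
have em : enorm m = 1 by exact: enorm_direction.
have [w0|wn0] := eqVneq w 0.
  have mn : m = n.
    by apply/eqP; rewrite -subr_eq0 -enorm_eq0 -/w w0.
  rewrite w0 mulr0; have -> : first_exit y = T by rewrite /T /first_exit /exits -/m -/n mn.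
  by rewrite subrr normr0.
have wp : 0 < w by rewrite lt_neqAle eq_sym wn0 enorm_ge0.
have mn : dot m n = 1 - w ^+ 2 / 2.
  have mm : dot m m = 1 by rewrite -enorm_sqr em expr1n.
  have : w ^+ 2 = dot m m - 2 * dot m n + dot n n.
    by rewrite /w enorm_sqr dotBl !dotBr (dotC n m); ring.
  by rewrite mm nn; lra.
(* The gradient being radial, turning the ray by [w] enters the linear part only through the cosine
   [1 - w^2 / 2], that is, quadratically. *)
have pz s : dot (grad rho p) (s *: m - p) = l * T * (s - T) - l * T * s * (w ^+ 2 / 2).
  rewrite gE dotZl dotBr dotZr -enorm_sqr ep /p dotZl (dotC n m) mn; ring.
have zp s : enorm (s *: m - p) <= `|s - T| + T * w.
  have -> : s *: m - p = (s - T) *: m + T *: (m - n).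
    by rewrite scalerBl scalerBr addrA subrK.
  apply: le_trans (enormD _ _) _.
  by rewrite (enormZ _ m) (enormZ T) em mulr1 (gtr0_norm T0).
have wk2 : T * w < k' / 2.
  by move: wk; rewrite ltr_pdivlMr ?mulr_gt0//; lra.
have wk4 : (e + T) * w < k' / 4.
  by move: wk'; rewrite ltr_pdivlMr ?mulr_gt0//; lra.
have we2 : (T + e) * w < e / 2.
  by move: we; rewrite ltr_pdivlMr ?mulr_gt0 1?addrC//; lra.
have ew0 : 0 < e * w by rewrite mulr_gt0.
have lT : 0 < l * T by rewrite mulr_gt0.
have [TRy nATy belowy] := first_exitP y0.
rewrite ler_norml; apply/andP; split.
- rewrite lerBrDr addrC; rewrite leNgt; apply/negP => Ty.
  apply: nATy; rewrite -/m; set s := first_exit y in Ty TRy *.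
  have s0 : 0 <= s by apply: le_trans TRy; exact: ltW.
  have [sd|sd] := leP s (T - d0).
    by apply: (c1P m wc1 s); rewrite /= in_itv /= s0.
  have sT : `|s - T| = T - s by rewrite ltr0_norm ?opprB//; lra.
  have zk : enorm (s *: m - p) < k'.
    by apply: le_lt_trans (zp s) _; rewrite sT; lra.
  have Vz : V (s *: m) by apply: kV; exact: lt_le_trans k'k2.
  apply/(Ar _ Vz); have := kP (s *: m) (lt_le_trans zk k'k).
  rewrite rp0 subr0 pz ler_norml => /andP[_ h1].
  have h2 : ee * enorm (s *: m - p) <= ee * (T - s + T * w).
    by rewrite ler_pM2l// -sT.
  have h3 : 0 <= l * T * s * (w ^+ 2 / 2).
    by rewrite !mulr_ge0 ?divr_ge0 ?sqr_ge0// ltW.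
  have h4 : 4 * ee <= l * T.
    rewrite -(ler_pM2r eT) -mulrA eeE mulrDr lerDl; exact/ltW/mulr_gt0.
  have h5 : (l * T - ee) * (T - s) >= (l * T - ee) * (e * w).
    by apply: ler_wpM2l; lra.
  have h6 : ee * (e * w) + ee * (T * w) < l * T * (e * w).
    have -> : ee * (e * w) + ee * (T * w) = ee * (e + T) * w by ring.
    have -> : l * T * (e * w) = 4 * (ee * (e + T)) * w by rewrite eeE; ring.
    have := mulr_gt0 (mulr_gt0 ee0 eT) wp; lra.
  move: h1 h2 h3 h5 h6; move: (rho _) (enorm _) => k3 k4.
  by clear; lra.
- rewrite lerBlDl; set s := T + e * w.
  have s0 : 0 <= s by rewrite /s; lra.
  apply: first_exit_le => //; rewrite -/m => As.
  have sT : `|s - T| = e * w by rewrite /s addrAC subrr add0r gtr0_norm.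
  have zk : enorm (s *: m - p) < k'.
    by apply: le_lt_trans (zp s) _; rewrite sT; lra.
  have Vz : V (s *: m) by apply: kV; exact: lt_le_trans k'k2.
  have rs := (Ar _ Vz).1 As; have := kP (s *: m) (lt_le_trans zk k'k).
  rewrite rp0 subr0 pz ler_norml => /andP[h1 _].
  have h2 : ee * enorm (s *: m - p) <= ee * (e * w + T * w).
    by rewrite ler_pM2l// -sT.
  have h3 : s * w <= e / 2.
    apply: le_trans (ltW we2); rewrite /s; apply: ler_wpM2r; [exact: ltW|].
    by rewrite lerD2l ler_piMr// ltW.
  have h4 : l * T * s * (w ^+ 2 / 2) <= l * T * (e * w) / 4.
    have -> : l * T * s * (w ^+ 2 / 2) = l * T * w / 2 * (s * w) by field.
    have -> : l * T * (e * w) / 4 = l * T * w / 2 * (e / 2) by field.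
    by apply: ler_wpM2l => //; rewrite divr_ge0// ltW// mulr_gt0.
  have h5 : ee * (e * w + T * w) = l * T * (e * w) / 4.
    have -> : l * T * (e * w) = 4 * (ee * (e + T)) * w by rewrite eeE; ring.
    by field.
  have h6 : l * T * (s - T) = l * T * (e * w) by rewrite /s; ring.
  have h7 : 0 < l * T * (e * w) by rewrite mulr_gt0.
  move: h1 h2; rewrite h5 h6; lra.
Qed.

Lemma first_exit_constant x y : (2 <= N)%N -> x != 0 -> y != 0 -> first_exit x = first_exit y.
Proof.
move=> N2; suff H u v : avoids0 u v -> first_exit u = first_exit v.
  move=> x0 y0; have [z [_ _ xz zy]] := avoids0_two_steps N2 x0 y0.
  by rewrite (H x z)// (H z y).
move=> uv; pose z t := u + t *: (v - u).
have := @flat_constant (fun t => first_exit (z t)).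
rewrite /z scale0r addr0 scale1r subrKC; apply => t t01 e e0.
have z0 : z t != 0 by exact: uv.
have ez : 0 < enorm (z t) by rewrite enorm_gt0.
(* A Lipschitz constant at [t] for the direction along the segment; the [+ 1] keeps it invertible
   when [u = v]. *)
pose L := 2 / enorm (z t) * enorm (v - u) + 1.
have L0 : 0 < L.
  by rewrite /L ltr_wpDl// mulr_ge0 ?enorm_ge0// divr_ge0// ltW.
have [c c0 cP] := first_exit_flat z0 (divr_gt0 e0 L0).
have L1 : 0 < enorm (v - u) + 1 by have := enorm_ge0 (v - u); lra.
exists (Num.min (c / L) (enorm (z t) / (enorm (v - u) + 1))).
  by rewrite lt_min !divr_gt0.
move=> s; rewrite lt_min => /andP[sc sz].
have zz : z s - z t = (s - t) *: (v - u).
  by rewrite /z opprD addrACA subrr add0r -scalerBl.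
have zs0 : z s != 0.
  apply/eqP => zs; move: zz; rewrite zs sub0r => /(congr1 (@enorm R N)).
  rewrite enormN enormZ => zE; move: sz; rewrite ltr_pdivlMr// zE.
  by have := normr_ge0 (s - t); nra.
have dd : enorm (direction (z s) - direction (z t)) <= L * `|s - t|.
  apply: le_trans (direction_lipschitz z0 zs0) _; rewrite zz enormZ.
  rewrite [X in _ * X]mulrC mulrA ler_wpM2r// /L; lra.
have dc : enorm (direction (z s) - direction (z t)) < c.
  by apply: le_lt_trans dd _; rewrite mulrC -ltr_pdivlMr.
apply: le_trans (cP _ zs0 dc) _.
have -> : e * `|s - t| = e / L * (L * `|s - t|) by field; rewrite gt_eqF.
by rewrite ler_wpM2l// divr_ge0// ltW.
Qed.

(** With a constant exit time [r], the sphere of radius [r] misses [A]. As [A] is connected and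
    contains the pole, it stays inside, which also excludes re-entering rays. *)
Lemma ball_of_radial_normals : (2 <= N)%N -> connected A ->
  exists2 r, R0 <= r & A = ballO r.
Proof.
move=> N2 cA; have [z0 z00 _] := orthogonal_vector (0 : E) N2.
have [TR _ _] := first_exitP z00; exists (first_exit z0) => //.
set r := first_exit z0 in TR *.
have r0 : 0 < r by exact: lt_le_trans TR.
have A0 : A 0 by apply: inA; rewrite /ballO /= enorm0.
have TE x : x != 0 -> first_exit x = r by move=> x0; exact: first_exit_constant.
have nr x : enorm x = r -> ~ A x.
  move=> xr; have x0 : x != 0 by rewrite -enorm_gt0 xr.
  by have [_ + _] := first_exitP x0; rewrite TE// -xr scale_direction.
apply/seteqP; split=> x; rewrite /ballO /=.
  move=> Ax; apply: (@connected_locally_constant _ A (fun x => enorm x < r) cA _ _ 0) => //.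
  - move=> y Ay yr; apply/nbhs_enormP; exists (r - enorm y); first by rewrite subr_gt0.
    by move=> z zy _; have := enorm_distr z y; rewrite ler_norml => /andP[_]; lra.
  - move=> y Ay /negP; rewrite -leNgt => yr.
    have yr' : r < enorm y.
      by rewrite lt_neqAle yr andbT; apply/eqP => yE; exact: (nr y (esym yE)).
    apply/nbhs_enormP; exists (enorm y - r); first by rewrite subr_gt0.
    move=> z zy _; apply/negP; rewrite -leNgt; have := enorm_distr z y.
    by rewrite ler_norml => /andP[+ _]; lra.
  - by rewrite enorm0.
move=> xr; have [->//|x0] := eqVneq x 0.
have [_ _ below] := first_exitP x0; rewrite -(scale_direction x0).
by apply: below; rewrite enorm_ge0 TE.
Qed.

End RadialNormals.

(** * The overdetermined problem *)

Section Domain.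
Variables (R : realType) (N : nat) (S : \bar R) (h : R -> R) (R0 Rr : R).
Local Notation E := 'rV[R]_N.
Implicit Types (x y z v p q c : E) (a b t r s k e : R) (w u : E -> R).
Hypothesis hpos : forall r, 0 < r -> (r%:E < S)%E -> 0 < h r.
Hypothesis dh : forall r, 0 < r -> (r%:E < S)%E -> derivable h r 1.
Hypothesis ddh : forall r, 0 < r -> (r%:E < S)%E -> derivable (derive1 h) r 1.
Hypotheses (N2 : (2 <= N)%N) (R00 : 0 < R0) (R0S : (R0%:E < S)%E) (RrS : (Rr%:E < S)%E).
Variable Om : set E.
Hypotheses (oO : open Om) (cO : connected Om) (inO : cballO R0 `<=` Om)
  (outO : Om `<=` ballO Rr).

Let D : set E := Om `\` cballO R0.
Let K : set E := closure Om `\` ballO R0.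

Lemma annular_domainE x : D x <-> Om x /\ R0 < enorm x.
Proof. by rewrite /D /cballO /=; split=> -[Ox] => [/negP|]; rewrite ?ltNge => // /negP. Qed.

Lemma closed_domainE x : K x <-> closure Om x /\ R0 <= enorm x.
Proof. by rewrite /K /ballO /=; split=> -[Ox] => [/negP|]; rewrite ?leNgt => // /negP. Qed.

Lemma closure_le x : closure Om x -> enorm x <= Rr.
Proof.
move=> /closure_enormP cx; rewrite leNgt; apply/negP => xr.
have [|y /outO yr yx] := cx (enorm x - Rr); first by rewrite subr_gt0.
move: yr; rewrite /ballO /= => yr.
by have := enorm_distr y x; rewrite ler_norml => /andP[]; lra.
Qed.

Lemma in_Mset r : r <= Rr -> (r%:E < S)%E.
Proof. by move=> rR; apply: le_lt_trans RrS; rewrite lee_fin. Qed.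

Lemma open_annular_domain : open D.
Proof.
have -> : D = Om `&` [set x | R0 < enorm x < Rr + 1].
  apply/seteqP; split=> x /=.
    move=> /annular_domainE[Ox ->]; split=> //=; have := outO Ox; rewrite /ballO /=; lra.
  by move=> [Ox /andP[xR _]]; apply/annular_domainE.
apply: openI => //; have := @open_shell R N 0 R0 (Rr + 1).
by under eq_fun do rewrite subr0.
Qed.

Lemma domain_sub : D `<=` K.
Proof.
move=> x /annular_domainE[Ox xR]; apply/closed_domainE.
by split; [exact: subset_closure|exact: ltW].
Qed.

Lemma compact_domain : compact K.
Proof.
apply: (@bounded_enorm_closed_compact _ _ _ Rr) => [x /closed_domainE[/closure_le]//|].
apply/closed_enormP => x Hx; apply/closed_domainE; split.
  apply/closure_enormP => e e0; have e2 : 0 < e / 2 by rewrite divr_gt0.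
  have [y /closed_domainE[/closure_enormP cy _] yx] := Hx _ e2.
  have [z Oz zy] := cy _ e2; exists z => //.
  have -> : z - x = (z - y) + (y - x) by rewrite addrA subrK.
  by apply: le_lt_trans (enormD _ _) _; lra.
rewrite leNgt; apply/negP => xR.
have [|y /closed_domainE[_ yR] yx] := Hx (R0 - enorm x); first by rewrite subr_gt0.
by have := enorm_distr y x; rewrite ler_norml => /andP[]; lra.
Qed.

Lemma bdry_norm p : bdry Om p -> [/\ closure Om p, ~ Om p, R0 < enorm p & enorm p <= Rr].
Proof.
move=> /(bdry_open oO)[cp np]; split=> //; last exact: closure_le.
by rewrite ltNge; apply/negP => pR; apply: np; exact: inO.
Qed.

Lemma bdry_domain p : bdry Om p -> K p.
Proof. by move=> /bdry_norm[cp _ pR _]; apply/closed_domainE; split=> //; exact: ltW. Qed.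

Lemma domain_cases x : K x -> [\/ D x, enorm x = R0 | bdry Om x].
Proof.
move=> /closed_domainE[cx xR]; have [Ox|nO] := pselect (Om x); last first.
  by apply: Or33; exact: open_bdry.
move: xR; rewrite le_eqVlt => /predU1P[->|xR]; first exact: Or32.
by apply: Or31; apply/annular_domainE.
Qed.

Lemma domain_pos x : K x -> [/\ x != 0, Mset S x, 0 < enorm x & 0 < h (enorm x)].
Proof.
move=> /closed_domainE[cx xR]; have x0 : 0 < enorm x by exact: lt_le_trans xR.
have xS : Mset S x by exact/in_Mset/closure_le.
by split=> //; [rewrite -enorm_gt0|exact: hpos].
Qed.

Lemma exists_outer_radius : exists p2, bdry Om p2 /\ Om `<=` ballO (enorm p2).
Proof.
have cc : compact (closure Om).
  by apply: (@bounded_enorm_closed_compact _ _ _ Rr); [exact: closure_le|exact: closed_closure].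
have Om0 : Om 0 by apply: inO; rewrite /cballO /= enorm0 ltW.
have [||p /set_mem cp pmax] := @EVT_max_rV _ _ (@enorm R N) (closure Om) _ cc.
- by exists 0; exact: subset_closure.
- exact: enorm_continuous.
(* A point of the open set [Om] can be pushed outwards within it, so it does not attain the maximum
   over the closure. The pole has no outward direction and is compared with a nonzero point of the
   inner ball. *)
have lt_max x : Om x -> enorm x < enorm p.
  move=> Ox; have [e e0 eO] := (open_enormP Om).1 oO x Ox.
  have [x0|x0] := eqVneq x 0.
    have Rp : exists2 y : E, Om y & 0 < enorm y.
      have [z z0 _] := orthogonal_vector (0 : E) N2.
      exists ((R0 / enorm z) *: z); last by rewrite enorm_gt0 scaler_eq0 negb_or z0 andbT
        mulf_neq0 ?invr_neq0 ?enorm_eq0// gt_eqF.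
      apply: inO; rewrite /cballO /= enormZ ger0_norm ?divfK ?enorm_eq0//.
      by rewrite divr_ge0 ?enorm_ge0// ltW.
    have [y Oy y0] := Rp; rewrite x0 enorm0; apply: lt_le_trans y0 _.
    by apply: pmax; apply/mem_set/subset_closure.
  have ex : 0 < enorm x by rewrite enorm_gt0.
  have e1 : 0 < e / (2 * enorm x) by rewrite divr_gt0// mulr_gt0.
  have : Om ((1 + e / (2 * enorm x)) *: x).
    apply: eO; rewrite scalerDl scale1r addrAC subrr add0r enormZ gtr0_norm//.
    by rewrite [_ * _](_ : _ = e / 2); [lra|field; rewrite gt_eqF].
  move=> /subset_closure/mem_set/pmax; apply: lt_le_trans.
  rewrite enormZ gtr0_norm; last by lra.
  by rewrite mulrDl mul1r ltrDl mulr_gt0.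
by exists p; split=> //; apply: open_bdry => // /lt_max; rewrite ltxx.
Qed.

(** A boundary point of least norm exists, [p2] witnessing that there is one. The segment from the
    pole to a point of smaller norm never meets the boundary, so it stays in [Om]. *)
Lemma exists_inner_radius p2 : bdry Om p2 -> exists p1, [/\ bdry Om p1,
  forall p, bdry Om p -> enorm p1 <= enorm p & ballO (enorm p1) `<=` Om].
Proof.
move=> b2; have cb : compact (bdry Om).
  apply: (@bounded_enorm_closed_compact _ _ _ Rr) => [x /bdry_norm[]//|].
  rewrite /bdry setDE; apply: closedI; first exact: closed_closure.
  exact/open_closedC/open_interior.
have [||p /set_mem bp pmin] := @EVT_min_rV _ _ (@enorm R N) (bdry Om) _ cb.
- by exists p2.
- exact: enorm_continuous.
exists p; split=> // [q bq|x xp]; first by apply: pmin; exact: mem_set.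
have Om0 : Om 0 by apply: inO; rewrite /cballO /= enorm0 ltW.
have := @connected_locally_constant _ _ (fun t : R => Om (t *: x))
  (@segment_connected R 0 1) _ _ 0 1.
rewrite scale0r scale1r; apply => //=; rewrite ?in_itv /= ?lexx ?ler01//.
- move=> t _ Ot; have ct : (fun t => t *: x) @ t --> t *: x.
    by apply: cvgZ; [exact: cvg_id|exact: cvg_cst].
  have : \forall s \near t, Om (s *: x) by apply: ct; exact: open_nbhs_nbhs.
  by apply: filterS.
- move=> t; rewrite /= in_itv /= => /andP[t0 t1] nO.
  have tx : enorm (t *: x) < enorm p.
    by apply: le_lt_trans xp; rewrite enormZ ger0_norm// ler_piMl// enorm_ge0.
  have ncl : ~ closure Om (t *: x).
    move=> cl; have := pmin (t *: x); rewrite leNgt tx => H.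
    by have : false by apply: H; exact/mem_set/open_bdry.
  have ct : (fun t => t *: x) @ t --> t *: x.
    by apply: cvgZ; [exact: cvg_id|exact: cvg_cst].
  have : \forall s \near t, (~` closure Om) (s *: x).
    by apply: ct; apply: open_nbhs_nbhs; split=> //; exact/closed_openC/closed_closure.
  by apply: filterS => s ns _ Os; apply: ns; exact: subset_closure.
Qed.

Lemma ball_of_equal_radii p1 p2 : ballO (enorm p1) `<=` Om ->
  Om `<=` ballO (enorm p2) -> enorm p1 = enorm p2 -> Om = ballO (enorm p1).
Proof. by move=> h1 h2 p12; apply/seteqP; split; [rewrite p12|]. Qed.

Lemma geodesic_ball_of_ball r : Om = ballO r -> 0 < r ->
  exists q rho, Mset S q /\ 0 < rho /\ Om = gball S h q rho.
Proof.
move=> OE r0; exists 0, r; split; first by rewrite /Mset /= enorm0; apply: lt_trans R0S; rewrite lte_fin.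
split=> //; rewrite OE gball_pole// => x xr; apply/in_Mset/ltW.
by have := outO; rewrite OE => /(_ x); apply.
Qed.

(* Adding a small multiple of [psi] makes the equation strict. *)
Lemma comparison_principle (psi : R -> R) (w : E -> R) :
  (forall x, K x -> differentiable (fun y => psi (enorm y)) x) ->
  (forall x, D x -> D2 (fun y => psi (enorm y)) x /\ LBform h (fun y => psi (enorm y)) x = 1) ->
  {within K, continuous w} -> (forall x, D x -> D2 w x /\ LBform h w x = 0) ->
  (forall x, K x -> ~ D x -> 0 <= w x) -> forall x, K x -> 0 <= w x.
Proof.
move=> dpsi Lpsi cw Lw bw x Kx.
have cpsi : {within K, continuous (fun y => psi (enorm y))}.
  by apply: within_differentiable => y; exact: dpsi.
have [||y0 /set_mem Ky0 y0max] := @EVT_max_rV _ _ (fun y => `|psi (enorm y)|) K _ compact_domain.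
- by exists x.
- move=> y; apply: continuous_comp; [exact: cpsi|exact: norm_continuous].
pose C := `|psi (enorm y0)|; have C0 : 0 <= C by exact: normr_ge0.
have CP y : K y -> `|psi (enorm y)| <= C by move=> Ky; apply: y0max; exact: mem_set.
have key e : 0 < e -> - (e * C) <= w x + (- e) * psi (enorm x).
  move=> e0; apply: (@weak_min_principle _ _ h K D (fun y => w y + (- e) * psi (enorm y))) => //.
  - exact: compact_domain.
  - apply: within_continuousD => //; apply: within_differentiable => y Ky.
    by apply: differentiableZ; exact: dpsi.
  - exact: open_annular_domain.
  - exact: domain_sub.
  - move=> y Dy; have [y0' _ _ _] := domain_pos (domain_sub Dy).
    have [d1 L1] := Lw y Dy; have [d2 L2] := Lpsi y Dy.
    split=> //; first exact: D2_lin.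
    by rewrite /LBform ellop_lin// -/(LBform h w y) -/(LBform h _ y) L1 L2 add0r mulr1 oppr_lt0.
  - move=> y Ky nDy; have := bw y Ky nDy; have := CP y Ky; rewrite ler_norml => /andP[c1 c2].
    by have := ler_wpM2l (ltW e0) c2; lra.
rewrite leNgt; apply/negP => wx.
(* Chosen so that the total loss [2 e C] is less than [- w x]. *)
pose e := - w x / (2 * C + 1) / 2.
have e0 : 0 < e by rewrite !divr_gt0//; lra.
have eE : 2 * e * (2 * C + 1) = - w x by rewrite /e; field; lra.
have := key e e0; have := CP x Kx; rewrite ler_norml => /andP[c1 c2].
have := ler_wpM2l (ltW e0) c1; lra.
Qed.

(** The last hypothesis is a vanishing normal derivative at [p], expressed by values. It contradicts
    Hopf's linear growth unless [w] vanishes somewhere in [D], and then the strong principle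
    applies. The bound on [4 s] keeps the tangent ball off the inner ball. *)
Lemma hopf_rigidity p s w : bdry Om p -> 0 < s -> 4 * s <= enorm p - R0 ->
  (forall x, enorm (x - (1 - s / enorm p) *: p) < s -> Om x) ->
  {within K, continuous w} -> (forall x, D x -> D2 w x /\ LBform h w x = 0) ->
  (forall x, K x -> 0 <= w x) -> w p = 0 ->
  (forall e, 0 < e -> exists2 d, 0 < d & forall t, 0 < t < d ->
     `|w p - w (p - t *: ((enorm p)^-1 *: p))| <= e * t) ->
  forall x, D x -> w x = 0.
Proof.
move=> bp s0 s4 ballO' cw Lw w0 wp flat.
have [p2 [b2 _]] := exists_outer_radius.
have [p1 [b1 _ in1]] := exists_inner_radius b2.
have [_ _ R0p1 _] := bdry_norm b1.
have [_ _ R0p pRr] := bdry_norm bp.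
have ep : 0 < enorm p by exact: lt_trans R0p.
suff [z Dz wz] : exists2 z, D z & w z = 0.
  move=> x /annular_domainE[Ox xR]; have /annular_domainE[Oz zR] := Dz.
  apply: (@strong_min_principle _ _ S h hpos dh ddh Om R0 (enorm p1) w N2 oO cO R00 R0p1 in1 _ z) => //.
  move=> y Oy yR; have Dy : D y by exact/annular_domainE.
  have [_ yS _ _] := domain_pos (domain_sub Dy); have [d2 L] := Lw y Dy.
  by split=> //; apply: w0; exact: domain_sub.
apply: contrapT => nz.
have wpos x : D x -> 0 < w x.
  move=> Dx; rewrite lt_neqAle w0 ?andbT; last exact: domain_sub.
  by rewrite eq_sym; apply/eqP => wx; apply: nz; exists x.
set c := (1 - s / enorm p) *: p in ballO'.
have spp : s <= enorm p by move: (enorm p) s0 s4 ep R00 => ? ? ? ?; lra.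
have sp : s / enorm p <= 1 by rewrite ler_pdivrMr// mul1r.
have ec : enorm c = enorm p - s.
  by rewrite enormZ ger0_norm ?subr_ge0// mulrBl mul1r divfK// gt_eqF.
have cp : c - p = - ((s / enorm p) *: p) by rewrite /c scalerBl scale1r addrAC subrr add0r.
have pc : enorm (p - c) = s.
  by rewrite enormB cp enormN enormZ gtr0_norm ?divr_gt0// divfK// gt_eqF.
have shell x : enorm (x - c) <= s -> R0 < enorm x <= enorm p.
  move=> xs; have := enorm_distr x c; rewrite ler_norml ec => /andP[h1 h2].
  by apply/andP; split; lra.
have ballD x : enorm (x - c) < s -> D x.
  move=> xs; apply/annular_domainE; split; first exact: ballO'.
  by have /andP[] := shell x (ltW xs).
have ballK x : enorm (x - c) <= s -> K x.
  move=> xs; apply/closed_domainE; have /andP[h1 _] := shell x xs.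
  split; last exact: ltW.
  apply/closure_enormP => e e0.
  have [t [t0 t1]] := pos_below2 ltr01 (divr_gt0 e0 s0); rewrite ltr_pdivlMr// => ts.
  exists (c + (1 - t) *: (x - c)).
    apply: ballO'; rewrite addrAC subrr add0r enormZ ger0_norm ?subr_ge0 ?(ltW t1)//.
    by have := enorm_ge0 (x - c); nra.
  have -> : c + (1 - t) *: (x - c) - x = - (t *: (x - c)).
    rewrite scalerBl scale1r addrA subrKC addrAC subrr add0r//.
  rewrite enormN enormZ gtr0_norm//; have := ler_wpM2l (ltW t0) xs; lra.
have [||||eta eta0 etaP] := @hopf _ _ S h hpos dh ddh c s R0 (enorm p) w p R00 (in_Mset pRr) s0 pc.
- by move=> x /shell/andP[x1 x2]; rewrite ltW.
- by apply: continuous_subspaceW cw => x /=; exact: ballK.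
- by move=> x /ballD Dx; have [d2 L] := Lw x Dx; split=> //; exact: wpos.
- by move=> x xs; apply/w0/ballK; rewrite xs.
have es : 0 < eta / (2 * s) by rewrite divr_gt0// mulr_gt0.
have [d d0 dP] := flat _ es.
have h12 : 0 < 1 / 2 :> R by rewrite divr_gt0.
have [t [t0 t1]] := pos_below2 h12 (divr_gt0 d0 s0); rewrite ltr_pdivlMr// => ts.
have pE : p + t *: (c - p) = p - (t * s) *: ((enorm p)^-1 *: p).
  by rewrite cp scalerN !scalerA -mulrA.
have tI : 0 <= t <= 1 / 2 by rewrite !ltW.
have := etaP t tI; rewrite pE.
have tsI : 0 < t * s < d by rewrite mulr_gt0.
have := dP (t * s) tsI; rewrite wp sub0r normrN => /(le_trans (ler_norm _)).
have -> : eta / (2 * s) * (t * s) = eta * t / 2 by field; rewrite gt_eqF.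
have := mulr_gt0 eta0 t0; lra.
Qed.

Lemma zero_on_closure w : {within K, continuous w} -> (forall x, D x -> w x = 0) ->
  (forall x, enorm x = R0 -> w x = 0) -> forall x, K x -> w x = 0.
Proof.
move=> cw wD wR x Kx; have [/wD//|/wR//|bx] := domain_cases Kx.
have [cx _ xR _] := bdry_norm bx.
apply/eqP/negPn/negP => wx; have wx0 : 0 < `|w x| by rewrite normr_gt0.
have [d d0 dP] := (continuous_enormP K w).1 cw x Kx _ wx0.
have dm : 0 < Num.min d (enorm x - R0) by rewrite lt_min d0 subr_gt0.
have [y Oy] := (closure_enormP Om x).1 cx _ dm; rewrite lt_min => /andP[yd yR].
have Dy : D y.
  apply/annular_domainE; split=> //.
  by have := enorm_distr y x; rewrite ler_norml => /andP[]; lra.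
by have := dP y (domain_sub Dy) yd; rewrite (wD y Dy) sub0r normrN ltxx.
Qed.

End Domain.

Lemma is_derive_left_expansion (R : realType) (v : R -> R) (r dv : R) : is_derive r 1 v dv ->
  forall e, 0 < e -> exists2 d, 0 < d & forall t, 0 < t < d ->
    `|v r - v (r - t) - t * dv| <= e * t.
Proof.
move=> /is_derive1_caratheodory[g [gE cg gr]] e e0.
have /cvgrPdist_lt /(_ e e0) : g @ r --> g r by exact: cg.
move=> /nbhs_ballP[d /= d0 dP]; exists d => // t /andP[t0 td].
have -> : v r - v (r - t) - t * dv = t * (g (r - t) - g r).
  by have := gE (r - t); rewrite -gr; lra.
rewrite normrM gtr0_norm// mulrC ler_pM2r// distrC; apply/ltW/dP.
by rewrite /ball /= opprB addrC subrK gtr0_norm.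
Qed.

Lemma wfun_ext (R : realType) (N : nat) (h f g : R -> R) (R0 r c : R) :
  (forall t, R0 <= t -> f t = g t) -> wfun N h f R0 r c = wfun N h g R0 r c.
Proof.
move=> fg; rewrite /wfun; congr (_ * (_ - _)).
apply: eq_Rintegral => s; rewrite inE /= in_itv /= => /andP[R0s _].
apply: eq_Rintegral => t; rewrite inE /= in_itv /= => /andP[st _].
by rewrite fg// (le_trans R0s).
Qed.

(** * The solution near boundary points *)

Section Neumann.
Variables (R : realType) (N : nat) (R0 Rr : R).
Local Notation E := 'rV[R]_N.
Implicit Types (x y z v p q c n : E) (a b t r s k e : R) (w u : E -> R).
Variables (Om : set E) (u : E -> R) (Du : 'I_N -> E -> R).
Hypotheses (R00 : 0 < R0) (oO : open Om) (inO : cballO R0 `<=` Om)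
  (outO : Om `<=` ballO Rr).
Hypothesis du : forall x, (Om `\` cballO R0) x -> differentiable u x.
Hypothesis cu : {within closure Om `\` ballO R0, continuous u}.
Hypothesis cDu : forall i, {within closure Om `\` cballO R0, continuous (Du i)}.
Hypothesis DuE : forall i x, (Om `\` cballO R0) x -> Du i x = partial i u x.

Lemma outer_ray p V rho l : bdry Om p -> local_defining Om p V rho -> 0 < l ->
  grad rho p = l *: p -> exists2 d, 0 < d & forall t, 0 < t < d ->
    (Om `\` cballO R0) (p - t *: ((enorm p)^-1 *: p)).
Proof.
move=> bp LD l0 gE; have [cp _ R0p _] := bdry_norm oO inO outO bp.
have ep : 0 < enorm p by exact: lt_trans R0p.
set n := (enorm p)^-1 *: p.
have en : enorm n = 1 by rewrite enormZ gtr0_norm ?invr_gt0// mulVf// gt_eqF.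
have rp0 := local_defining_bdry0 oO LD bp; have [_ Vp _ _ _] := LD.
have gn : 0 < dot (grad rho p) n.
  by rewrite gE dotZl dotZr -enorm_sqr !mulr_gt0// ?invr_gt0// exprn_gt0.
have [m m0 mP] := defining_crossing LD Vp rp0 gn.
exists (Num.min m (enorm p - R0)); first by rewrite lt_min m0 subr_gt0.
move=> t /andP[t0]; rewrite lt_min => /andP[tm tR].
apply/annular_domainE; split; first by have [|] := mP t; rewrite ?t0.
have := enorm_distr (p - t *: n) p; rewrite addrAC subrr add0r enormN enormZ en mulr1.
by rewrite (gtr0_norm t0) ler_norml => /andP[]; lra.
Qed.

(** The mean value theorem on the inward segment moves the quotient to an interior gradient, and
    continuity of [Du] up to the boundary carries it back to [p]. The radial normal guarantees that
    the segment lies in the domain. *)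
Lemma normal_expansion p V rho l : bdry Om p -> local_defining Om p V rho -> 0 < l ->
  grad rho p = l *: p -> forall e, 0 < e -> exists2 d, 0 < d & forall t, 0 < t < d ->
    `|u p - u (p - t *: ((enorm p)^-1 *: p)) -
      t * \sum_i Du i p * ((enorm p)^-1 *: p) 0 i| <= e * t.
Proof.
move=> bp LD l0 gE e e0; have [cp np R0p _] := bdry_norm oO inO outO bp.
have ep : 0 < enorm p by exact: lt_trans R0p.
have [d1 d10 d1D] := outer_ray bp LD l0 gE.
set n := (enorm p)^-1 *: p in d1D *.
have en : enorm n = 1 by rewrite enormZ gtr0_norm ?invr_gt0// mulVf// gt_eqF.
pose G x := dot (\row_i Du i x) n.
have Gp : \sum_i Du i p * n 0 i = G p by apply: eq_bigr => i _; rewrite mxE.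
have cG : {within closure Om `\` cballO R0, continuous G}.
  move=> y; apply: cvg_dot => i; last exact: cvg_cst.
  by under eq_fun do rewrite mxE; rewrite mxE; exact: cDu.
have Kp : (closure Om `\` cballO R0) p.
  by split=> //; rewrite /cballO /= => /(lt_le_trans R0p); rewrite ltxx.
have [d2 d20 d2P] := (continuous_enormP _ _).1 cG p Kp e e0.
exists (Num.min d1 d2); first by rewrite lt_min d10.
move=> t /andP[t0]; rewrite lt_min => /andP[td1 td2].
pose g s := u (p - s *: n).
have Dn s : is_derive s 1 (fun s => p - s *: n) (- n).
  have := is_derive_line p (- n) s.
  by under eq_fun do rewrite scalerN.
have sub_dist s s' : enorm (p - s' *: n - (p - s *: n)) = `|s - s'|.
  by rewrite opprB addrC addrA subrK -scalerBl enormZ en mulr1.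
have D s : 0 < s <= t -> (Om `\` cballO R0) (p - s *: n).
  by move=> /andP[s0 st]; apply: d1D; rewrite s0 (le_lt_trans st).
have Kin s : 0 <= s <= t -> (closure Om `\` ballO R0) (p - s *: n).
  move=> /andP[]; rewrite le_eqVlt => /predU1P[<- _|s0 st].
    by rewrite scale0r subr0; apply/closed_domainE; split=> //; exact: ltW.
  by apply: domain_sub; apply: D; rewrite s0.
have Dg s : s \in `]0, t[ -> is_derive s 1 g (- G (p - s *: n)).
  rewrite in_itv /= => /andP[s0 st]; have Ds := D s; rewrite s0 ltW// in Ds.
  have {}Ds := Ds isT.
  have Dg0 : is_derive s 1 g ('D_(- n) u (p - s *: n)) := is_derive_curve (du Ds) (Dn s).
  apply: is_derive_eq Dg0 _.
  rewrite grad_dot; last exact: du.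
  rewrite dotNr; congr (- _); apply: eq_bigr => i _; congr (_ * _).
  by rewrite !mxE DuE.
have cg : {within `[0, t], continuous g}.
  apply/subspace_continuousP => s; rewrite /= in_itv /= => sI.
  apply/cvgrPdist_lt => a a0; rewrite near_withinE.
  have [d d0 dP] := (continuous_enormP _ _).1 cu _ (Kin s sI) a a0.
  apply/nbhs_ballP; exists d => // s' ss'; rewrite /= in_itv /= => s'I.
  by rewrite distrC; apply: dP; [exact: Kin|rewrite sub_dist].
have [c] := MVT t0 Dg cg; rewrite in_itv /= subr0 => /andP[c0 ct] gE'.
have -> : u p - u (p - t *: n) = t * G (p - c *: n).
  by move: gE'; rewrite /g scale0r subr0; lra.
rewrite Gp -mulrBr normrM gtr0_norm// mulrC ler_pM2r//.
apply/ltW/d2P.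
  have [Oc nc] : (Om `\` cballO R0) (p - c *: n) by apply: D; rewrite c0 ltW.
  by split=> //; exact: subset_closure.
have := sub_dist 0 c; rewrite scale0r subr0 => ->.
by rewrite sub0r normrN gtr0_norm//; exact: lt_trans td2.
Qed.

(** [Du] is determined at [p] by its limit from inside, where it is the gradient of a radial
    function. *)
Lemma boundary_gradient_radial (v dv : R -> R) p : bdry Om p ->
  (forall r, R0 < r <= Rr -> is_derive r 1 v (dv r)) ->
  (forall r, R0 < r <= Rr -> {for r, continuous dv}) ->
  (forall x, (Om `\` cballO R0) x -> u x = v (enorm x)) ->
  forall i, Du i p = dv (enorm p) * (p 0 i / enorm p).
Proof.
move=> bp Dv cdv uv i; have [cp np R0p pR] := bdry_norm oO inO outO bp.
have Kp : (closure Om `\` cballO R0) p.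
  by split=> //; rewrite /cballO /= => /(lt_le_trans R0p); rewrite ltxx.
have DE x : (Om `\` cballO R0) x -> Du i x = dv (enorm x) * (x 0 i / enorm x).
  move=> Dx; have /annular_domainE[Ox xR] := Dx.
  have x0 : x != 0 by rewrite -enorm_gt0; exact: lt_trans xR.
  have xI : R0 < enorm x <= Rr by rewrite xR; have := outO Ox; rewrite /ballO /= => /ltW.
  have Dvx := Dv _ xI.
  rewrite DuE// (@near_eq_partial _ _ i u (fun y => v (enorm y))); last first.
    have : \forall y \near x, (Om `\` cballO R0) y.
      by apply: open_nbhs_nbhs; split=> //; exact: (open_annular_domain oO outO).
    by apply: filterS => y /uv.
  rewrite partial_radial//.
  by rewrite derive1E (@derive_val _ _ _ _ _ _ _ Dvx).
pose q x := dv (enorm x) * (x 0 i / enorm x).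
have p0 : p != 0 by rewrite -enorm_gt0; exact: lt_trans R0p.
have cq : {for p, continuous q}.
  have ce : {for p, continuous (@enorm R N)}.
    by apply/differentiable_continuous/differentiable_enorm.
  have cd : {for enorm p, continuous dv} by apply: cdv; rewrite R0p.
  apply: continuousM; first exact: (continuous_comp ce cd).
  apply: continuousM; first exact: coord_continuous.
  by apply: continuousV => //; rewrite enorm_eq0.
have {}cq : q @ p --> q p by exact: cq.
apply/eqP; rewrite -subr_eq0; apply/negPn/negP => ne.
have ne0 : 0 < `|Du i p - q p| / 2 by rewrite divr_gt0// normr_gt0.
have [d1 d10 d1P] := (continuous_enormP _ _).1 (@cDu i) p Kp _ ne0.
have /cvgrPdist_lt /(_ _ ne0) /nbhs_enormP[d2 d20 d2P] := cq.
have dm : 0 < Num.min d1 (Num.min d2 (enorm p - R0)) by rewrite !lt_min d10 d20 subr_gt0.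
have [y Oy] := (closure_enormP Om p).1 cp _ dm; rewrite !lt_min => /andP[yd1 /andP[yd2 yR]].
have Dy : (Om `\` cballO R0) y.
  apply/annular_domainE; split=> //.
  by have := enorm_distr y p; rewrite ler_norml => /andP[]; lra.
have Ky : (closure Om `\` cballO R0) y by case: Dy => Oy' nb; split=> //; exact: subset_closure.
have h1 := d1P y Ky yd1; have h2 := d2P y yd2.
rewrite (DE y Dy) -/(q y) in h1.
have := ler_normD (Du i p - q y) (q y - q p).
rewrite addrA subrK; rewrite distrC in h1; rewrite distrC in h2; lra.
Qed.

End Neumann.

Lemma mean_value (R : realType) (g dg : R -> R) (a b : R) : a < b ->
  (forall r, a <= r <= b -> is_derive r 1 g (dg r)) ->
  exists2 c, a < c < b & g b - g a = dg c * (b - a).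
Proof.
move=> ab Dg; have [||c] := @MVT R g dg a b ab; last by rewrite in_itv; exists c.
- by move=> r; rewrite in_itv /= => /andP[ar rb]; apply: Dg; rewrite !ltW.
- by apply: continuous_within_segment => r /Dg/is_derive_continuous.
Qed.

(** * The one-parameter family of radial solutions *)

Section Profiles.
Variables (R : realType) (N : nat) (S : \bar R) (h f phi kappa : R -> R) (R0 b : R).
Implicit Types (r s t k : R).
Hypothesis hpos : forall r, 0 < r -> (r%:E < S)%E -> 0 < h r.
Hypothesis dh : forall r, 0 < r -> (r%:E < S)%E -> derivable h r 1.
Hypothesis cf : forall r, 0 < r -> (r%:E < S)%E -> {for r, continuous f}.
Variables (H F Phi : R -> R).
Hypotheses (b0 : 0 < b) (bR0 : b < R0) (H0 : H R0 = 0) (F0 : F R0 = 0) (Phi0 : Phi R0 = 0).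
Hypothesis DH : forall r, b < r -> (r%:E < S)%E -> is_derive r 1 H (h r ^+ N.-1)^-1.
Hypothesis DF : forall r, b < r -> (r%:E < S)%E -> is_derive r 1 F (Phi r / h r ^+ N.-1) /\
  is_derive r 1 Phi (h r ^+ N.-1 * f r).

(* [radial_profile k] is the radial solution vanishing at [R0] with flux constant [k];
   [radial_level r] selects the one taking the value [phi r] at [r]. *)
Definition radial_profile k r := k * H r - F r.
Definition radial_slope k r := (k - Phi r) / h r ^+ N.-1.
Definition radial_level r := (phi r + F r) / H r.

Lemma warp_gt0 r : b < r -> (r%:E < S)%E -> 0 < h r ^+ N.-1.
Proof. by move=> br rS; rewrite exprn_gt0// hpos// (lt_trans b0). Qed.

Lemma lt_base r : R0 <= r -> b < r. Proof. exact: lt_le_trans. Qed.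

Lemma primitive_gt0 r : R0 < r -> (r%:E < S)%E -> 0 < H r.
Proof.
move=> R0r rS; have inS t : R0 <= t <= r -> (t%:E < S)%E.
  by move=> /andP[_ tr]; apply: le_lt_trans rS; rewrite lee_fin.
have [t tI|c /andP[R0c cr] HE] := mean_value R0r (dg := fun t => (h t ^+ N.-1)^-1) (g := H).
  by apply: DH; [apply: lt_base; case/andP: tI|exact: inS].
rewrite H0 subr0 in HE; rewrite HE mulr_gt0 ?subr_gt0// invr_gt0 warp_gt0//.
  by apply: lt_base; exact: ltW.
by apply: inS; rewrite !ltW.
Qed.

Lemma is_derive_profile k r : b < r -> (r%:E < S)%E -> is_derive r 1 (radial_profile k) (radial_slope k r).
Proof.
move=> br rS; have [D1 _] := DF br rS.
apply: is_derive_eq (is_derive_subf (is_derive_scalef (DH br rS) k) D1) _.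
by rewrite /radial_slope mulrBl.
Qed.

Lemma continuous_slope k r : b < r -> (r%:E < S)%E -> {for r, continuous (radial_slope k)}.
Proof.
move=> br rS; have r0 := lt_trans b0 br; have [_ D2] := DF br rS.
apply: continuousM.
  exact: is_derive_continuous (is_derive_subf (is_derive_cst k r 1) D2).
apply: continuousV; first by rewrite gt_eqF// warp_gt0.
have Dh : is_derive r 1 h (derive1 h r) by exact/derivable_derive1/dh.
exact: is_derive_continuous (is_derive_expf Dh _).
Qed.

Lemma wfun_slope r : R0 < r -> (r%:E < S)%E -> wfun N h f R0 r (phi r) = radial_slope (radial_level r) r.
Proof.
move=> R0r rS; have br := lt_base (ltW R0r).
have cf' t : R0 <= t -> (t%:E < S)%E -> {for t, continuous f}.
  by move=> /lt_base bt; apply: cf; exact: lt_trans bt.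
rewrite (wfun_eq b0 bR0 hpos dh cf' H0 F0 Phi0 DH DF)//; last exact: ltW.
by rewrite /radial_slope /radial_level; field; rewrite !gt_eqF ?primitive_gt0 ?warp_gt0.
Qed.

Hypothesis dphi : forall r, R0 < r -> (r%:E < S)%E -> derivable phi r 1.

(** Differentiating [k H - F = phi] with [k] depending on [r] gives [k' H = phi'] minus the slope at
    fixed [k]; this turns the sign condition into monotonicity. *)
Lemma is_derive_level r : R0 < r -> (r%:E < S)%E ->
  is_derive r 1 radial_level ((derive1 phi r - radial_slope (radial_level r) r) / H r).
Proof.
move=> R0r rS; have br := lt_base (ltW R0r); have [D1 _] := DF br rS.
have Dp : is_derive r 1 phi (derive1 phi r) by exact/derivable_derive1/dphi.
have Hr : 0 < H r by exact: primitive_gt0.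
have hr := warp_gt0 br rS.
apply: is_derive_eq (is_derive_mulf (is_derive_addf Dp D1) (is_derive_invf (DH br rS) _)) _.
  by rewrite gt_eqF.
by rewrite /radial_slope /radial_level; field; rewrite !gt_eqF.
Qed.

Lemma level_increment r s : R0 < r -> r < s -> (s%:E < S)%E ->
  exists c, [/\ R0 < c, (c%:E < S)%E & radial_level s - radial_level r =
    (derive1 phi c - wfun N h f R0 c (phi c)) / H c * (s - r)].
Proof.
move=> R0r rs sS; have inS t : r <= t <= s -> R0 < t /\ (t%:E < S)%E.
  move=> /andP[rt ts]; split; first exact: lt_le_trans rt.
  by apply: le_lt_trans sS; rewrite lee_fin.
have [t tI|c /andP[rc cs] E] := mean_value rs (g := radial_level)
    (dg := fun t => (derive1 phi t - radial_slope (radial_level t) t) / H t).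
  by have [t1 t2] := inS t tI; exact: is_derive_level.
have [|c1 c2] := inS c; first by rewrite !ltW.
by exists c; rewrite wfun_slope.
Qed.

Lemma level_nondecreasing r s :
  (forall t, R0 < t -> (t%:E < S)%E -> 0 <= derive1 phi t - wfun N h f R0 t (phi t)) ->
  R0 < r -> r <= s -> (s%:E < S)%E -> radial_level r <= radial_level s.
Proof.
move=> ge0 R0r; rewrite le_eqVlt => /predU1P[->//|rs] sS.
have [c [c1 c2 E]] := level_increment R0r rs sS; rewrite -subr_ge0 E.
by rewrite mulr_ge0 ?subr_ge0 ?(ltW rs)// divr_ge0 ?ge0// ltW// primitive_gt0.
Qed.

Lemma level_increasing r s :
  (forall t, R0 < t -> (t%:E < S)%E -> 0 < derive1 phi t - wfun N h f R0 t (phi t)) ->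
  R0 < r -> r < s -> (s%:E < S)%E -> radial_level r < radial_level s.
Proof.
move=> gt0 R0r rs sS; have [c [c1 c2 E]] := level_increment R0r rs sS; rewrite -subr_gt0 E.
by rewrite mulr_gt0 ?subr_gt0// divr_gt0 ?gt0// primitive_gt0.
Qed.

Lemma continuous_slope_level r : R0 < r -> (r%:E < S)%E ->
  {for r, continuous (fun t => radial_slope (radial_level t) t)}.
Proof.
move=> R0r rS; have br := lt_base (ltW R0r); have [_ D2] := DF br rS.
have r0 := lt_trans b0 br; apply: continuousM.
  exact: is_derive_continuous (is_derive_subf (is_derive_level R0r rS) D2).
apply: continuousV; first by rewrite gt_eqF// warp_gt0.
have Dh : is_derive r 1 h (derive1 h r) by exact/derivable_derive1/dh.
exact: is_derive_continuous (is_derive_expf Dh _).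
Qed.

(** Zero slope makes the flux [Phi] equal to the constant [k], so its derivative [h^(N-1) f]
    vanishes. *)
Lemma source_zero k a c t : b < a -> (c%:E < S)%E -> (forall r, a < r < c -> radial_slope k r = 0) ->
  a < t < c -> f t = 0.
Proof.
move=> ba cS sl /andP[at_ tc]; have bt := lt_trans ba at_.
have inS r : a < r < c -> b < r /\ (r%:E < S)%E.
  by move=> /andP[ar rc]; split; [exact: lt_trans ar|apply: lt_trans cS; rewrite lte_fin].
have PhiE r : a < r < c -> Phi r = k.
  move=> rI; have [br rS] := inS r rI; have := sl r rI; rewrite /radial_slope.
  move=> /eqP; rewrite mulf_eq0 subr_eq0 => /orP[/eqP/esym//|].
  by rewrite invr_eq0 gt_eqF// warp_gt0.
have tI : a < t < c by rewrite at_.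
have [_ tS] := inS t tI; have [_ D2] := DF bt tS.
have Dk : is_derive t 1 Phi 0.
  have ee : \forall r \near t, (cst k : R -> R) r = Phi r.
    near=> r; rewrite PhiE//; apply/andP; split.
      by near: r; exact: lt_nbhsr.
    by near: r; exact: lt_nbhsl.
  exact: near_eq_is_derive (is_derive_cst k t 1).
have : h t ^+ N.-1 * f t = 0.
  by rewrite -(@derive_val _ _ _ _ _ _ _ D2) (@derive_val _ _ _ _ _ _ _ Dk).
by move=> /eqP; rewrite mulf_eq0 => /orP[|/eqP//]; rewrite gt_eqF// warp_gt0.
Unshelve. all: end_near. Qed.

End Profiles.

(** * Persistence of non-radial normals *)

Section Parallel.
Variables (R : realType) (N : nat).
Implicit Types (x p g : 'rV[R]_N).

(** The Gram determinant expresses that [g] is not parallel to [x] as positivity of a continuous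
    quantity, which persists at nearby points. *)
Definition gram g x : R := dot g g * dot x x - dot g x ^+ 2.

Lemma gram_parallel l x : gram (l *: x) x = 0.
Proof. rewrite /gram !dotE; ring. Qed.

Lemma gram_gt0 g p : p != 0 -> (forall l, g <> l *: p) -> 0 < gram g p.
Proof.
move=> p0 np; have pp : 0 < dot p p by rewrite dotxx_gt0.
have w0 : g - (dot g p / dot p p) *: p != 0.
  by rewrite subr_eq0; apply/eqP; exact: np.
rewrite -dotxx_gt0 in w0; have := mulr_gt0 w0 pp; congr (_ < _).
by rewrite /gram !dotE (dotC p g); field; rewrite gt_eqF.
Qed.

Lemma gram_near (V : set 'rV[R]_N) rho p : C1_on V rho -> V p -> 0 < gram (grad rho p) p ->
  exists2 e, 0 < e & forall x, V x -> enorm (x - p) < e -> 0 < gram (grad rho x) x.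
Proof.
move=> [_ cr] Vp gp.
have cg : {within V, continuous (fun x => gram (grad rho x) x)}.
  move=> x; have cx i : {within V, continuous (fun x : 'rV[R]_N => x 0 i)}.
    by apply: continuous_subspaceT => y; exact: coord_continuous.
  have cgr i : {within V, continuous (fun x => grad rho x 0 i)}.
    by under eq_fun do rewrite mxE; exact: cr.
  apply: cvgB; first by apply: cvgM; apply: cvg_dot => i; by [exact: cx|exact: cgr].
  have c2 : dot (grad rho y) y @[y --> (x : subspace V)] --> dot (grad rho x) x.
    by apply: cvg_dot => i; by [exact: cx|exact: cgr].
  by under eq_fun do rewrite expr2; rewrite expr2; exact: (cvgM c2 c2).
have [d d0 dP] := (continuous_enormP _ _).1 cg p Vp _ gp.
exists d => // x Vx /(dP x Vx); rewrite ltr_norml => /andP[+ _]; lra.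
Qed.

End Parallel.

(** * Comparison with radial solutions and rigidity *)

Section Overdetermined.
Variables (R : realType) (N : nat) (S : \bar R) (h f phi kappa : R -> R) (R0 Rr b : R).
Local Notation E := 'rV[R]_N.
Hypothesis hpos : forall r, 0 < r -> (r%:E < S)%E -> 0 < h r.
Hypothesis dh : forall r, 0 < r -> (r%:E < S)%E -> derivable h r 1.
Hypothesis ddh : forall r, 0 < r -> (r%:E < S)%E -> derivable (derive1 h) r 1.
Hypotheses (N2 : (2 <= N)%N) (R00 : 0 < R0) (R0S : (R0%:E < S)%E) (RrS : (Rr%:E < S)%E).
Hypothesis cf : forall r, 0 < r -> (r%:E < S)%E -> {for r, continuous f}.
Variables (H F Phi psi Q : R -> R).
Hypotheses (b0 : 0 < b) (bR0 : b < R0) (H0 : H R0 = 0) (F0 : F R0 = 0) (Phi0 : Phi R0 = 0).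
Hypothesis DH : forall r, b < r -> (r%:E < S)%E -> is_derive r 1 H (h r ^+ N.-1)^-1.
Hypothesis DF : forall r, b < r -> (r%:E < S)%E -> is_derive r 1 F (Phi r / h r ^+ N.-1) /\
  is_derive r 1 Phi (h r ^+ N.-1 * f r).
Hypothesis Dpsi : forall r, b < r -> (r%:E < S)%E -> is_derive r 1 psi (Q r / h r ^+ N.-1) /\
  is_derive r 1 Q (h r ^+ N.-1 * 1).
Variable Om : set E.
Hypotheses (oO : open Om) (cO : connected Om) (inO : cballO R0 `<=` Om)
  (outO : Om `<=` ballO Rr).
Hypothesis bO : forall p, bdry Om p -> exists V rho, local_defining Om p V rho.

Let D : set E := Om `\` cballO R0.
Let K : set E := closure Om `\` ballO R0.

Variables (u : E -> R) (Du : 'I_N -> E -> R).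
Hypothesis C2u : C2_on D u.
Hypothesis cu : {within K, continuous u}.
Hypothesis cDu : forall i, {within closure Om `\` cballO R0, continuous (Du i)}.
Hypothesis DuE : forall i x, D x -> Du i x = partial i u x.
Hypothesis uf : forall x, D x -> - LaplaceBeltrami h u x = f (enorm x).
Hypothesis uR0 : forall x, enorm x = R0 -> u x = 0.
Hypothesis uphi : forall x, bdry Om x -> u x = phi (enorm x).
Hypothesis ukappa : forall p nu, bdry Om p -> outer_normal h Om p nu ->
  \sum_i Du i p * nu 0 i = kappa (enorm p).
Hypothesis dphi : forall r, R0 < r -> (r%:E < S)%E -> derivable phi r 1.
Hypothesis ckappa : {within [set r | R0 < r /\ (r%:E < S)%E], continuous kappa}.
Hypothesis sign : forall r, R0 < r -> (r%:E < S)%E ->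
  0 <= derive1 phi r - wfun N h f R0 r (phi r).

Implicit Types (x y z p q : E) (r s t k e : R).
Local Notation profile := (radial_profile H F).
Local Notation slope := (radial_slope N h Phi).
Local Notation level := (radial_level phi H F).

Let bdryP p : bdry Om p -> [/\ R0 < enorm p, enorm p <= Rr, ((enorm p)%:E < S)%E, K p &
  p != 0 /\ 0 < h (enorm p)].
Proof.
move=> bp; have [_ _ R0p pR] := bdry_norm oO inO outO bp.
have Kp := bdry_domain oO inO outO bp.
have [p0 pS _ hp] := domain_pos hpos R00 RrS outO Kp.
by split.
Qed.

Let domP x : K x -> [/\ x != 0, b < enorm x, ((enorm x)%:E < S)%E & 0 < enorm x].
Proof.
move=> Kx; have [x0 xS ex _] := domain_pos hpos R00 RrS outO Kx.
by split=> //; have /closed_domainE[_] := Kx; exact: lt_le_trans.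
Qed.

Lemma solution_form x : D x -> D2 u x /\ LBform h u x = - f (enorm x).
Proof.
move=> Dx; have d2 : D2 u x.
  have [[du _] d2u] := C2u; split; last by move=> j; have [+ _] := d2u j; apply.
  have : \forall y \near x, D y.
    by apply: open_nbhs_nbhs; split=> //; exact: open_annular_domain outO.
  by apply: filterS => y; exact: du.
split=> //; have [x0 _ xS _] := domP (domain_sub Dx).
by rewrite -(LaplaceBeltramiE hpos dh x0 xS d2) -uf// opprK.
Qed.

Lemma radial_form (g G s : R -> R) x : K x ->
  (forall r, b < r -> (r%:E < S)%E -> is_derive r 1 g (G r / h r ^+ N.-1) /\
    is_derive r 1 G (h r ^+ N.-1 * s r)) ->
  D2 (fun y => g (enorm y)) x /\ LBform h (fun y => g (enorm y)) x = s (enorm x).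
Proof.
move=> Kx Dg; have [x0 bx xS ex] := domP Kx.
have nr : \forall r \near enorm x, b < r /\ (r%:E < S)%E.
  have [e e0 eS] := lt_ereal_open xS.
  near=> r; split; first by near: r; exact: lt_nbhsr.
  apply: eS; near: r; apply: lt_nbhsl; lra.
apply: (@LBform_radial_flux _ _ h g G) => //.
- by apply: filterS nr => r [br rS]; rewrite gt_eqF// hpos// (lt_trans b0).
- exact: dh.
- by apply: filterS nr => r [br rS]; have [] := Dg r br rS.
- by case: (Dg _ bx xS).
Unshelve. all: end_near. Qed.

Lemma profile_form k x : K x -> D2 (fun y => profile k (enorm y)) x /\
  LBform h (fun y => profile k (enorm y)) x = - f (enorm x).
Proof.
move=> Kx; apply: (@radial_form _ (fun r => k - Phi r) (fun r => - f r)) => // r br rS.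
split; first exact: (is_derive_profile DH DF k br rS).
have [_ D2'] := DF br rS.
by apply: is_derive_eq (is_derive_subf (is_derive_cst k r 1) D2') _; rewrite sub0r mulrN.
Qed.

(** The factor [(-1)] fits [D2_lin] and [ellop_lin]. The opposite difference is a second definition
    of the same shape, so that upper bounds on [u] also come from minimum principles. *)
Definition defect k x := u x + (-1) * profile k (enorm x).
Definition codefect k x := profile k (enorm x) + (-1) * u x.

Lemma codefectE k x : codefect k x = - defect k x.
Proof. rewrite /codefect /defect; ring. Qed.

Lemma defect_form k x : D x -> D2 (defect k) x /\ LBform h (defect k) x = 0.
Proof.
move=> Dx; have [d1 L1] := solution_form Dx; have [d2 L2] := profile_form k (domain_sub Dx).
split; first exact: D2_lin.
by rewrite /LBform ellop_lin// -/(LBform h u x) -/(LBform h _ x) L1 L2; ring.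
Qed.

Lemma codefect_form k x : D x -> D2 (codefect k) x /\ LBform h (codefect k) x = 0.
Proof.
move=> Dx; have [d1 L1] := solution_form Dx; have [d2 L2] := profile_form k (domain_sub Dx).
split; first exact: D2_lin.
by rewrite /LBform ellop_lin// -/(LBform h u x) -/(LBform h _ x) L1 L2; ring.
Qed.

Lemma defect_continuous k : {within K, continuous (defect k)}.
Proof.
apply: within_continuousD => //; apply: within_differentiable => y Ky.
by apply: differentiableZ; have [/D2_differentiable] := profile_form k Ky.
Qed.

Lemma codefect_continuous k : {within K, continuous (codefect k)}.
Proof.
have -> : codefect k = - defect k by apply/funext => x; rewrite codefectE.
by move=> x; apply: cvgN; exact: defect_continuous.
Qed.

Lemma defect_sphere k x : enorm x = R0 -> defect k x = 0.
Proof. by move=> xR; rewrite /defect uR0// xR /radial_profile H0 F0; ring. Qed.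

Lemma defect_bdry k p : bdry Om p -> defect k p = (level (enorm p) - k) * H (enorm p).
Proof.
move=> bp; have [R0p _ pS _ _] := bdryP bp.
have Hp := primitive_gt0 hpos b0 bR0 H0 DH R0p pS.
by rewrite /defect uphi// /radial_profile /radial_level; field; rewrite gt_eqF.
Qed.

Lemma nonneg_by_comparison w : {within K, continuous w} ->
  (forall x, D x -> D2 w x /\ LBform h w x = 0) -> (forall x, enorm x = R0 -> w x = 0) ->
  (forall p, bdry Om p -> 0 <= w p) -> forall x, K x -> 0 <= w x.
Proof.
move=> cw Lw wR wb; apply: (comparison_principle hpos R00 RrS oO outO (psi := psi)) => //.
- move=> x Kx; have [/D2_differentiable//] := @radial_form psi Q (cst 1) x Kx Dpsi.
- by move=> x Dx; apply: (@radial_form psi Q (cst 1)) => //; exact: domain_sub.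
- by move=> x Kx nD; have [//|/wR->//|/wb] := domain_cases oO Kx.
Qed.

Lemma defect_ge0 k : (forall p, bdry Om p -> k <= level (enorm p)) ->
  forall x, K x -> 0 <= defect k x.
Proof.
move=> kl; apply: nonneg_by_comparison.
- exact: defect_continuous.
- exact: defect_form.
- exact: defect_sphere.
- move=> p bp; have [R0p _ pS _ _] := bdryP bp.
  rewrite defect_bdry// mulr_ge0 ?subr_ge0 ?kl//.
  exact: ltW (primitive_gt0 hpos b0 bR0 H0 DH R0p pS).
Qed.

Lemma codefect_ge0 k : (forall p, bdry Om p -> level (enorm p) <= k) ->
  forall x, K x -> 0 <= codefect k x.
Proof.
move=> kl; apply: nonneg_by_comparison.
- exact: codefect_continuous.
- exact: codefect_form.
- by move=> x xR; rewrite codefectE defect_sphere// oppr0.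
- move=> p bp; have [R0p _ pS _ _] := bdryP bp.
  rewrite codefectE defect_bdry// -mulNr opprB mulr_ge0 ?subr_ge0 ?kl//.
  exact: ltW (primitive_gt0 hpos b0 bR0 H0 DH R0p pS).
Qed.

(* The Neumann condition fixes the first-order behaviour where the normal is radial. *)
Lemma defect_expansion k p V rho l : bdry Om p -> local_defining Om p V rho -> 0 < l ->
  grad rho p = l *: p -> forall e, 0 < e -> exists2 d, 0 < d & forall t, 0 < t < d ->
    D (p - t *: ((enorm p)^-1 *: p)) /\
    `|defect k p - defect k (p - t *: ((enorm p)^-1 *: p)) -
      t * (kappa (enorm p) - slope k (enorm p))| <= e * t.
Proof.
move=> bp LD l0 gE e e0; have [R0p _ pS Kp [p0 hp]] := bdryP bp.
have ep : 0 < enorm p by rewrite enorm_gt0.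
have e2 : 0 < e / 2 by rewrite divr_gt0.
have du x : D x -> differentiable u x by have [[+ _] _] := C2u; apply.
have [d1 d10 d1P] := normal_expansion R00 oO inO outO du cu cDu DuE bp LD l0 gE e2.
have [d2 d20 d2P] := is_derive_left_expansion
  (is_derive_profile DH DF k (lt_trans bR0 R0p) pS) e2.
have [d3 d30 d3P] := outer_ray R00 oO inO outO bp LD l0 gE.
have Nk := ukappa bp (outer_normal_radial p0 hp LD l0 gE).
rewrite Nk in d1P.
exists (Num.min d1 (Num.min d2 (Num.min d3 (enorm p)))); first by rewrite !lt_min d10 d20 d30.
move=> t /andP[t0]; rewrite !lt_min => /and4P[t1 t2 t3 tp].
have t0' d : t < d -> 0 < t < d by rewrite t0.
split; first exact/d3P/t0'.
have en : enorm (p - t *: ((enorm p)^-1 *: p)) = enorm p - t.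
  rewrite scalerA -{1}[p]scale1r -scalerBl enormZ ger0_norm.
    by rewrite mulrBl mul1r divfK// gt_eqF.
  by rewrite subr_ge0 ler_pdivrMr// mul1r ltW.
have h1 := d1P t (t0' _ t1); have h2 := d2P t (t0' _ t2).
rewrite /defect en; move: h1 h2; rewrite !ler_norml => /andP[h1 h1'] /andP[h2 h2'].
by apply/andP; split; lra.
Qed.

Lemma defect_flat k p V rho l : bdry Om p -> local_defining Om p V rho -> 0 < l ->
  grad rho p = l *: p -> kappa (enorm p) = slope k (enorm p) ->
  forall e, 0 < e -> exists2 d, 0 < d & forall t, 0 < t < d ->
    `|defect k p - defect k (p - t *: ((enorm p)^-1 *: p))| <= e * t.
Proof.
move=> bp LD l0 gE kE e e0; have [d d0 dP] := defect_expansion k bp LD l0 gE e0.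
by exists d => // t /dP[_]; rewrite kE subrr mulr0 subr0.
Qed.

(** A nonnegative defect that vanishes at [p] has nonnegative inward quotients, and by
    [defect_expansion] these tend to [slope - kappa]. *)
Lemma neumann_le_slope k p V rho l : bdry Om p -> local_defining Om p V rho -> 0 < l ->
  grad rho p = l *: p -> defect k p = 0 -> (forall x, K x -> 0 <= defect k x) ->
  kappa (enorm p) <= slope k (enorm p).
Proof.
move=> bp LD l0 gE w0 wpos; apply/ler_addgt0Pr => e e0.
have [d d0 dP] := defect_expansion k bp LD l0 gE e0.
have t0 : 0 < d / 2 by rewrite divr_gt0.
have [|Dt] := dP (d / 2); first by rewrite t0; lra.
rewrite w0 ler_norml => /andP[+ _]; have := wpos _ (domain_sub Dt).
move: (defect k _) => W W0; move=> h1; rewrite -(ler_pM2l t0); lra.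
Qed.

Lemma slope_le_neumann k p V rho l : bdry Om p -> local_defining Om p V rho -> 0 < l ->
  grad rho p = l *: p -> defect k p = 0 -> (forall x, K x -> 0 <= codefect k x) ->
  slope k (enorm p) <= kappa (enorm p).
Proof.
move=> bp LD l0 gE w0 wpos; apply/ler_addgt0Pr => e e0.
have [d d0 dP] := defect_expansion k bp LD l0 gE e0.
have t0 : 0 < d / 2 by rewrite divr_gt0.
have [|Dt] := dP (d / 2); first by rewrite t0; lra.
rewrite w0 ler_norml => /andP[_ +]; have := wpos _ (domain_sub Dt); rewrite codefectE.
move: (defect k _) => W W0; move=> h1; rewrite -(ler_pM2l t0); lra.
Qed.

Lemma vanishing_defect k : (forall x, D x -> defect k x = 0) ->
  (forall x, K x -> u x = profile k (enorm x)) /\ (forall p, bdry Om p -> level (enorm p) = k).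
Proof.
move=> w0; have wK := zero_on_closure oO inO outO (@defect_continuous k) w0 (@defect_sphere k).
split=> [x Kx|p bp]; first by have := wK x Kx; rewrite /defect; lra.
have [R0p _ pS Kp _] := bdryP bp; have := wK p Kp; rewrite defect_bdry// => /eqP.
rewrite mulf_eq0 subr_eq0 => /orP[/eqP//|].
by rewrite gt_eqF// (primitive_gt0 hpos b0 bR0 H0 DH R0p pS).
Qed.


Definition gap r := wfun N h f R0 r (phi r) - kappa r.

Lemma gapE r : R0 < r -> (r%:E < S)%E -> gap r = slope (level r) r - kappa r.
Proof. by move=> R0r rS; rewrite /gap (wfun_slope _ hpos dh cf b0 bR0 H0 F0 Phi0 DH DF R0r rS). Qed.

Let level_le r s : R0 < r -> r <= s -> (s%:E < S)%E -> level r <= level s.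
Proof. exact: (level_nondecreasing hpos dh cf b0 bR0 H0 F0 Phi0 DH DF dphi sign). Qed.

Let defect_level0 p : bdry Om p -> defect (level (enorm p)) p = 0.
Proof. by move=> bp; rewrite defect_bdry// subrr mul0r. Qed.

Lemma defect_inner_ge0 p1 : bdry Om p1 -> (forall p, bdry Om p -> enorm p1 <= enorm p) ->
  forall x, K x -> 0 <= defect (level (enorm p1)) x.
Proof.
move=> b1 min1; apply: defect_ge0 => p bp; have [R0p _ pS _ _] := bdryP bp.
by have [R1 _ _ _ _] := bdryP b1; apply: level_le => //; exact: min1.
Qed.

Lemma codefect_outer_ge0 p2 : bdry Om p2 -> Om `<=` ballO (enorm p2) ->
  forall x, K x -> 0 <= codefect (level (enorm p2)) x.
Proof.
move=> b2 out2; apply: codefect_ge0 => p bp; have [R0p _ pS _ _] := bdryP bp.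
have [_ _ S2 _ _] := bdryP b2; apply: level_le => //.
by apply: (closure_le out2); have [cp _] := bdry_open oO bp.
Qed.

Lemma gap_inner_ge0 p1 : bdry Om p1 -> (forall p, bdry Om p -> enorm p1 <= enorm p) ->
  ballO (enorm p1) `<=` Om -> 0 <= gap (enorm p1).
Proof.
move=> b1 min1 in1; have [R1 _ S1 _ [p0 _]] := bdryP b1.
have [V [rho LD]] := bO b1; have [l l0 gE] := normal_of_inner_ball oO LD b1 p0 in1.
rewrite gapE// subr_ge0; apply: (neumann_le_slope b1 LD l0 gE); first exact: defect_level0.
exact: defect_inner_ge0.
Qed.

Lemma gap_outer_le0 p2 : bdry Om p2 -> Om `<=` ballO (enorm p2) -> gap (enorm p2) <= 0.
Proof.
move=> b2 out2; have [R2 _ S2 _ [p0 _]] := bdryP b2.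
have [V [rho LD]] := bO b2; have [l l0 gE] := normal_of_outer_ball oO LD b2 p0 out2.
rewrite gapE// subr_le0; apply: (slope_le_neumann b2 LD l0 gE); first exact: defect_level0.
exact: codefect_outer_ge0.
Qed.

Lemma gap_zero r1 r2 : R0 < r1 -> r1 <= r2 -> (r2%:E < S)%E -> 0 <= gap r1 -> gap r2 <= 0 ->
  exists2 r0, r1 <= r0 <= r2 & gap r0 = 0.
Proof.
move=> R1 r12 S2 g1 g2.
have inI r : r1 <= r <= r2 -> R0 < r /\ (r%:E < S)%E.
  move=> /andP[h1 h2]; split; first exact: lt_le_trans h1.
  by apply: le_lt_trans S2; rewrite lee_fin.
(* Continuity is available for this expression; it coincides with [gap] on the interval at hand. *)
pose G r := slope (level r) r - kappa r.
have GE r : r1 <= r <= r2 -> gap r = G r by move=> /inI[Rr' rS]; exact: gapE.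
have cG : {within `[r1, r2], continuous G}.
  move=> r; apply: cvgB.
    move: r; apply: continuous_within_segment => r /inI[h1 h2].
    exact: (continuous_slope_level hpos dh b0 bR0 H0 DH DF dphi h1 h2).
  move: r; apply: continuous_subspaceW ckappa => r; rewrite /= in_itv /=; exact: inI.
rewrite GE ?lexx// in g1; rewrite GE ?lexx ?r12// in g2.
have [|c] := @IVT _ G r1 r2 0 r12 cG; first by rewrite ge_min le_max g1 g2 orbT.
by rewrite in_itv /= => cI Gc; exists c => //; rewrite GE.
Qed.

(** The interior ball for Hopf's lemma is found inside the ball of radius [|p1|] about the pole,
    tangent to it at [p1]. *)
Lemma inner_rigidity p1 : bdry Om p1 -> (forall p, bdry Om p -> enorm p1 <= enorm p) ->
  ballO (enorm p1) `<=` Om -> gap (enorm p1) = 0 ->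
  forall x, D x -> defect (level (enorm p1)) x = 0.
Proof.
move=> b1 min1 in1 g0; have [R1 _ S1 _ [p0 _]] := bdryP b1.
have ep : 0 < enorm p1 by rewrite enorm_gt0.
have [V [rho LD]] := bO b1; have [l l0 gE] := normal_of_inner_ball oO LD b1 p0 in1.
pose s := (enorm p1 - R0) / 4.
have s0 : 0 < s by rewrite divr_gt0// subr_gt0.
have s4 : 4 * s <= enorm p1 - R0 by rewrite /s; lra.
apply: (hopf_rigidity hpos dh ddh N2 R00 RrS oO cO inO outO b1 s0 s4).
- move=> x xs; apply: in1; rewrite /ballO /=.
  have := enormD (x - (1 - s / enorm p1) *: p1) ((1 - s / enorm p1) *: p1).
  rewrite subrK enormZ ger0_norm; last first.
    by rewrite subr_ge0 ler_pdivrMr// mul1r; move: s4 s0 R00; lra.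
  by rewrite mulrBl mul1r divfK ?gt_eqF//; move: xs; lra.
- exact: defect_continuous.
- exact: defect_form.
- exact: defect_inner_ge0.
- exact: defect_level0.
- apply: (defect_flat b1 LD l0 gE); apply/esym/eqP; rewrite -subr_eq0 -gapE//.
  exact/eqP.
Qed.

(** The tangent ball may touch the outer sphere at a point [p] other than [p2]. This [p] is a limit
    of points of [Om] with maximal norm, so it is a boundary point, and it has the same data because
    they depend on the norm alone. *)
Lemma outer_rigidity p2 : bdry Om p2 -> Om `<=` ballO (enorm p2) ->
  interior_sphere S h Om p2 -> gap (enorm p2) = 0 ->
  forall x, D x -> defect (level (enorm p2)) x = 0.
Proof.
move=> b2 out2 ball2 g0; have [R2 _ S2 _ _] := bdryP b2.
have [p [s [pE s0 s4 ballp]]] := interior_sphere_touch dh R00 R2 S2 out2 erefl ball2.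
rewrite -pE in s4 ballp out2 g0 R2 S2 *.
have ep : 0 < enorm p by exact: lt_trans R2.
have p0 : p != 0 by rewrite -enorm_gt0.
have bp : bdry Om p.
  apply: (open_bdry oO); last by move=> /out2; rewrite /ballO /= ltxx.
  apply/closure_enormP => e e0.
  have [t [t0]] := pos_below2 (divr_gt0 s0 ep) (divr_gt0 e0 ep).
  rewrite !ltr_pdivlMr// => ts te; exists ((1 - t) *: p); last first.
    by rewrite scalerBl scale1r addrAC subrr add0r enormN enormZ gtr0_norm.
  have tp : 0 < t * enorm p by rewrite mulr_gt0.
  apply: ballp; rewrite -scalerBl enormZ opprB addrC subrKA.
  rewrite ger0_norm; first by rewrite mulrBl divfK ?gt_eqF//; lra.
  by rewrite subr_ge0 ler_pdivlMr// ltW.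
have [V [rho LD]] := bO bp; have [l l0 gE] := normal_of_outer_ball oO LD bp p0 out2.
have w0 := hopf_rigidity hpos dh ddh N2 R00 RrS oO cO inO outO bp s0 s4 ballp
  (@codefect_continuous (level (enorm p))) (@codefect_form (level (enorm p)))
  (@codefect_outer_ge0 p bp out2).
move=> x Dx; apply: oppr_inj; rewrite oppr0 -codefectE; apply: w0 => //.
  by rewrite codefectE defect_level0// oppr0.
move=> e e0; have kE : kappa (enorm p) = slope (level (enorm p)) (enorm p).
  by apply/esym/eqP; rewrite -subr_eq0 -gapE//; exact/eqP.
have [d d0 dP] := defect_flat bp LD l0 gE kE e0; exists d => // t /dP.
by rewrite !codefectE -opprD normrN.
Qed.


(** * Consequences of coincidence with a radial solution *)

Section Vanishing.
Variable k : R.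
Hypothesis w0 : forall x, D x -> defect k x = 0.
Hypothesis g0 : forall p, bdry Om p -> gap (enorm p) = 0.

Let slope_kappa p : bdry Om p -> slope k (enorm p) = kappa (enorm p).
Proof.
move=> bp; have [R0p _ pS _ _] := bdryP bp; have [_ lE] := vanishing_defect w0.
by have := g0 bp; rewrite gapE// lE// => /eqP; rewrite subr_eq0 => /eqP.
Qed.

(* Where [kappa] is not zero, a non-radial normal would see too small a normal derivative. *)
Lemma boundary_aligned p V rho : bdry Om p -> local_defining Om p V rho ->
  kappa (enorm p) != 0 -> exists l, grad rho p = l *: p.
Proof.
move=> bp LD kp; have [R0p _ pS Kp [p0 hp]] := bdryP bp.
have [nu On al] := outer_normal_aligned p0 hp LD; apply: al.
have ep : 0 < enorm p by rewrite enorm_gt0.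
have bR r : R0 < r <= Rr -> b < r /\ (r%:E < S)%E.
  move=> /andP[h1 h2]; split; first exact: lt_trans h1.
  by apply: le_lt_trans RrS; rewrite lee_fin.
have DuP i : Du i p = slope k (enorm p) * (p 0 i / enorm p).
  apply: (boundary_gradient_radial R00 oO inO outO cDu DuE (v := profile k) (dv := slope k) bp).
  - by move=> r /bR[h1 h2]; exact: (is_derive_profile DH DF k h1 h2).
  - by move=> r /bR[h1 h2]; exact: (continuous_slope hpos dh b0 DF h1 h2).
  - by move=> x Dx; have := w0 Dx; rewrite /defect; lra.
(* The Neumann condition reads [slope * (dot p nu / |p|) = slope]; cancelling the nonzero slope
   gives the equality case [dot p nu = |p|]. *)
have := ukappa bp On; rewrite -(slope_kappa bp) in kp *.
under eq_bigr do rewrite DuP.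
have -> : \sum_i slope k (enorm p) * (p 0 i / enorm p) * nu 0 i =
    slope k (enorm p) * (dot p nu / enorm p).
  rewrite /dot mulr_suml mulr_sumr; apply: eq_bigr => i _; ring.
rewrite -[RHS]mulr1 => /(mulfI kp) dE.
by rewrite -[LHS](divfK (lt0r_neq0 ep)) dE mul1r.
Qed.

Lemma ball_of_flux : (forall r, R0 < r -> (r%:E < S)%E -> kappa r != 0) ->
  exists2 r, R0 <= r & Om = ballO r.
Proof.
move=> k0; apply: (ball_of_radial_normals R00 oO _ outO _ N2 cO).
  by move=> x; rewrite /ballO /= => /ltW; exact: inO.
move=> p bp; have [V [rho LD]] := bO bp; exists V, rho; split=> //.
by have [R0p _ pS _ _] := bdryP bp; apply: boundary_aligned LD _ => //; exact: k0.
Qed.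

Lemma ball_of_source : (forall a c, R0 <= a -> a < c -> (c%:E <= S)%E ->
    ~ (forall t, a < t < c -> f t = 0)) ->
  exists2 r, R0 <= r & Om = ballO r.
Proof.
move=> f0; apply: (ball_of_radial_normals R00 oO _ outO _ N2 cO).
  by move=> x; rewrite /ballO /= => /ltW; exact: inO.
move=> p bp; have [V [rho LD]] := bO bp; exists V, rho; split=> //.
apply: contrapT => nl; have np l : grad rho p <> l *: p by move=> lE; apply: nl; exists l.
have [R0p _ pS _ [p0 _]] := bdryP bp; have [oV Vp C1 gn rA] := LD.
have [e e0 eP] := gram_near C1 Vp (gram_gt0 p0 np).
have [m [e1 [e10 pm radii]]] := nonradial_normal_radii oO LD bp p0 np e0.
have sl r : `|r - m| < e1 -> slope k r = 0 /\ (r%:E < S)%E.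
  move=> /radii[x [bx <- Vx xp]]; have [_ _ xS _ _] := bdryP bx; split=> //.
  rewrite slope_kappa//; apply/eqP/negPn/negP => kx.
  have LDx : local_defining Om x V rho by split.
  have [l lE] := boundary_aligned bx LDx kx.
  by have := eP x Vx xp; rewrite lE gram_parallel ltxx.
(* The interval begins at [m], which is at least [|p|], so it lies beyond [R0]. *)
have me : m < m + e1 / 2 by rewrite ltrDl divr_gt0.
have meS : ((m + e1 / 2)%:E < S)%E.
  by have [|_] := sl (m + e1 / 2); first by rewrite addrAC subrr add0r gtr0_norm; lra.
apply: (f0 m (m + e1 / 2)) => //.
- exact/ltW/(lt_le_trans R0p).
- exact: ltW.
- move=> t; apply: (source_zero hpos b0 DF (k := k)) => //.
    by apply: lt_le_trans pm; exact: lt_trans R0p.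
  by move=> r /andP[h1 h2]; have [] := sl r; rewrite ?gtr0_norm; lra.
Qed.

(** When the defect vanishes identically both one-sided comparisons hold, hence equality. Used at
    the two extreme radii, between which a monotone gap is then squeezed to zero. *)
Lemma gap_vanishing p V rho l : bdry Om p -> local_defining Om p V rho -> 0 < l ->
  grad rho p = l *: p -> gap (enorm p) = 0.
Proof.
move=> bp LD l0 gE; have [R0p _ pS Kp _] := bdryP bp; have [uE lE] := vanishing_defect w0.
have dK x : K x -> defect k x = 0 by move=> /uE; rewrite /defect; lra.
rewrite gapE// lE//; apply/eqP; rewrite subr_eq0 eq_le.
rewrite (slope_le_neumann bp LD l0 gE) ?dK//=; last first.
  by move=> x Kx; rewrite codefectE dK// oppr0.
by apply: (neumann_le_slope bp LD l0 gE) => [|x Kx]; rewrite dK.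
Qed.

End Vanishing.

Let inS r := R0 < r /\ (r%:E < S)%E.

Lemma rigidity p1 p2 : bdry Om p1 -> (forall p, bdry Om p -> enorm p1 <= enorm p) ->
  ballO (enorm p1) `<=` Om -> bdry Om p2 -> Om `<=` ballO (enorm p2) ->
  (forall r0, inS r0 -> gap r0 = 0 -> forall r, R0 < r <= r0 -> gap r <= 0) \/
  (forall r0, inS r0 -> gap r0 = 0 -> forall r, r0 <= r -> (r%:E < S)%E -> 0 <= gap r) /\
    (forall p, bdry Om p -> interior_sphere S h Om p) ->
  exists k, forall x, D x -> defect k x = 0.
Proof.
move=> b1 min1 in1 b2 out2 cond; have [R1 _ S1 _ _] := bdryP b1; have [R2 _ S2 _ _] := bdryP b2.
have g1 := gap_inner_ge0 b1 min1 in1; have g2 := gap_outer_le0 b2 out2.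
have [r0 /andP[r10 r02] g0] := gap_zero R1 (min1 _ b2) S2 g1 g2.
have r0S : inS r0.
  by split; [exact: lt_le_trans r10|apply: le_lt_trans S2; rewrite lee_fin].
case: cond => [c1|[c2 ball]].
  exists (level (enorm p1)); apply: inner_rigidity => //.
  by apply/le_anti; rewrite g1 (c1 r0)// R1.
exists (level (enorm p2)); apply: outer_rigidity => //; first exact: ball.
by apply/le_anti; rewrite g2 (c2 r0).
Qed.

Lemma ball_of_rigidity p1 p2 k : bdry Om p1 -> (forall p, bdry Om p -> enorm p1 <= enorm p) ->
  ballO (enorm p1) `<=` Om -> bdry Om p2 -> Om `<=` ballO (enorm p2) ->
  (forall x, D x -> defect k x = 0) ->
  let mono := (forall r s, inS r -> inS s -> r <= s -> gap s <= gap r) \/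
              (forall r s, inS r -> inS s -> r <= s -> gap r <= gap s) in
  [\/ forall r, inS r -> 0 < derive1 phi r - wfun N h f R0 r (phi r),
      mono /\ (forall r, inS r -> kappa r != 0) |
      mono /\ (forall a c, R0 <= a -> a < c -> (c%:E <= S)%E ->
                 ~ (forall t, a < t < c -> f t = 0))] ->
  exists2 r, R0 <= r & Om = ballO r.
Proof.
move=> b1 min1 in1 b2 out2 w0 mono cond.
have [R1 _ S1 _ [p10 _]] := bdryP b1; have [R2 _ S2 _ [p20 _]] := bdryP b2.
have [_ lE] := vanishing_defect w0.
have gap0 : mono -> forall p, bdry Om p -> gap (enorm p) = 0.
  have [V1 [rho1 LD1]] := bO b1; have [l1 l10 gE1] := normal_of_inner_ball oO LD1 b1 p10 in1.
  have [V2 [rho2 LD2]] := bO b2; have [l2 l20 gE2] := normal_of_outer_ball oO LD2 b2 p20 out2.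
  have z1 := gap_vanishing w0 b1 LD1 l10 gE1; have z2 := gap_vanishing w0 b2 LD2 l20 gE2.
  move=> mon p bp; have [Rp _ pS _ _] := bdryP bp.
  have p2p : enorm p <= enorm p2 by apply: (closure_le out2); have [] := bdry_open oO bp.
  have p1p := min1 p bp; apply/le_anti; apply/andP.
  case: mon => mon.
    by rewrite -{1}z1 -z2; split; apply: mon.
  by rewrite -{1}z2 -z1; split; apply: mon.
case: cond => [pos|[mon k0]|[mon f0]].
- exists (enorm p1); first exact: ltW.
  apply: ball_of_equal_radii in1 out2 _.
  have p12 := min1 p2 b2; move: p12; rewrite le_eqVlt => /predU1P[//|p12].
  have := level_increasing hpos dh cf b0 bR0 H0 F0 Phi0 DH DF dphi
    (fun t h1 h2 => pos t (conj h1 h2)) R1 p12 S2.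
  by rewrite !lE// ltxx.
- by apply: (ball_of_flux w0 (gap0 mon)) => r h1 h2; exact: k0.
- exact: (ball_of_source w0 (gap0 mon) f0).
Qed.

End Overdetermined.

Unset Implicit Arguments. Set Strict Implicit. Set Printing Implicit Defensive.

Theorem theorem1p2 (R : realType) (N : nat) (S : \bar R) (h : R -> R)
  (R0 Rr : R) (Omega : set 'rV[R]_N) (f phi kappa : R -> R)
  (u : 'rV[R]_N -> R) :
  (2 <= N)%N ->
  (0 < S)%E ->
  model_warping S h ->
  0 < R0 -> (R0%:E < S)%E -> 0 < Rr -> (Rr%:E < S)%E ->
  C1_domain Omega ->
  cballO R0 `<=` Omega -> Omega `<=` ballO Rr ->
  {within [set r | R0 <= r /\ (r%:E < S)%E], continuous f} ->
  (forall r, R0 < r -> (r%:E < S)%E -> derivable phi r 1) ->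
  {within [set r | R0 < r /\ (r%:E < S)%E], continuous (derive1 phi)} ->
  {within [set r | R0 < r /\ (r%:E < S)%E], continuous kappa} ->
  (* regularity of the solution u *)
  C2_on (Omega `\` cballO R0) u ->
  (exists Du : 'I_N -> 'rV[R]_N -> R,
     (forall i, {within closure Omega `\` cballO R0, continuous (Du i)}) /\
     (forall i x, (Omega `\` cballO R0) x -> Du i x = partial i u x) /\
     (* the Neumann condition u_nu = kappa(r) on the boundary of Omega *)
     (forall p nu, bdry Omega p -> outer_normal h Omega p nu ->
        \sum_i Du i p * nu 0 i = kappa (enorm p))) ->
  {within closure Omega `\` ballO R0, continuous u} ->
  (* the equation and the Dirichlet conditions *)
  (forall x, (Omega `\` cballO R0) x -> - LaplaceBeltrami h u x = f (enorm x)) ->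
  (forall x : 'rV[R]_N, enorm x = R0 -> u x = 0) ->
  (forall x, bdry Omega x -> u x = phi (enorm x)) ->
  (* sign assumption *)
  (forall r, R0 < r -> (r%:E < S)%E -> derive1 phi r - wfun N h f R0 r (phi r) >= 0) ->
  let Z := fun r => wfun N h f R0 r (phi r) - kappa r in
  let I := fun r => R0 < r /\ (r%:E < S)%E in
  let cond1 := forall r0, I r0 -> Z r0 = 0 -> forall r, R0 < r <= r0 -> Z r <= 0 in
  let cond2 := (forall r0, I r0 -> Z r0 = 0 -> forall r, r0 <= r -> (r%:E < S)%E -> Z r >= 0)
               /\ (forall p, bdry Omega p -> interior_sphere S h Omega p) in
  let monZ := (forall x y, I x -> I y -> x <= y -> Z y <= Z x) \/
              (forall x y, I x -> I y -> x <= y -> Z x <= Z y) in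
  let ca := forall r, I r -> derive1 phi r - wfun N h f R0 r (phi r) > 0 in
  let cb := monZ /\ (forall r, I r -> kappa r != 0) in
  let cc := monZ /\ (forall a b, R0 <= a -> a < b -> (b%:E <= S)%E ->
                       ~ (forall t, a < t < b -> f t = 0)) in
  [/\ exists r0, I r0 /\ Z r0 = 0,
      cond1 \/ cond2 -> radial_on (closure Omega `\` ballO R0) u &
      (cond1 \/ cond2) -> (ca \/ cb \/ cc) ->
        exists q rho, Mset S q /\ 0 < rho /\ Omega = gball S h q rho].

Proof.
move=> N2 _ [[delta [delta0 dn]] hpos _ _] R00 R0S Rr0 RrS [oO cO _ bO] inO outO cf dphi _ ckappa.
move=> C2u [Du [cDu [DuE ukappa]]] cu uf uR0 uphi sgn Z I cond1 cond2 monZ ca cb cc.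
have dh r : 0 < r -> (r%:E < S)%E -> derivable h r 1.
  by move=> r0; apply: (dn 0%N); rewrite (lt_trans _ r0)// oppr_lt0.
have ddh r : 0 < r -> (r%:E < S)%E -> derivable (derive1 h) r 1.
  by move=> r0; apply: (dn 1%N); rewrite (lt_trans _ r0)// oppr_lt0.
(* The equation and [wfun] see the source only from [R0] on, so [f] may be replaced by this
   extension. *)
pose g t := f (Num.max R0 t).
have fg t : R0 <= t -> f t = g t by move=> Rt; rewrite /g max_r.
have cg r : 0 < r -> (r%:E < S)%E -> {for r, continuous g}.
  by move=> _; exact: (continuous_max_extension R0S cf).
have wg r : wfun N h f R0 r (phi r) = wfun N h g R0 r (phi r) by exact: wfun_ext.
have [F [Phi [b1 [b10 b1R F0 Phi0 DF]]]] := radial_system N R00 R0S hpos dh cg.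
have c1 r : 0 < r -> (r%:E < S)%E -> {for r, continuous (fun=> 1 : R)}.
  by move=> _ _; exact: cst_continuous.
(* The same construction with source 1 yields the function that makes the equation strict in
   [comparison_principle]. *)
have [psi [Q [b2 [b20 b2R _ _ Dpsi]]]] := radial_system N R00 R0S hpos dh c1.
have [H [b3 [b30 b3R H0 DH]]] : exists H b, [/\ 0 < b, b < R0, H R0 = 0 &
    forall r, b < r -> (r%:E < S)%E -> is_derive r 1 H (h r ^+ N.-1)^-1].
  apply: primitive_exists => // r r0 rS.
  have Dh : is_derive r 1 h (derive1 h r) by exact/derivable_derive1/dh.
  apply: continuousV; first by rewrite expf_neq0// gt_eqF// hpos.
  exact: is_derive_continuous (is_derive_expf Dh _).
(* One common left endpoint, still below [R0], for the three families of primitives. *)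
pose b := Num.max b1 (Num.max b2 b3).
have b0 : 0 < b by rewrite lt_max b10.
have bR0 : b < R0 by rewrite !gt_max b1R b2R.
have bP r : b < r -> [/\ b1 < r, b2 < r & b3 < r] by rewrite !gt_max => /and3P[].
have {}DF r : b < r -> (r%:E < S)%E -> is_derive r 1 F (Phi r / h r ^+ N.-1) /\
    is_derive r 1 Phi (h r ^+ N.-1 * g r).
  by move=> /bP[br _ _]; exact: DF.
have {}Dpsi r : b < r -> (r%:E < S)%E -> is_derive r 1 psi (Q r / h r ^+ N.-1) /\
    is_derive r 1 Q (h r ^+ N.-1 * 1).
  by move=> /bP[_ br _]; exact: Dpsi.
have {}DH r : b < r -> (r%:E < S)%E -> is_derive r 1 H (h r ^+ N.-1)^-1.
  by move=> /bP[_ _ br]; exact: DH.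
have {}uf x : (Omega `\` cballO R0) x -> - LaplaceBeltrami h u x = g (enorm x).
  by move=> Dx; rewrite uf// fg//; have /annular_domainE[_ /ltW] := Dx.
have {}sgn r : R0 < r -> (r%:E < S)%E -> 0 <= derive1 phi r - wfun N h g R0 r (phi r).
  by rewrite -wg; exact: sgn.
have ZE : Z = gap N h g phi kappa R0 by apply/funext => r; rewrite /Z wg.
have [p2 [bd2 out2]] := exists_outer_radius N2 R00 oO inO outO.
have [p1 [bd1 min1 in1]] := exists_inner_radius R00 oO inO outO bd2.
have DuE' i x : (Omega `\` cballO R0) x -> Du i x = partial i u x by exact: DuE.
have norms p : bdry Omega p -> R0 < enorm p /\ ((enorm p)%:E < S)%E.
  move=> bp; have [_ _ h1 h2] := bdry_norm oO inO outO bp; split; first exact: h1.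
  by apply: le_lt_trans RrS; rewrite lee_fin.
have [R1 S1] := norms _ bd1; have [R2 S2] := norms _ bd2.
have g1 := gap_inner_ge0 hpos dh N2 R00 RrS cg b0 bR0 H0 F0 Phi0 DH DF Dpsi oO inO outO bO C2u cu
  cDu DuE' uf uR0 uphi ukappa dphi sgn bd1 min1 in1.
have g2 := gap_outer_le0 hpos dh N2 R00 RrS cg b0 bR0 H0 F0 Phi0 DH DF Dpsi oO inO outO bO C2u cu
  cDu DuE' uf uR0 uphi ukappa dphi sgn bd2 out2.
have rigid : cond1 \/ cond2 -> exists k, forall x, (Omega `\` cballO R0) x ->
    defect H F u k x = 0.
  rewrite /cond1 /cond2 ZE.
  exact: (rigidity hpos dh ddh N2 R00 RrS cg b0 bR0 H0 F0 Phi0 DH DF Dpsi oO cO inO outO bO C2u cu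
    cDu DuE' uf uR0 uphi ukappa dphi ckappa sgn bd1 min1 in1 bd2 out2).
split.
- have [r0 /andP[r10 r02] z0] := gap_zero hpos dh cg b0 bR0 H0 F0 Phi0 DH DF dphi ckappa R1
    (min1 _ bd2) S2 g1 g2.
  exists r0; rewrite ZE; split; last exact: z0.
  split; first exact: lt_le_trans r10.
  by apply: le_lt_trans S2; rewrite lee_fin.
- move=> /rigid[k w0]; exists (radial_profile H F k).
  by have [] := vanishing_defect hpos dh N2 R00 RrS b0 bR0 H0 F0 DH DF oO inO outO cu uR0 uphi w0.
- move=> /rigid[k w0] cond.
  have [|r rR OE] := ball_of_rigidity hpos dh N2 R00 RrS cg b0 bR0 H0 F0 Phi0 DH DF oO cO inO outO
    bO C2u cu cDu DuE' uR0 uphi ukappa dphi bd1 min1 in1 bd2 out2 w0.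
    rewrite -/I -ZE; case: cond => [pos|[[mon k0]|[mon f0]]].
    - by apply: Or31 => r rI; rewrite -wg; exact: pos.
    - by apply: Or32; split.
    - apply: Or33; split; [exact: mon|move=> a c Ra ac cS ga].
      apply: (f0 a c Ra ac cS) => t tI; rewrite fg; first exact: ga.
      by case/andP: tI => at_ _; apply: le_trans Ra _; exact: ltW.
  exact: (geodesic_ball_of_ball h R00 R0S RrS outO OE (lt_le_trans R00 rR)).
Qed.
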